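(* Let $N$ be an odd positive integer and $\alpha,\beta>0$ such that $\alpha\beta^{N}=\pi^{N+1}$. Then for any non-zero integer $m$, $$\begin{aligned}&\alpha^{-\left( \frac{2Nm+N-1}{N+1}\right) }\left(\frac{1}{2}\zeta(2Nm+N)+\sum_{n=1}^{\infty}\frac{n^{-2Nm-N}}{\exp\left((2n)^{N}\alpha\right)-1}\right)\\ &=(-1)^m \beta^{-\left( \frac{2Nm+N-1}{N+1}\right) }\frac{2^{(N-1)\left(2m+1-\frac1N\right)}}{N}\Bigg(\frac{1}{2}\frac{\zeta\left(2m+2-\frac1N\right)}{\sin\left(\frac{\pi}{2N} \right) }+\sum_{j=-\frac{N-1}{2}}^{\frac{N-1}{2}}e^{\frac{\pi ij}{N}}\sum_{n=1}^{\infty}\frac{n^{-2m-2+\frac1N}}{\exp\left((2n)^{\frac{1}{N}}\beta e^{\frac{i\pi j}{N}}\right)-1}\Bigg)\\ &\quad+(-1)^{m}2^{2Nm+N-1}\sum_{j=0}^{m+1}\frac{(-1)^jB_{2j}B_{2N(m-j+1)}}{(2j)!(2N(m-j+1))!}\alpha^{\frac{2j}{N+1}}\beta^{\frac{2N^2(m-j+1)}{N+1}}.\end{aligned}$$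
   Context: $\zeta$ is the (analytically continued) Riemann zeta function and $B_j$ are the Bernoulli numbers ($\frac{t}{e^t-1}=\sum_{j\ge0}B_jt^j/j!$). A sum whose upper limit is less than its lower limit is empty and equals $0$. *)

(* Defs.v *)
From Stdlib Require Import Reals ZArith.
From Coquelicot Require Import Coquelicot.

Local Open Scope R_scope.

Definition Cexp (z : C) : C :=
  (exp (Re z) * cos (Im z), exp (Re z) * sin (Im z)).

(* Meaningful when the real and imaginary parts are summable, i.e. under
   [ex_series (K := C_AbsRing) (V := C_NormedModule) a]. *)
Definition CSeries (a : nat -> C) : C :=
  (Series (fun n => Re (a n)), Series (fun n => Im (a n))).

(* f a + f (a + 1) + ... + f b, which is 0 if b < a. *)
Definition Csum_Z (f : Z -> C) (a b : Z) : C :=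
  sum_n_m (G := C_AbelianMonoid) (fun k : nat => f (a + Z.of_nat k - 1)%Z)
    1 (Z.to_nat (b - a + 1)).

(* Near z0, f is the sum of a convergent power series in z - z0. *)
Definition C_analytic_at (f : C -> C) (z0 : C) : Prop :=
  exists a : nat -> C,
    locally (T := C_UniformSpace) z0
      (fun z => is_pseries (K := C_AbsRing) (V := C_NormedModule)
                  a (z - z0)%C (f z)).

(* The Dirichlet series over n >= 1 on Re s > 1, continued analytically to
   C \ {1}. Since C \ {1} is connected, this determines zeta there; the value
   at 1 is left free. *)
Definition is_riemann_zeta (zeta : C -> C) : Prop :=
  (forall s : C, 1 < Re s ->
     is_series (K := C_AbsRing) (V := C_NormedModule)
       (fun n => Cexp (- s * RtoC (ln (INR (S n))))%C) (zeta s)) /\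
  (forall s : C, s <> RtoC 1 -> C_analytic_at zeta s).

(* t / (e^t - 1) = sum_j B_j t^j / j! for all small t <> 0. *)
Definition is_bernoulli (B : nat -> R) : Prop :=
  locally' 0
    (fun t => is_pseries (fun j => B j / INR (fact j)) t (t / (exp t - 1))).

(* Main.v *)
(** Put u = ((2n)^N alpha)^2 and v = (2 pi k)^2.  By the partial fractions of coth,
    1/2 + 1/(e^x - 1) at x = (2n)^N alpha is (1 + 2 sum_k u/(u+v)) / x, and, by the
    identity sum_w 1/(1 + a w) = N/(1 + a^N) over the N-th roots of unity w, the sum
    over j on the right is a multiple of 1 + 2 sum_n v/(u+v).  So the theorem relates
    sum_(n,k) u^(-m)/(u+v) to sum_(n,k) v^(-m)/(u+v).  For m >= 1 everything converges
    absolutely: (u^(-m) - (-v)^(-m))/(u+v) is a sum of products u^(-a) v^(-b), which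
    give the Bernoulli terms.

    For m < 0 the sums over k (or over n) of v^(-m)/(u+v) diverge and zeta is taken
    outside Re s > 1.  The alternating versions of the sums are treated by Euler
    summation, which continues (1 - 2^(1-s)) zeta(s) analytically.  Alternation in k
    shows that the (normalised) defect of the formula is multiplied by 2^(-2m-1) when alpha is
    doubled, alternation in n that it is halved when alpha is multiplied by 2^N; hence
    it vanishes. *)

Require Import Defs.
From Stdlib Require Import Reals ZArith Lra Lia FunctionalExtensionality.
From Coquelicot Require Import Coquelicot.

Set Bullet Behavior "Strict Subproofs".

Local Open Scope R_scope.

(** The relation between alpha and beta serves to eliminate beta: everything becomes a function of
    the single parameter c = 2^N alpha, which can then be dilated freely.

    For m = -p < 0 no direct exchange of the two summations is available. What can be justified is a
    mixed exchange, in which one variable is summed by Euler's method and the other in the ordinary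
    sense. Euler's method fits because it is linear, stops after finitely many differences, asks
    absolute convergence only of the last differences, and evaluates polynomials: the alternating
    sum of n^d over n >= 1, d even, is 1/2 for d = 0 and 0 otherwise (the trivial zeros of zeta).
    The lone 1/2 is the origin of the term B_0 B_0 at m = -1, the only Bernoulli term for m < 0.

    Such an exchange compares the two sides only at c and at a dilate of c. One dilation alone would
    admit a defect that is a power of c times a log-periodic function; the second one, with an
    incompatible scalar, excludes it. *)

(** * Real series and the interchange of double series *)

Lemma ex_series_bound (a b : nat -> R) :
  (forall n, Rabs (a n) <= b n) -> ex_series b -> ex_series a.
Proof.
  intros Hab Hb. apply (ex_series_le (K := R_AbsRing) (V := R_CompleteNormedModule) a b); auto.
Qed.

Lemma is_series_nonneg_le (a : nat -> R) (M : R) :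
  (forall n, 0 <= a n) -> (forall n, sum_n a n <= M) ->
  ex_series a /\ Series a <= M.
Proof.
  intros Ha HM.
  destruct (ex_finite_lim_seq_incr (sum_n a) M) as [l Hl].
  - intros n. rewrite sum_Sn. unfold plus; simpl. specialize (Ha (S n)). lra.
  - exact HM.
  - split.
    + exists l. exact Hl.
    + rewrite (is_series_unique a l Hl).
      apply (is_lim_seq_le (sum_n a) (fun _ => M) l M); auto. apply is_lim_seq_const.
Qed.

Lemma pow_m1_sqr (n : nat) : (-1) ^ n * (-1) ^ n = 1.
Proof. rewrite <- Rpow_mult_distr. replace (-1 * -1) with 1 by ring. apply pow1. Qed.

Lemma Rinv_ge_0 (x : R) : 0 < x -> 0 <= / x.
Proof. intros H. now apply Rlt_le, Rinv_0_lt_compat. Qed.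

Lemma is_series_zero (a : nat -> R) : (forall n, a n = 0) -> is_series a 0.
Proof.
  intros H. apply is_series_ext with (fun _ => 0); [now intros; rewrite H|].
  apply is_series_Reals. intros e He. exists 0%nat. intros n _.
  rewrite sum_cte, Rmult_0_l. unfold Rdist. now rewrite Rminus_0_r, Rabs_R0.
Qed.

Lemma Series_zero (a : nat -> R) : (forall n, a n = 0) -> Series a = 0.
Proof. intros H. now apply is_series_unique, is_series_zero. Qed.

Lemma Series_nonneg (a : nat -> R) :
  (forall k, 0 <= a k) -> ex_series a -> 0 <= Series a.
Proof.
  intros Ha He. rewrite <- (Series_zero (fun _ => 0)) by reflexivity.
  apply Series_le; auto. intros k. split; [lra|auto].
Qed.

Lemma sum_n_le_Series (a : nat -> R) (N : nat) :
  (forall k, 0 <= a k) -> ex_series a -> sum_n a N <= Series a.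
Proof.
  intros Ha He. rewrite (Series_incr_n a (S N)) by (lia || auto).
  rewrite sum_n_Reals. simpl pred.
  assert (0 <= Series (fun k => a (S N + k)%nat)).
  { apply Series_nonneg. auto. apply (ex_series_incr_n a); auto. }
  lra.
Qed.

Lemma term_le_Series (a : nat -> R) (n : nat) :
  (forall k, 0 <= a k) -> ex_series a -> a n <= Series a.
Proof.
  intros Ha He. apply Rle_trans with (sum_n a n); [|now apply sum_n_le_Series].
  destruct n as [|n]; [rewrite sum_O; lra|]. rewrite sum_Sn, sum_n_Reals.
  assert (0 <= sum_f_R0 a n) by (apply cond_pos_sum; auto).
  unfold plus; simpl. lra.
Qed.

Lemma is_series_sum_n (a : nat -> nat -> R) (N : nat) :
  (forall k, ex_series (fun n => a n k)) ->
  is_series (fun n => sum_n (a n) N) (sum_n (fun k => Series (fun n => a n k)) N).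
Proof.
  intros H. induction N as [|N IH].
  - apply is_series_ext with (fun n => a n 0%nat). intros n. now rewrite sum_O.
    rewrite sum_O. apply Series_correct, H.
  - apply is_series_ext with (fun n => plus (sum_n (a n) N) (a n (S N))).
    intros n. now rewrite sum_Sn.
    rewrite sum_Sn. apply (is_series_plus (K := R_AbsRing) (V := R_NormedModule)); auto. apply Series_correct, H.
Qed.

(** Finitely many columns together are at most the full row, so the partial sums of the column sums
    are bounded by the sum of the rows: one half of Tonelli's theorem. *)
Lemma double_series_nonneg_le (a : nat -> nat -> R) :
  (forall n k, 0 <= a n k) -> (forall n, ex_series (a n)) ->
  ex_series (fun n => Series (a n)) ->
  (forall k, ex_series (fun n => a n k)) /\
  ex_series (fun k => Series (fun n => a n k)) /\
  Series (fun k => Series (fun n => a n k)) <= Series (fun n => Series (a n)).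
Proof.
  intros Ha Hr Hs.
  assert (Hc : forall k, ex_series (fun n => a n k)).
  { intros k. apply ex_series_bound with (fun n => Series (a n)); auto.
    intros n. rewrite Rabs_pos_eq by auto. apply term_le_Series; auto. }
  split; auto.
  apply is_series_nonneg_le.
  - intros k. apply Series_nonneg; auto.
  - intros K. rewrite <- (is_series_unique _ _ (is_series_sum_n a K Hc)).
    apply Series_le; auto. intros n. split.
    + rewrite sum_n_Reals. apply cond_pos_sum; auto.
    + apply sum_n_le_Series; auto.
Qed.

(** The inequality is applied to [a] and to its transpose. *)
Lemma double_series_nonneg (a : nat -> nat -> R) :
  (forall n k, 0 <= a n k) -> (forall n, ex_series (a n)) ->
  ex_series (fun n => Series (a n)) ->
  (forall k, ex_series (fun n => a n k)) /\
  ex_series (fun k => Series (fun n => a n k)) /\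
  Series (fun k => Series (fun n => a n k)) = Series (fun n => Series (a n)).
Proof.
  intros Ha Hr Hs.
  destruct (double_series_nonneg_le a Ha Hr Hs) as (Hc & He & Hle).
  destruct (double_series_nonneg_le (fun k n => a n k)) as (_ & _ & Hle'); auto.
  split; [auto|split; auto]. apply Rle_antisym; auto.
Qed.

(** Fubini's theorem, by subtracting the nonnegative case for |a| from the one for a + |a|. *)
Lemma double_series (a : nat -> nat -> R) :
  (forall n, ex_series (fun k => Rabs (a n k))) ->
  ex_series (fun n => Series (fun k => Rabs (a n k))) ->
  Series (fun k => Series (fun n => a n k)) = Series (fun n => Series (a n)).
Proof.
  intros Hr Hs.
  destruct (double_series_nonneg (fun n k => Rabs (a n k))) as (Hc & He & E1); auto.
  { intros; apply Rabs_pos. }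
  assert (Hp : forall n k, 0 <= a n k + Rabs (a n k)).
  { intros n k. generalize (Rle_abs (- a n k)). rewrite Rabs_Ropp. lra. }
  assert (Hr' : forall n, ex_series (a n)) by (intros; apply ex_series_Rabs; auto).
  assert (Hc' : forall k, ex_series (fun n => a n k)) by (intros; apply ex_series_Rabs; auto).
  assert (Hs' : ex_series (fun n => Series (a n))).
  { apply ex_series_bound with (2 := Hs). intros n. apply Series_Rabs; auto. }
  assert (He' : ex_series (fun k => Series (fun n => a n k))).
  { apply ex_series_bound with (2 := He). intros n. apply (Series_Rabs (fun m => a m n)); auto. }
  destruct (double_series_nonneg (fun n k => a n k + Rabs (a n k))) as (_ & _ & E2); auto.
  { intros n. apply (ex_series_plus (V := R_NormedModule)); auto. }
  { apply ex_series_ext with (fun n => Series (a n) + Series (fun k => Rabs (a n k))).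
    - intros n. now rewrite Series_plus.
    - apply (ex_series_plus (V := R_NormedModule)); auto. }
  rewrite (Series_ext (fun n => Series (fun k => a n k + Rabs (a n k)))
     (fun n => Series (a n) + Series (fun k => Rabs (a n k)))) in E2
     by (intros; now rewrite Series_plus).
  rewrite (Series_ext (fun k => Series (fun n => a n k + Rabs (a n k)))
     (fun k => Series (fun n => a n k) + Series (fun n => Rabs (a n k)))) in E2
     by (intros; now rewrite Series_plus).
  rewrite 2!Series_plus in E2; auto. lra.
Qed.

(** * Absolutely convergent complex series *)

Definition Csummable (a : nat -> C) : Prop := ex_series (fun n => Cmod (a n)).

Lemma im_le_Cmod (z : C) : Rabs (Im z) <= Cmod z.
Proof. eapply Rle_trans; [apply Rmax_r|apply Rmax_Cmod]. Qed.

Lemma Cmod_le_Re_Im (z : C) : Cmod z <= Rabs (Re z) + Rabs (Im z).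
Proof.
  unfold Cmod. fold (Re z). fold (Im z).
  rewrite <- (sqrt_pow2 (Rabs (Re z) + Rabs (Im z))).
  - apply sqrt_le_1_alt.
    generalize (Rabs_pos (Re z)) (Rabs_pos (Im z)) (pow2_abs (Re z)) (pow2_abs (Im z)).
    intros. change (fst z) with (Re z). change (snd z) with (Im z). nra.
  - generalize (Rabs_pos (Re z)) (Rabs_pos (Im z)). lra.
Qed.

Lemma Csummable_Re (a : nat -> C) : Csummable a -> ex_series (fun n => Rabs (Re (a n))).
Proof.
  intros H. apply ex_series_bound with (2 := H). intros n. rewrite Rabs_Rabsolu. apply re_le_Cmod.
Qed.

Lemma Csummable_Im (a : nat -> C) : Csummable a -> ex_series (fun n => Rabs (Im (a n))).
Proof.
  intros H. apply ex_series_bound with (2 := H). intros n. rewrite Rabs_Rabsolu. apply im_le_Cmod.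
Qed.

Lemma Csummable_bound (a : nat -> C) (b : nat -> R) :
  (forall n, Cmod (a n) <= b n) -> ex_series b -> Csummable a.
Proof.
  intros H Hb. apply ex_series_bound with b; auto. intros n.
  rewrite Rabs_pos_eq; auto. apply Cmod_ge_0.
Qed.

Lemma Csummable_ext (a b : nat -> C) :
  (forall n, a n = b n) -> Csummable a -> Csummable b.
Proof. intros H. apply ex_series_ext. intros n; now rewrite H. Qed.

Lemma Csummable_plus (a b : nat -> C) :
  Csummable a -> Csummable b -> Csummable (fun n => a n + b n)%C.
Proof.
  intros Ha Hb. apply Csummable_bound with (fun n => Cmod (a n) + Cmod (b n)).
  intros; apply Cmod_triangle. apply (ex_series_plus (V := R_NormedModule)); auto.
Qed.

Lemma ex_series_mult_l (c : R) (a : nat -> R) : ex_series a -> ex_series (fun n => c * a n).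
Proof. apply (ex_series_scal (V := R_NormedModule) c). Qed.

Lemma Csummable_scal (c : C) (a : nat -> C) : Csummable a -> Csummable (fun n => c * a n)%C.
Proof.
  intros Ha. apply Csummable_bound with (fun n => Cmod c * Cmod (a n)).
  intros; rewrite Cmod_mult; lra. now apply ex_series_mult_l.
Qed.

Lemma Csummable_opp (a : nat -> C) : Csummable a -> Csummable (fun n => - a n)%C.
Proof. apply ex_series_ext. intros; now rewrite Cmod_opp. Qed.

Lemma Csummable_minus (a b : nat -> C) :
  Csummable a -> Csummable b -> Csummable (fun n => a n - b n)%C.
Proof. intros Ha Hb. apply Csummable_plus; auto. now apply Csummable_opp. Qed.

Lemma Csummable_shift (a : nat -> C) : Csummable a -> Csummable (fun n => a (S n)).
Proof. intros H. apply (ex_series_incr_1 (fun n => Cmod (a n))); auto. Qed.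

Lemma Csummable_RtoC (a : nat -> R) :
  ex_series (fun n => Rabs (a n)) -> Csummable (fun n => RtoC (a n)).
Proof. apply ex_series_ext. intros; now rewrite Cmod_R. Qed.

Lemma CSeries_ext (a b : nat -> C) : (forall n, a n = b n) -> CSeries a = CSeries b.
Proof. intros H. unfold CSeries. f_equal; apply Series_ext; intros; now rewrite H. Qed.

Lemma CSeries_plus (a b : nat -> C) :
  Csummable a -> Csummable b -> CSeries (fun n => a n + b n)%C = (CSeries a + CSeries b)%C.
Proof.
  intros Ha Hb. apply injective_projections; simpl.
  - apply (Series_plus (fun n => Re (a n)) (fun n => Re (b n)));
      now apply ex_series_Rabs, Csummable_Re.
  - apply (Series_plus (fun n => Im (a n)) (fun n => Im (b n)));
      now apply ex_series_Rabs, Csummable_Im.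
Qed.

Lemma CSeries_scal (c : C) (a : nat -> C) :
  Csummable a -> CSeries (fun n => c * a n)%C = (c * CSeries a)%C.
Proof.
  intros Ha.
  assert (Hr := ex_series_Rabs _ (Csummable_Re _ Ha)).
  assert (Hi := ex_series_Rabs _ (Csummable_Im _ Ha)).
  apply injective_projections; simpl; rewrite <- !Series_scal_l.
  - apply (Series_minus (fun n => Re c * Re (a n)) (fun n => Im c * Im (a n)));
      now apply ex_series_mult_l.
  - apply (Series_plus (fun n => Re c * Im (a n)) (fun n => Im c * Re (a n)));
      now apply ex_series_mult_l.
Qed.

Lemma CSeries_opp (a : nat -> C) : CSeries (fun n => - a n)%C = (- CSeries a)%C.
Proof. apply injective_projections; simpl; apply Series_opp. Qed.

Lemma CSeries_minus (a b : nat -> C) :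
  Csummable a -> Csummable b -> CSeries (fun n => a n - b n)%C = (CSeries a - CSeries b)%C.
Proof.
  intros Ha Hb. unfold Cminus. rewrite <- CSeries_opp.
  apply CSeries_plus; auto. now apply Csummable_opp.
Qed.

Lemma CSeries_incr_1 (a : nat -> C) :
  Csummable a -> CSeries a = (a 0%nat + CSeries (fun n => a (S n)))%C.
Proof.
  intros Ha. apply injective_projections; simpl.
  - apply (Series_incr_1 (fun n => Re (a n))). now apply ex_series_Rabs, Csummable_Re.
  - apply (Series_incr_1 (fun n => Im (a n))). now apply ex_series_Rabs, Csummable_Im.
Qed.

Lemma CSeries_RtoC (a : nat -> R) : CSeries (fun n => RtoC (a n)) = RtoC (Series a).
Proof.
  unfold CSeries, RtoC; simpl. f_equal. now apply Series_zero.
Qed.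

Lemma CSeries_0 : CSeries (fun _ => RtoC 0) = RtoC 0.
Proof. rewrite CSeries_RtoC. f_equal. now apply Series_zero. Qed.

(** Real and imaginary parts are bounded separately, which costs the factor 2; the bound serves to
    transfer summability. *)
Lemma Cmod_CSeries_le (a : nat -> C) :
  Csummable a -> Cmod (CSeries a) <= 2 * Series (fun n => Cmod (a n)).
Proof.
  intros Ha. eapply Rle_trans; [apply Cmod_le_Re_Im|]. unfold CSeries; simpl.
  assert (Hr : Rabs (Series (fun n => Re (a n))) <= Series (fun n => Cmod (a n))).
  { eapply Rle_trans; [apply Series_Rabs, Csummable_Re, Ha|]. apply Series_le; auto.
    intros n; split; [apply Rabs_pos|apply re_le_Cmod]. }
  assert (Hi : Rabs (Series (fun n => Im (a n))) <= Series (fun n => Cmod (a n))).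
  { eapply Rle_trans; [apply Series_Rabs, Csummable_Im, Ha|]. apply Series_le; auto.
    intros n; split; [apply Rabs_pos|apply im_le_Cmod]. }
  lra.
Qed.

Lemma C_double_series (F : nat -> nat -> C) :
  (forall n, Csummable (F n)) ->
  ex_series (fun n => Series (fun k => Cmod (F n k))) ->
  (forall k, Csummable (fun n => F n k)) /\
  ex_series (fun k => Series (fun n => Cmod (F n k))) /\
  Csummable (fun n => CSeries (F n)) /\
  Csummable (fun k => CSeries (fun n => F n k)) /\
  CSeries (fun k => CSeries (fun n => F n k)) = CSeries (fun n => CSeries (F n)).
Proof.
  intros Hr Hs.
  destruct (double_series_nonneg (fun n k => Cmod (F n k))) as (Hc & He & _); auto.
  { intros; apply Cmod_ge_0. }
  split; [exact Hc|]. split; [exact He|].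
  split.
  { apply Csummable_bound with (fun n => 2 * Series (fun k => Cmod (F n k))).
    intros; now apply Cmod_CSeries_le. now apply ex_series_mult_l. }
  split.
  { apply Csummable_bound with (fun k => 2 * Series (fun n => Cmod (F n k))).
    intros k; apply (Cmod_CSeries_le (fun n => F n k)), Hc. now apply ex_series_mult_l. }
  apply injective_projections; simpl.
  - apply (double_series (fun n k => Re (F n k))).
    intros; now apply Csummable_Re.
    apply ex_series_bound with (2 := Hs). intros n.
    rewrite Rabs_pos_eq by (apply Series_nonneg; [intros; apply Rabs_pos|now apply Csummable_Re]).
    apply Series_le; [|apply Hr]. intros k; split; [apply Rabs_pos|apply re_le_Cmod].
  - apply (double_series (fun n k => Im (F n k))).
    intros; now apply Csummable_Im.
    apply ex_series_bound with (2 := Hs). intros n.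
    rewrite Rabs_pos_eq by (apply Series_nonneg; [intros; apply Rabs_pos|now apply Csummable_Im]).
    apply Series_le; [|apply Hr]. intros k; split; [apply Rabs_pos|apply im_le_Cmod].
Qed.

Lemma Re_sum_n (a : nat -> C) (n : nat) :
  Re (sum_n (G := C_AbelianMonoid) a n) = sum_n (fun k => Re (a k)) n.
Proof.
  induction n as [|n IH]. now rewrite !sum_O. rewrite !sum_Sn, <- IH. reflexivity.
Qed.

Lemma Im_sum_n (a : nat -> C) (n : nat) :
  Im (sum_n (G := C_AbelianMonoid) a n) = sum_n (fun k => Im (a k)) n.
Proof.
  induction n as [|n IH]. now rewrite !sum_O. rewrite !sum_Sn, <- IH. reflexivity.
Qed.

(** The balls of [C_UniformSpace] are squares, so convergence is convergence of both components. *)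
Lemma is_Cseries_iff (a : nat -> C) (l : C) :
  is_series (K := C_AbsRing) (V := C_NormedModule) a l <->
  is_series (fun n => Re (a n)) (Re l) /\ is_series (fun n => Im (a n)) (Im l).
Proof.
  unfold is_series. split.
  - intros H. split.
    + apply filterlim_ext with (fun n => Re (sum_n (G := C_AbelianMonoid) a n)).
      apply Re_sum_n. intros P [e He]. apply (H (fun z => P (Re z))).
      exists e. intros y [Hy _]. now apply He.
    + apply filterlim_ext with (fun n => Im (sum_n (G := C_AbelianMonoid) a n)).
      apply Im_sum_n. intros P [e He]. apply (H (fun z => P (Im z))).
      exists e. intros y [_ Hy]. now apply He.
  - intros [Hr Hi] P [e He].
    assert (Hr' := Hr (ball (Re l) e) (locally_ball _ _)).
    assert (Hi' := Hi (ball (Im l) e) (locally_ball _ _)).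
    unfold filtermap in *. generalize (filter_and _ _ Hr' Hi').
    apply filter_imp. intros n [H1 H2]. apply He. split.
    + rewrite <- Re_sum_n in H1. exact H1.
    + rewrite <- Im_sum_n in H2. exact H2.
Qed.

Lemma Csummable_is_Cseries (a : nat -> C) :
  Csummable a -> is_series (K := C_AbsRing) (V := C_NormedModule) a (CSeries a).
Proof.
  intros H. apply is_Cseries_iff. split; apply Series_correct, ex_series_Rabs.
  now apply Csummable_Re. now apply Csummable_Im.
Qed.

Lemma is_Cseries_unique (a : nat -> C) (l : C) :
  is_series (K := C_AbsRing) (V := C_NormedModule) a l -> CSeries a = l.
Proof.
  intros H%is_Cseries_iff. destruct H as [Hr Hi]. unfold CSeries.
  rewrite (is_series_unique _ _ Hr), (is_series_unique _ _ Hi). now destruct l.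
Qed.

Lemma Csummable_ex_series (a : nat -> C) :
  Csummable a -> ex_series (K := C_AbsRing) (V := C_NormedModule) a.
Proof. intros H. eexists. now apply Csummable_is_Cseries. Qed.

(** * Euler's summation of alternating series *)

(** The sign makes [alt (sdiff a)] equal to [alt a] plus its shift, so that no stage of Euler's
    transform carries a sign. *)
Definition sdiff (a : nat -> C) (k : nat) : C := (a k - a (S k))%C.

Fixpoint sdiffs (r : nat) (a : nat -> C) : nat -> C :=
  match r with O => a | S r => sdiffs r (sdiff a) end.

Definition alt (a : nat -> C) (k : nat) : C := (RtoC ((-1) ^ k) * a k)%C.

(* The r-th stage of Euler's transform of a 0 - a 1 + a 2 - ...; it sums every
   sequence whose r-th difference is absolutely summable. *)
Fixpoint eulsum (r : nat) (a : nat -> C) : C :=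
  match r with
  | O => CSeries (alt a)
  | S r => (/ 2 * a 0%nat + / 2 * eulsum r (sdiff a))%C
  end.

Definition esummable (r : nat) (a : nat -> C) : Prop := Csummable (sdiffs r a).

Lemma Cmod_alt (a : nat -> C) (k : nat) : Cmod (alt a k) = Cmod (a k).
Proof.
  unfold alt. rewrite Cmod_mult, Cmod_R, pow_1_abs. ring.
Qed.

Lemma Csummable_alt (a : nat -> C) : Csummable a -> Csummable (alt a).
Proof. apply ex_series_ext. intros; now rewrite Cmod_alt. Qed.

Lemma sdiffs_S (r : nat) (a : nat -> C) : sdiffs (S r) a = sdiff (sdiffs r a).
Proof. revert a. induction r as [|r IH]; intros a; [reflexivity|]. simpl. now rewrite <- IH. Qed.

Lemma sdiff_plus (a b : nat -> C) :
  sdiff (fun k => a k + b k)%C = (fun k => sdiff a k + sdiff b k)%C.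
Proof. extensionality k. unfold sdiff. ring. Qed.

Lemma sdiff_scal (c : C) (a : nat -> C) :
  sdiff (fun k => c * a k)%C = (fun k => c * sdiff a k)%C.
Proof. extensionality k. unfold sdiff. ring. Qed.

Lemma sdiffs_plus (r : nat) (a b : nat -> C) :
  sdiffs r (fun k => a k + b k)%C = (fun k => sdiffs r a k + sdiffs r b k)%C.
Proof.
  revert a b. induction r as [|r IH]; intros a b; [reflexivity|].
  simpl. now rewrite sdiff_plus, IH.
Qed.

Lemma sdiffs_scal (r : nat) (c : C) (a : nat -> C) :
  sdiffs r (fun k => c * a k)%C = (fun k => c * sdiffs r a k)%C.
Proof.
  revert a. induction r as [|r IH]; intros a; [reflexivity|].
  simpl. now rewrite sdiff_scal, IH.
Qed.

Lemma Csummable_sdiff (a : nat -> C) : Csummable a -> Csummable (sdiff a).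
Proof. intros H. apply Csummable_minus; auto. now apply Csummable_shift. Qed.

Lemma esummable_plus (r : nat) (a b : nat -> C) :
  esummable r a -> esummable r b -> esummable r (fun k => a k + b k)%C.
Proof. intros Ha Hb. unfold esummable. rewrite sdiffs_plus. now apply Csummable_plus. Qed.

Lemma esummable_scal (r : nat) (c : C) (a : nat -> C) :
  esummable r a -> esummable r (fun k => c * a k)%C.
Proof. intros Ha. unfold esummable. rewrite sdiffs_scal. now apply Csummable_scal. Qed.

Lemma esummable_S (r : nat) (a : nat -> C) : esummable r a -> esummable (S r) a.
Proof. unfold esummable. rewrite sdiffs_S. apply Csummable_sdiff. Qed.

Lemma esummable_le (r r' : nat) (a : nat -> C) :
  (r <= r')%nat -> esummable r a -> esummable r' a.
Proof. induction 1; auto. intros; apply esummable_S; auto. Qed.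

Lemma Csummable_esummable (r : nat) (a : nat -> C) : Csummable a -> esummable r a.
Proof. intros H. apply (esummable_le 0); auto. lia. Qed.

Lemma alt_sdiff (a : nat -> C) (k : nat) : (alt (sdiff a) k = alt a k + alt a (S k))%C.
Proof.
  unfold alt, sdiff. simpl. rewrite RtoC_mult. ring.
Qed.

(** Regularity of Euler's transform: the alternating sum of the differences is twice the alternating
    sum of [a] minus [a 0]. Hence the value no longer depends on the stage once the sequence is
    summable there. *)
Lemma eulsum_S (r : nat) (a : nat -> C) :
  esummable r a -> eulsum (S r) a = eulsum r a.
Proof.
  revert a. induction r as [|r IH]; intros a Ha.
  - simpl. assert (Ha' := Csummable_alt _ Ha).
    rewrite (CSeries_ext _ _ (alt_sdiff a)), CSeries_plus; auto.
    + rewrite (CSeries_incr_1 (alt a)) by auto.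
      replace (alt a 0%nat) with (a 0%nat) by (unfold alt; simpl; ring). field.
    + now apply Csummable_shift.
  - simpl. specialize (IH (sdiff a) Ha). simpl in IH. now rewrite IH.
Qed.

Lemma eulsum_le (r r' : nat) (a : nat -> C) :
  (r <= r')%nat -> esummable r a -> eulsum r' a = eulsum r a.
Proof.
  induction 1 as [|r' Hr IH]; auto. intros Ha.
  rewrite eulsum_S; auto. now apply (esummable_le r).
Qed.

Lemma eulsum_Csummable (r : nat) (a : nat -> C) :
  Csummable a -> eulsum r a = CSeries (alt a).
Proof. intros Ha. rewrite (eulsum_le 0); auto. lia. Qed.

Lemma eulsum_plus (r : nat) (a b : nat -> C) :
  esummable r a -> esummable r b ->
  (eulsum r (fun k => a k + b k) = eulsum r a + eulsum r b)%C.
Proof.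
  revert a b. induction r as [|r IH]; intros a b Ha Hb; simpl.
  - rewrite <- CSeries_plus by now apply Csummable_alt.
    apply CSeries_ext. intros k. unfold alt. ring.
  - rewrite sdiff_plus, IH; auto. ring.
Qed.

Lemma eulsum_scal (r : nat) (c : C) (a : nat -> C) :
  esummable r a -> (eulsum r (fun k => c * a k) = c * eulsum r a)%C.
Proof.
  revert a. induction r as [|r IH]; intros a Ha; simpl.
  - rewrite <- CSeries_scal by now apply Csummable_alt.
    apply CSeries_ext. intros k. unfold alt. ring.
  - rewrite sdiff_scal, IH; auto. ring.
Qed.

(** One difference at a time is moved inside the sum over n, which only uses convergence for each
    fixed k; Fubini's theorem is applied at the last stage. So absolute double summability is asked
    of the r-th differences alone, and [F] itself may grow in k. *)
Lemma eulsum_swap (r : nat) (F : nat -> nat -> C) :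
  (forall k, Csummable (fun n => F n k)) ->
  (forall n, esummable r (F n)) ->
  ex_series (fun n => Series (fun k => Cmod (sdiffs r (F n) k))) ->
  Csummable (fun n => eulsum r (F n)) /\
  esummable r (fun k => CSeries (fun n => F n k)) /\
  eulsum r (fun k => CSeries (fun n => F n k)) = CSeries (fun n => eulsum r (F n)).
Proof.
  revert F. induction r as [|r IH]; intros F Hc Hr Hs.
  - destruct (C_double_series (fun n k => alt (F n) k)) as (H1 & H2 & H3 & H4 & H5).
    + intros n. apply Csummable_alt, Hr.
    + apply ex_series_ext with (2 := Hs). intros n. apply Series_ext. intros k.
      now rewrite Cmod_alt.
    + assert (E : forall k, CSeries (fun n => alt (F n) k) = alt (fun k => CSeries (fun n => F n k)) k).
      { intros k. unfold alt. rewrite <- CSeries_scal; auto. }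
      split; [exact H3|split].
      * unfold esummable. simpl. apply ex_series_ext with (2 := H4). intros k.
        now rewrite E, Cmod_alt.
      * simpl. transitivity (CSeries (fun k => CSeries (fun n => alt (F n) k))); [|exact H5].
        apply CSeries_ext. intros k. now rewrite E.
  - destruct (IH (fun n => sdiff (F n))) as (H1 & H2 & H3); auto.
    + intros k. apply Csummable_minus; apply Hc.
    + assert (E : sdiff (fun k => CSeries (fun n => F n k)) =
        (fun k => CSeries (fun n => sdiff (F n) k))).
      { extensionality k. unfold sdiff. now rewrite CSeries_minus. }
      simpl. split; [|split].
      * apply Csummable_plus; apply Csummable_scal; auto.
      * unfold esummable. simpl. rewrite E. exact H2.
      * rewrite E, H3, CSeries_plus; try (apply Csummable_scal; auto).
        rewrite !CSeries_scal; auto.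
Qed.

(** * Finite differences of real functions *)

Fixpoint fdiffs (r : nat) (f : R -> R) : R -> R :=
  match r with O => f | S r => fdiffs r (fun x => f x - f (x + 1)) end.

Lemma fdiffs_S (r : nat) (f : R -> R) (x : R) :
  fdiffs (S r) f x = fdiffs r f x - fdiffs r f (x + 1).
Proof.
  revert f x. induction r as [|r IH]; intros f x; [reflexivity|].
  change (fdiffs (S (S r)) f x) with (fdiffs (S r) (fun x => f x - f (x + 1)) x).
  rewrite IH. reflexivity.
Qed.

Lemma sdiffs_RtoC (r : nat) (f : R -> R) (a : R) (k : nat) :
  sdiffs r (fun k => RtoC (f (INR k + a))) k = RtoC (fdiffs r f (INR k + a)).
Proof.
  revert f k. induction r as [|r IH]; intros f k; [reflexivity|]. simpl.
  rewrite <- IH. f_equal. extensionality i. unfold sdiff. rewrite <- RtoC_minus.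
  do 3 f_equal. rewrite S_INR. ring.
Qed.

Lemma is_derive_fdiffs (r : nat) (f f' : R -> R) (x : R) :
  (forall y, x <= y -> is_derive f y (f' y)) ->
  is_derive (fdiffs r f) x (fdiffs r f' x).
Proof.
  revert f f' x. induction r as [|r IH]; intros f f' x H; simpl.
  - apply H; lra.
  - apply (IH (fun x => f x - f (x + 1)) (fun x => f' x - f' (x + 1))).
    intros y Hy. apply (is_derive_minus (V := R_NormedModule)).
    + now apply H.
    + assert (D := is_derive_comp (K := R_AbsRing) (V := R_NormedModule) f (fun y => y + 1) y (f' (y + 1)) 1).
      replace (f' (y + 1)) with (scal 1 (f' (y + 1))) by (unfold scal; simpl; unfold mult; simpl; ring).
      apply D. apply H; lra. auto_derive; auto; ring.
Qed.

(** Differences commute with differentiation, so one mean value step trades a difference for a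
    derivative at a point of [x, x + 1]. *)
Lemma fdiffs_MVT (r : nat) (f f' : R -> R) (x : R) :
  (forall y, x <= y -> is_derive f y (f' y)) ->
  exists xi, x <= xi <= x + 1 /\ fdiffs (S r) f x = - fdiffs r f' xi.
Proof.
  intros H.
  destruct (MVT_gen (fdiffs r f) x (x + 1) (fdiffs r f')) as (xi & Hxi & E).
  - intros y Hy. rewrite Rmin_left in Hy by lra. apply is_derive_fdiffs.
    intros z Hz. apply H; lra.
  - intros y Hy. rewrite Rmin_left in Hy by lra.
    apply continuity_pt_filterlim, (ex_derive_continuous (V := R_NormedModule)).
    eexists. apply is_derive_fdiffs. intros z Hz. apply H; lra.
  - rewrite Rmin_left, Rmax_right in Hxi by lra. exists xi. split; auto.
    rewrite fdiffs_S. replace (x + 1 - x) with 1 in E by ring. lra.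
Qed.

Lemma fdiffs_ext (r : nat) (f g : R -> R) (x : R) :
  (forall y, f y = g y) -> fdiffs r f x = fdiffs r g x.
Proof. intros H. replace g with f; auto. now extensionality y. Qed.

Lemma fdiffs_plus (r : nat) (f g : R -> R) (x : R) :
  fdiffs r (fun y => f y + g y) x = fdiffs r f x + fdiffs r g x.
Proof.
  revert f g. induction r as [|r IH]; intros f g; [reflexivity|]. simpl.
  rewrite <- IH. apply fdiffs_ext. intros; ring.
Qed.

Lemma fdiffs_scal (r : nat) (c : R) (f : R -> R) (x : R) :
  fdiffs r (fun y => c * f y) x = c * fdiffs r f x.
Proof.
  revert f. induction r as [|r IH]; intros f; [reflexivity|]. simpl.
  rewrite <- IH. apply fdiffs_ext. intros; ring.
Qed.

Lemma fdiffs_shift (r : nat) (f : R -> R) (a x : R) :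
  fdiffs r (fun y => f (y + a)) x = fdiffs r f (x + a).
Proof.
  revert f. induction r as [|r IH]; intros f; [reflexivity|]. simpl.
  rewrite <- (IH (fun x => f x - f (x + 1))). apply fdiffs_ext.
  intros y. f_equal. f_equal. ring.
Qed.

Lemma fdiffs_reflect (r : nat) (f : R -> R) (c : R) :
  (forall x, fdiffs r f x = 0) -> forall x, fdiffs r (fun y => f (c - y)) x = 0.
Proof.
  revert f c. induction r as [|r IH]; intros f c H x; simpl in *.
  - apply H.
  - rewrite (fdiffs_ext r _ (fun y => -1 * (f (c - 1 - y) - f (c - 1 - y + 1)))).
    + rewrite fdiffs_scal.
      rewrite (IH (fun x => f x - f (x + 1)) (c - 1) H). ring.
    + intros y. replace (c - 1 - y + 1) with (c - y) by ring.
      replace (c - (y + 1)) with (c - 1 - y) by ring. ring.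
Qed.

(** Discrete Leibniz rule: multiplication by the identity raises the order of annihilation by one,
    hence x^i is annihilated by i + 1 differences. *)
Lemma fdiffs_mult_id (r : nat) (f : R -> R) :
  (forall x, fdiffs r f x = 0) -> forall x, fdiffs (S r) (fun y => y * f y) x = 0.
Proof.
  revert f. induction r as [|r IH]; intros f H x.
  - simpl in *. rewrite !H. ring.
  - change (fdiffs (S r) (fun y => y * f y - (y + 1) * f (y + 1)) x = 0).
    rewrite (fdiffs_ext _ _ (fun y => y * (f y - f (y + 1)) + -1 * f (y + 1))) by (intros; ring).
    rewrite fdiffs_plus, fdiffs_scal, fdiffs_shift, H, (IH (fun x => f x - f (x + 1))).
    + ring.
    + apply H.
Qed.

Lemma fdiffs_pow (i r : nat) (x : R) : (i < r)%nat -> fdiffs r (fun y => y ^ i) x = 0.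
Proof.
  revert r x. induction i as [|i IH]; intros r x Hr; (destruct r as [|r]; [lia|]).
  - simpl. rewrite (fdiffs_ext _ _ (fun y => 0 * 0)) by (intros; ring).
    rewrite fdiffs_scal. ring.
  - apply (fdiffs_mult_id r (fun y => y ^ i)). intros y. apply IH. lia.
Qed.

(** The finite Euler transform of f x - f (x + 1) + f (x + 2) - ... . On polynomials of degree below
    r it is the polynomial solution g of g x + g (x + 1) = f x; for f = x^i this is half the Euler
    polynomial E_i. *)
Fixpoint esum (r : nat) (f : R -> R) (x : R) : R :=
  match r with
  | O => 0
  | S r => f x / 2 + esum r (fun y => f y - f (y + 1)) x / 2
  end.

Lemma eulsum_poly (r : nat) (f : R -> R) (a : R) :
  (forall x, fdiffs r f x = 0) ->
  eulsum r (fun k => RtoC (f (INR k + a))) = RtoC (esum r f a).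
Proof.
  revert f. induction r as [|r IH]; intros f H.
  - simpl in *. rewrite <- CSeries_0. apply CSeries_ext. intros k. unfold alt.
    rewrite H. ring.
  - assert (E : sdiff (fun k => RtoC (f (INR k + a))) =
      (fun k => RtoC (f (INR k + a) - f (INR k + a + 1)))).
    { extensionality k. unfold sdiff. rewrite S_INR, RtoC_minus.
      now replace (INR k + 1 + a) with (INR k + a + 1) by ring. }
    simpl. rewrite E, (IH (fun x => f x - f (x + 1)) H).
    unfold Rdiv. rewrite RtoC_plus, !RtoC_mult, RtoC_inv, Rplus_0_l by lra. ring.
Qed.

Lemma esum_shift (r : nat) (f : R -> R) (x : R) :
  (forall x, fdiffs r f x = 0) -> esum r f x + esum r f (x + 1) = f x.
Proof.
  revert f. induction r as [|r IH]; intros f H; simpl in *.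
  - rewrite H. ring.
  - specialize (IH (fun y => f y - f (y + 1)) H). simpl in IH. lra.
Qed.

Lemma fdiffs_esum (s r : nat) (f : R -> R) (x : R) :
  (forall x, fdiffs s f x = 0) -> fdiffs s (esum r f) x = 0.
Proof.
  revert f. induction r as [|r IH]; intros f H; simpl.
  - rewrite (fdiffs_ext _ _ (fun y => 0 * 0)) by (intros; ring).
    rewrite fdiffs_scal. ring.
  - rewrite (fdiffs_ext _ _ (fun x => / 2 * f x + / 2 * esum r (fun y => f y - f (y + 1)) x))
      by (intros; field).
    rewrite fdiffs_plus, !fdiffs_scal, H, IH. ring.
    intros y. rewrite (fdiffs_ext _ _ (fun x => f x + -1 * f (x + 1))) by (intros; ring).
    rewrite fdiffs_plus, fdiffs_scal, fdiffs_shift, !H. ring.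
Qed.

(** Each difference doubles an antiperiodic function, so one that is also annihilated by some
    difference is zero. This gives the uniqueness of the polynomial solution of g x + g (x + 1) = f
    x. *)
Lemma fdiffs_antiperiodic (r : nat) (d : R -> R) (x : R) :
  (forall x, d (x + 1) = - d x) -> fdiffs r d x = 2 ^ r * d x.
Proof.
  intros H. revert x. induction r as [|r IH]; intros x; [simpl; ring|].
  rewrite fdiffs_S, !IH, H. simpl. ring.
Qed.

(* The reflection x -> 1 - x maps solutions g of g x + g (x + 1) = f x to
   solutions, and a polynomial solution is unique. *)
Lemma esum_even (r : nat) (f : R -> R) :
  (forall x, fdiffs r f x = 0) -> (forall x, f (- x) = f x) -> esum r f 1 = f 0 / 2.
Proof.
  intros H He.
  set (d := fun x => esum r f x + -1 * esum r f (1 - x)).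
  assert (Hd : forall x, d (x + 1) = - d x).
  { intros x. unfold d. generalize (esum_shift r f x H) (esum_shift r f (- x) H).
    rewrite He. replace (1 - (x + 1)) with (- x) by ring. replace (- x + 1) with (1 - x) by ring.
    lra. }
  assert (H0 : d 0 = 0).
  { assert (E := fdiffs_antiperiodic r d 0 Hd). unfold d in E at 1.
    rewrite fdiffs_plus, fdiffs_scal, fdiffs_esum, fdiffs_reflect in E; auto.
    - assert (0 < 2 ^ r) by (apply pow_lt; lra). nra.
    - intros; now apply fdiffs_esum. }
  unfold d in H0. generalize (esum_shift r f 0 H).
  rewrite Rminus_0_r in H0. rewrite Rplus_0_l. lra.
Qed.

(** This is the value of the alternating zeta function at -d i: half the value at 0 of the even
    polynomial x^(d i). Exponent 0 gives 1/2, all others give the trivial zeros. *)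
Lemma eulsum_even_pow (d i r : nat) :
  Nat.Even d -> (0 < d)%nat -> (d * i < r)%nat ->
  eulsum r (fun k => RtoC ((INR k + 1) ^ (d * i))) =
    RtoC (if Nat.eqb i 0 then / 2 else 0).
Proof.
  intros [e He] Hd Hr.
  rewrite (eulsum_poly r (fun x => x ^ (d * i)) 1) by (intros; now apply fdiffs_pow).
  f_equal. rewrite esum_even.
  - destruct i as [|i]; simpl.
    + rewrite Nat.mul_0_r. simpl. field.
    + rewrite pow_i by nia. field.
  - intros; now apply fdiffs_pow.
  - intros x. rewrite He, <- Nat.mul_assoc, !(pow_mult _ 2). now replace ((- x) ^ 2) with (x ^ 2) by ring.
Qed.

Lemma esummable_even_pow (d i r : nat) :
  (d * i < r)%nat -> esummable r (fun k => RtoC ((INR k + 1) ^ (d * i))).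
Proof.
  intros Hr. unfold esummable. apply Csummable_ext with (fun _ => RtoC 0).
  - intros k. rewrite (sdiffs_RtoC r (fun x => x ^ (d * i)) 1).
    now rewrite fdiffs_pow.
  - exists 0. apply is_series_zero. intros; apply Cmod_0.
Qed.

Lemma Rpower_pos (x y : R) : 0 < Rpower x y.
Proof. apply exp_pos. Qed.

Lemma Rpower_le_neg (x y e : R) : 0 < x <= y -> e <= 0 -> Rpower y e <= Rpower x e.
Proof.
  intros Hxy He. replace e with (- - e) by ring. rewrite (Rpower_Ropp x), (Rpower_Ropp y).
  apply Rinv_le_contravar. apply Rpower_pos. apply Rle_Rpower_l; lra.
Qed.

(** The derivative consists of two functions of the same form, with (i, j) replaced by (i - 1, j)
    and by (i + d - 1, j + 1); this closure carries the induction on the order of the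
    differences. *)
Lemma is_derive_rational (i j d : nat) (u B x : R) :
  0 < u -> 0 < B -> 0 < x ->
  is_derive (fun y => y ^ i / (u + B * y ^ d) ^ j) x
    (INR i * (x ^ (pred i) / (u + B * x ^ d) ^ j)
     - INR j * INR d * B * (x ^ (i + pred d) / (u + B * x ^ d) ^ (S j))).
Proof.
  intros Hu HB Hx.
  assert (Hw : 0 < u + B * x ^ d) by (generalize (pow_lt x d Hx); intros; nra).
  auto_derive.
  - apply Rgt_not_eq, pow_lt; auto.
  - rewrite pow_add. simpl. destruct j as [|j]; simpl pred.
    + simpl. field. lra.
    + change ((u + B * x ^ d) ^ S j) with ((u + B * x ^ d) * (u + B * x ^ d) ^ j).
      field. split; [|lra]. apply Rgt_not_eq, pow_lt; auto.
Qed.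

(** With w = u + B x^d, x is of size at most w^(1/d), and every difference gains a factor w^(-1/d).
    The point is the uniformity in u, which will run over a sequence as well. The condition
    [i <= j * d] keeps the exponent nonpositive, so that the bound at the intermediate point, where
    w is larger, may be replaced by the bound at x. *)
Lemma fdiffs_rational_bound (d : nat) (B : R) :
  (0 < d)%nat -> 0 < B -> forall r i j : nat, (i <= j * d)%nat ->
  exists K, 0 <= K /\ forall u x, 0 < u -> 1 <= x ->
    Rabs (fdiffs r (fun y => y ^ i / (u + B * y ^ d) ^ j) x)
      <= K * Rpower (u + B * x ^ d) ((INR i - INR r) / INR d - INR j).
Proof.
  intros Hd HB r. assert (Hd' : 0 < INR d) by (apply lt_0_INR; lia).
  induction r as [|r IH]; intros i j Hij.
  (* From B x^d <= w follows x^i <= (w / B)^(i/d). *)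
  - exists (Rpower (/ B) (INR i / INR d)). split; [apply Rlt_le, Rpower_pos|].
    intros u x Hu Hx. simpl.
    assert (Hxd : 0 < x ^ d) by (apply pow_lt; lra).
    assert (Hw : 0 < u + B * x ^ d) by nra.
    rewrite Rminus_0_r. unfold Rminus. rewrite Rpower_plus, Rpower_Ropp, Rpower_pow by auto.
    rewrite Rabs_pos_eq.
    2:{ apply Rmult_le_pos; [apply pow_le; lra|]. apply Rinv_ge_0, pow_lt; auto. }
    rewrite <- Rmult_assoc. apply Rmult_le_compat_r.
    { apply Rinv_ge_0, pow_lt; auto. }
    rewrite Rpower_mult_distr; auto; [|now apply Rinv_0_lt_compat].
    apply Rle_trans with (Rpower (x ^ d) (INR i / INR d)).
    + rewrite <- (Rpower_pow d x), Rpower_mult by lra.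
      replace (INR d * (INR i / INR d)) with (INR i) by (field; lra).
      rewrite Rpower_pow by lra. lra.
    + apply Rle_Rpower_l.
      * apply Rmult_le_pos; [apply pos_INR|]. apply Rinv_ge_0; auto.
      * split; auto. rewrite Rmult_plus_distr_l, <- Rmult_assoc, Rinv_l by lra.
        assert (0 < / B) by now apply Rinv_0_lt_compat. nra.
  - destruct (IH (pred i) j) as (K1 & HK1 & H1); [lia|].
    destruct (IH (i + pred d)%nat (S j)) as (K2 & HK2 & H2); [lia|].
    set (c := INR j * INR d * B).
    assert (Hc : 0 <= c).
    { unfold c. apply Rmult_le_pos; [apply Rmult_le_pos; apply pos_INR|lra]. }
    exists (INR i * K1 + c * K2). split.
    { generalize (pos_INR i). intros. apply Rplus_le_le_0_compat; apply Rmult_le_pos; auto. }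
    intros u x Hu Hx.
    destruct (fdiffs_MVT r (fun y => y ^ i / (u + B * y ^ d) ^ j)
       (fun y => INR i * (y ^ (pred i) / (u + B * y ^ d) ^ j)
     + (- c) * (y ^ (i + pred d) / (u + B * y ^ d) ^ (S j))) x) as (xi & Hxi & E).
    { intros y Hy.
      replace (INR i * (y ^ (pred i) / (u + B * y ^ d) ^ j)
     + (- c) * (y ^ (i + pred d) / (u + B * y ^ d) ^ (S j))) with
       (INR i * (y ^ (pred i) / (u + B * y ^ d) ^ j)
     - INR j * INR d * B * (y ^ (i + pred d) / (u + B * y ^ d) ^ (S j))) by (unfold c; ring).
      apply is_derive_rational; lra. }
    rewrite E, Rabs_Ropp, fdiffs_plus, !fdiffs_scal.
    set (e := (INR i - INR (S r)) / INR d - INR j).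
    assert (He : e <= 0).
    { unfold e. apply Rmult_le_reg_l with (INR d); auto. rewrite Rmult_0_r.
      replace (INR d * ((INR i - INR (S r)) / INR d - INR j)) with
        (INR i - INR (S r) - INR j * INR d) by (field; lra).
      rewrite <- mult_INR. generalize (le_INR _ _ Hij) (pos_INR (S r)). lra. }
    assert (Hmono : Rpower (u + B * xi ^ d) e <= Rpower (u + B * x ^ d) e).
    { apply Rpower_le_neg; auto. assert (0 < x ^ d) by (apply pow_lt; lra).
      split; [nra|]. apply Rplus_le_compat_l, Rmult_le_compat_l; [lra|].
      apply pow_incr; lra. }
    specialize (H1 u xi Hu ltac:(lra)). specialize (H2 u xi Hu ltac:(lra)).
    set (A1 := fdiffs r (fun y => y ^ pred i / _) xi) in *. set (A2 := fdiffs r (fun y => y ^ (i + pred d) / _) xi) in *.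
    assert (B1 : INR i * Rabs A1 <= INR i * K1 * Rpower (u + B * x ^ d) e).
    { destruct i as [|i]; [simpl; lra|]. rewrite Rmult_assoc. apply Rmult_le_compat_l; [apply pos_INR|].
      eapply Rle_trans; [exact H1|]. apply Rmult_le_compat_l; auto.
      replace ((INR (pred (S i)) - INR r) / INR d - INR j) with e; auto.
      unfold e. simpl pred. rewrite !S_INR. f_equal. f_equal. ring. }
    assert (B2 : c * Rabs A2 <= c * K2 * Rpower (u + B * x ^ d) e).
    { rewrite Rmult_assoc. apply Rmult_le_compat_l; auto.
      eapply Rle_trans; [exact H2|]. apply Rmult_le_compat_l; auto.
      replace ((INR (i + pred d) - INR r) / INR d - INR (S j)) with e; auto.
      unfold e. rewrite plus_INR, !S_INR. replace (INR (pred d)) with (INR d - 1).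
      - field. lra.
      - destruct d; [lia|]. rewrite S_INR. simpl pred. ring. }
    eapply Rle_trans; [apply Rabs_triang|]. rewrite !Rabs_mult, Rabs_Ropp.
    rewrite (Rabs_pos_eq (INR i)) by apply pos_INR. rewrite (Rabs_pos_eq c) by auto. lra.
Qed.

(** * Exchange of Euler summation and summation *)

Lemma INR_S_pos (k : nat) : 0 < INR k + 1.
Proof. generalize (pos_INR k). lra. Qed.

Lemma ex_series_inv_sqr : ex_series (fun k => / (INR k + 1) ^ 2).
Proof.
  (* The majorant telescopes from 1/(y+1)^2 <= 1/y - 1/(y+1). *)
  assert (H : forall n, sum_n (fun k => / (INR k + 1) ^ 2) n <= 2 - / (INR n + 1)).
  { induction n as [|n IH].
    - rewrite sum_O. simpl. lra.
    - rewrite sum_Sn. unfold plus; simpl plus. change (sum_n (fun k => / (INR k + 1) ^ 2) n + / (INR (S n) + 1) ^ 2 <= 2 - / (INR (S n) + 1)).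
      assert (Hn := INR_S_pos n). rewrite S_INR. set (y := INR n + 1) in *.
      assert (/ (y + 1) ^ 2 <= / y - / (y + 1)).
      { replace (/ y - / (y + 1)) with (/ (y * (y + 1))) by (field; lra).
        apply Rinv_le_contravar; nra. }
      lra. }
  apply (is_series_nonneg_le _ 2).
  - intros n. apply Rinv_ge_0, pow_lt, INR_S_pos.
  - intros n. eapply Rle_trans; [apply H|].
    assert (0 < / (INR n + 1)) by apply Rinv_0_lt_compat, INR_S_pos. lra.
Qed.

Lemma ex_series_inv_pow (d : nat) (B : R) :
  (2 <= d)%nat -> 0 < B -> ex_series (fun k => / (B * (INR k + 1) ^ d)).
Proof.
  intros Hd HB. apply ex_series_bound with (fun k => / B * / (INR k + 1) ^ 2).
  - intros k. assert (Hk := INR_S_pos k). rewrite Rinv_mult.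
    assert (0 < (INR k + 1) ^ d) by (apply pow_lt; lra).
    rewrite Rabs_pos_eq.
    + apply Rmult_le_compat_l; [apply Rinv_ge_0; auto|].
      apply Rinv_le_contravar; [apply pow_lt; lra|]. apply Rle_pow; auto.
      generalize (pos_INR k); lra.
    + apply Rmult_le_pos; apply Rinv_ge_0; auto.
  - apply ex_series_mult_l, ex_series_inv_sqr.
Qed.

(* For p >= 1, u^p/(u+v) and (-v)^p/(u+v) differ by an even polynomial in k,
   which Euler summation evaluates explicitly; the high order differences of
   1/(u+v) make the double series absolutely convergent, so that the two
   summations can be exchanged. *)
Section Regularised_exchange.

Variables (d1 d2 : nat) (A B : R) (p : nat).
Hypotheses (Hd1 : (2 <= d1)%nat) (Hd2 : (2 <= d2)%nat) (Hd2e : Nat.Even d2).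
Hypotheses (HA : 0 < A) (HB : 0 < B).

Let u (n : nat) : R := A * (INR n + 1) ^ d1.
Let v (k : nat) : R := B * (INR k + 1) ^ d2.
Let G (q : nat) (w : R) (k : nat) : C := RtoC ((- v k) ^ q / (w + v k)).

Lemma reg_u_pos n : 0 < u n.
Proof. apply Rmult_lt_0_compat; auto. apply pow_lt, INR_S_pos. Qed.

Lemma reg_v_pos k : 0 < v k.
Proof. apply Rmult_lt_0_compat; auto. apply pow_lt, INR_S_pos. Qed.

Lemma reg_Csummable_G0 w : 0 < w -> Csummable (G 0 w).
Proof.
  intros Hw. apply Csummable_bound with (fun k => / v k).
  - intros k. assert (Hv := reg_v_pos k). unfold G. rewrite Cmod_R. simpl.
    unfold Rdiv. rewrite Rmult_1_l, Rabs_pos_eq by (apply Rinv_ge_0; lra).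
    apply Rinv_le_contravar; lra.
  - now apply ex_series_inv_pow.
Qed.

(** Polynomial division: (-v)^(q+1) = w (-v)^q - (w + v) (-v)^q. *)
Lemma reg_G_S q w : 0 < w ->
  G (S q) w = (fun k => RtoC w * G q w k + RtoC (- (- B) ^ q) * RtoC ((INR k + 1) ^ (d2 * q)))%C.
Proof.
  intros Hw. extensionality k. unfold G. rewrite <- !RtoC_mult, <- RtoC_plus. f_equal.
  replace (- (- B) ^ q * (INR k + 1) ^ (d2 * q)) with (- (- v k) ^ q).
  - simpl. field. generalize (reg_v_pos k); lra.
  - unfold v. rewrite Ropp_mult_distr_l, Rpow_mult_distr, pow_mult. ring.
Qed.

(** Differences of order above the degree annihilate the polynomial split off at each division. Its
    Euler sum is nonzero only in the division from q = 0 to q = 1, where it is 1/2; the later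
    divisions multiply this by w, whence w^(q-1)/2. *)
Lemma reg_G q w r : 0 < w -> (d2 * q < r)%nat ->
  esummable r (G q w) /\
  sdiffs r (G q w) = (fun k => RtoC (w ^ q) * sdiffs r (G 0 w) k)%C /\
  eulsum r (G q w) = (RtoC (w ^ q) * eulsum r (G 0 w) -
    RtoC (match q with O => 0 | S q' => w ^ q' / 2 end))%C.
Proof.
  intros Hw Hr. induction q as [|q IH].
  - split; [|split].
    + apply Csummable_esummable, reg_Csummable_G0; auto.
    + extensionality k. simpl. ring.
    + simpl. ring.
  - destruct IH as (H1 & H2 & H3); [nia|].
    assert (Hq : esummable r (fun k => RtoC ((INR k + 1) ^ (d2 * q)))) by (apply esummable_even_pow; nia).
    rewrite (reg_G_S q w Hw). split; [|split].
    + apply esummable_plus; now apply esummable_scal.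
    + extensionality k. rewrite sdiffs_plus, !sdiffs_scal, H2.
      rewrite (sdiffs_RtoC r (fun x => x ^ (d2 * q)) 1), fdiffs_pow by nia.
      simpl pow. rewrite RtoC_mult. ring.
    + rewrite eulsum_plus, !eulsum_scal by (auto; now apply esummable_scal).
      rewrite H3, eulsum_even_pow by (auto; lia).
      destruct q as [|q].
      * simpl. rewrite Rmult_1_r.
        replace (RtoC (1 / 2)) with (RtoC (/ 2)) by (f_equal; field).
        replace (RtoC (- (1))) with (- RtoC 1)%C by now rewrite RtoC_opp. ring.
      * simpl Nat.eqb. cbv iota. rewrite (Rdiv_def (w ^ S q)). simpl pow. rewrite ?RtoC_mult, ?RtoC_minus.
        unfold Rdiv. rewrite ?RtoC_mult. ring.
Qed.

(** The double family is (-v)^p/(u+v). Summed over n at fixed k it equals (-1)^p/2 v^(p-1) (g - 1)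
    with g = 1 + 2 sum v/(u+v); Euler-summed over k at fixed n it equals -1/2 u^(p-1) times the
    alternating bracket. The subtracted constant leaves the Euler sum of v^(p-1), which vanishes
    unless p = 1. The left-hand sum over n is an ordinary one. *)
Lemma regularised_exchange r : (1 <= p)%nat -> (d2 * (p + 1) <= r)%nat ->
  esummable r (fun k => RtoC (v k ^ (p - 1) * (1 + 2 * Series (fun n => v k / (u n + v k))))) /\
  CSeries (fun n => RtoC (u n ^ (p - 1) *
     (1 - 2 * Series (fun k => (-1) ^ k * (u n / (u n + v k)))))) =
  Cplus (Cmult (RtoC (- (-1) ^ p)) (eulsum r (fun k => RtoC (v k ^ (p - 1) *
     (1 + 2 * Series (fun n => v k / (u n + v k)))))))
   (RtoC (if Nat.eqb p 1 then - / 2 else 0)).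
Proof.
  intros Hp Hr.
  (* With this number of differences the decay is (u+v)^(-p-2): the factor u^p takes up p of these
     powers, and the other two are split as 1/(u v). *)
  set (s := (d2 * (p + 1))%nat) in *.
  assert (Hs : (d2 * p < s)%nat) by (unfold s; nia).
  destruct (fdiffs_rational_bound d2 B ltac:(lia) HB s 0 1 ltac:(lia)) as (K & HK & HKb).
  assert (Hb : forall n k, Cmod (sdiffs s (G p (u n)) k) <= K * (/ u n * / v k)).
  { intros n k. assert (Hu := reg_u_pos n). assert (Hv := reg_v_pos k).
    destruct (reg_G p (u n) s Hu Hs) as (_ & -> & _).
    rewrite Cmod_mult, Cmod_R, Rabs_pos_eq by (apply pow_le; lra).
    unfold G.
    rewrite (sdiffs_RtoC s (fun x => (- (B * x ^ d2)) ^ 0 / (u n + B * x ^ d2)) 1), Cmod_R.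
    rewrite (fdiffs_ext s _ (fun y => y ^ 0 / (u n + B * y ^ d2) ^ 1))
      by (intros; now rewrite pow_1).
    eapply Rle_trans.
    { apply Rmult_le_compat_l; [apply pow_le; lra|]. apply HKb; auto.
      generalize (pos_INR k); lra. }
    fold (v k).
    replace ((INR 0 - INR s) / INR d2 - INR 1) with (- INR (p + 2)).
    2:{ unfold s. rewrite mult_INR, !plus_INR. simpl. field. apply not_0_INR. lia. }
    rewrite Rpower_Ropp, Rpower_pow by lra. rewrite pow_add.
    assert (Hpw : u n ^ p <= (u n + v k) ^ p) by (apply pow_incr; lra).
    assert (0 < u n ^ p) by (apply pow_lt; lra).
    rewrite <- Rinv_mult.
    apply Rle_trans with (K * (u n ^ p / (u n + v k) ^ p) * / (u n + v k) ^ 2).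
    { right. field. split; [lra|]. apply Rgt_not_eq. lra. }
    rewrite Rmult_assoc. apply Rmult_le_compat_l; auto.
    apply Rle_trans with (1 * / (u n + v k) ^ 2).
    - apply Rmult_le_compat_r; [apply Rinv_ge_0, pow_lt; lra|].
      apply Rle_div_l; lra.
    - rewrite Rmult_1_l. apply Rinv_le_contravar; nra. }
  assert (Hinvv := ex_series_inv_pow d2 B Hd2 HB).
  assert (Hinvu := ex_series_inv_pow d1 A Hd1 HA).
  assert (Hcol : forall k, ex_series (fun n => / (u n + v k))).
  { intros k. apply ex_series_bound with (fun n => / u n); auto.
    intros n. assert (Hu := reg_u_pos n). assert (Hv := reg_v_pos k).
    rewrite Rabs_pos_eq by (apply Rinv_ge_0; lra).
    apply Rinv_le_contravar; lra. }
  destruct (eulsum_swap s (fun n => G p (u n))) as (S1 & S2 & S3).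
  - intros k. unfold G. apply Csummable_RtoC.
    apply ex_series_ext with (fun n => v k ^ p * / (u n + v k)).
    + intros n. assert (Hu := reg_u_pos n). assert (Hv := reg_v_pos k).
      unfold Rdiv. rewrite Rabs_mult, <- RPow_abs, Rabs_Ropp, !Rabs_pos_eq; auto; try lra.
      apply Rinv_ge_0; lra.
    + apply ex_series_mult_l, Hcol.
  - intros n. now apply reg_G; [apply reg_u_pos|].
  - apply ex_series_bound with (fun n => K * Series (fun k => / v k) * / u n).
    + intros n. assert (Hu := reg_u_pos n).
      assert (Hex : ex_series (fun k => K * / u n * / v k)) by now apply ex_series_mult_l.
      rewrite Rabs_pos_eq.
      * replace (K * Series (fun k => / v k) * / u n) with (Series (fun k => K * / u n * / v k))
          by (rewrite Series_scal_l; ring).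
        apply Series_le; auto. intros k. split; [apply Cmod_ge_0|].
        rewrite Rmult_assoc. apply Hb.
      * apply Series_nonneg; [intros; apply Cmod_ge_0|].
        now apply reg_G; [apply reg_u_pos|].
    + now apply ex_series_mult_l.
  - set (g := fun k => 1 + 2 * Series (fun n => v k / (u n + v k))).
    assert (E1 : (fun k => CSeries (fun n => G p (u n) k)) =
       (fun k => RtoC ((-1) ^ p / 2) * RtoC (v k ^ (p - 1) * g k)
          + RtoC (- (-1) ^ p / 2 * B ^ (p - 1)) * RtoC ((INR k + 1) ^ (d2 * (p - 1))))%C).
    { extensionality k. unfold G. rewrite CSeries_RtoC, <- !RtoC_mult, <- RtoC_plus. f_equal.
      unfold g.
      replace (Series (fun n => (- v k) ^ p / (u n + v k))) with
        ((- v k) ^ p * Series (fun n => / (u n + v k))) by now rewrite <- Series_scal_l.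
      replace (Series (fun n => v k / (u n + v k))) with
        (v k * Series (fun n => / (u n + v k))) by now rewrite <- Series_scal_l.
      replace (- (-1) ^ p / 2 * B ^ (p - 1) * (INR k + 1) ^ (d2 * (p - 1))) with
        (- (-1) ^ p / 2 * v k ^ (p - 1)) by (unfold v; rewrite Rpow_mult_distr, pow_mult; ring).
      replace (- v k) with (-1 * v k) by ring. rewrite Rpow_mult_distr.
      replace (v k ^ p) with (v k * v k ^ (p - 1)) by (rewrite (tech_pow_Rmult (v k)); f_equal; lia).
      field. }
    assert (E2 : forall n, eulsum s (G p (u n)) = (RtoC (- / 2) * RtoC (u n ^ (p - 1) *
     (1 - 2 * Series (fun k => (-1) ^ k * (u n / (u n + v k)))))%R)%C).
    { intros n. assert (Hu := reg_u_pos n). destruct (reg_G p (u n) s Hu Hs) as (_ & _ & ->).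
      rewrite eulsum_Csummable by now apply reg_Csummable_G0.
      unfold alt, G. rewrite (CSeries_ext _ (fun k => RtoC ((-1) ^ k * ((- v k) ^ 0 / (u n + v k)))%R))
        by (intros; now rewrite RtoC_mult).
      rewrite CSeries_RtoC, <- !RtoC_mult, <- RtoC_minus. f_equal.
      rewrite (Series_ext (fun k => (-1) ^ k * (u n / (u n + v k)))
        (fun k => u n * ((-1) ^ k * ((- v k) ^ 0 / (u n + v k))))).
      2:{ intros k. simpl. field. generalize (reg_v_pos k); lra. }
      rewrite Series_scal_l. destruct p as [|q]; [lia|]. simpl pred. simpl Nat.sub.
      rewrite Nat.sub_0_r. rewrite <- tech_pow_Rmult. field. }
    assert (Pe : esummable s (fun k => RtoC ((INR k + 1) ^ (d2 * (p - 1)))))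
      by (apply esummable_even_pow; unfold s; nia).
    assert (Pg : esummable s (fun k => RtoC (v k ^ (p - 1) * g k))).
    { replace (fun k => RtoC (v k ^ (p - 1) * g k)) with
        (fun k => RtoC (2 * (-1) ^ p) * CSeries (fun n => G p (u n) k) +
           RtoC (B ^ (p - 1)) * RtoC ((INR k + 1) ^ (d2 * (p - 1))))%C.
      - apply esummable_plus; now apply esummable_scal.
      - extensionality k. apply equal_f with (x := k) in E1. rewrite E1.
        rewrite <- !RtoC_mult, <- !RtoC_plus, <- RtoC_mult, <- RtoC_plus. f_equal.
        assert (Hm := pow_m1_sqr p).
        transitivity ((-1) ^ p * (-1) ^ p * (v k ^ (p - 1) * g k - B ^ (p - 1) * (INR k + 1) ^ (d2 * (p - 1))) +
            B ^ (p - 1) * (INR k + 1) ^ (d2 * (p - 1))).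
        + field.
        + rewrite Hm. ring. }
    split; [now apply (esummable_le s)|].
    rewrite (eulsum_le s r) by auto.
    rewrite E1, eulsum_plus, !eulsum_scal in S3 by (auto; now apply esummable_scal).
    rewrite eulsum_even_pow in S3 by (auto; unfold s; nia).
    rewrite (CSeries_ext _ _ E2) in S3.
    fold g.
    set (X := eulsum s (fun k => RtoC (v k ^ (p - 1) * g k))) in *.
    rewrite CSeries_scal in S3.
    + set (Y := CSeries _) in *.
      assert (Hm := pow_m1_sqr p).
      transitivity (RtoC (- 2) * (RtoC (- / 2) * Y))%C.
      { rewrite Cmult_assoc, <- RtoC_mult. replace (-2 * - / 2) with 1 by field. ring. }
      rewrite <- S3. destruct (Nat.eqb_spec p 1) as [->|Hp1].
      * simpl. rewrite Cmult_plus_distr_l, !Cmult_assoc, <- !RtoC_mult.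
        f_equal; [f_equal|]; f_equal; field.
      * replace (Nat.eqb (p - 1) 0) with false by (symmetry; apply Nat.eqb_neq; lia).
        rewrite Cmult_plus_distr_l, !Cmult_assoc, <- !RtoC_mult.
        f_equal; [f_equal|]; f_equal; field.
    + apply Csummable_ext with (fun n => RtoC (- 2) * eulsum s (G p (u n)))%C.
      * intros n. rewrite E2, Cmult_assoc, <- RtoC_mult.
        replace (-2 * - / 2) with 1 by field. ring.
      * now apply Csummable_scal.
Qed.

End Regularised_exchange.

(** * Roots of unity and partial fractions of coth *)

Lemma Cexp_plus (z w : C) : Cexp (z + w)%C = (Cexp z * Cexp w)%C.
Proof.
  unfold Cexp, Cmult, Re, Im; simpl. rewrite exp_plus, cos_plus, sin_plus. apply injective_projections; simpl; ring.
Qed.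

Lemma Cexp_0 : Cexp 0 = 1.
Proof. unfold Cexp; simpl. rewrite exp_0, cos_0, sin_0. apply injective_projections; simpl; ring. Qed.

Lemma Cexp_RtoC (x : R) : Cexp (RtoC x) = RtoC (exp x).
Proof. unfold Cexp; simpl. rewrite cos_0, sin_0. apply injective_projections; simpl; ring. Qed.

Lemma Cexp_neg (z : C) : (Cexp z * Cexp (- z) = 1)%C.
Proof. rewrite <- Cexp_plus, Cplus_opp_r. apply Cexp_0. Qed.

Lemma Cexp_neq_0 (z : C) : Cexp z <> 0.
Proof.
  intros H. assert (E := Cexp_neg z). rewrite H, Cmult_0_l in E.
  apply (f_equal fst) in E. simpl in E. lra.
Qed.

Lemma Cexp_opp (z : C) : Cexp (- z)%C = (/ Cexp z)%C.
Proof.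
  assert (H := Cexp_neq_0 z). rewrite <- (Cmult_1_l (/ Cexp z)), <- (Cexp_neg z). field. exact H.
Qed.

Lemma Cmod_Cexp (z : C) : Cmod (Cexp z) = exp (Re z).
Proof.
  unfold Cmod, Cexp; simpl.
  replace (exp (Re z) * cos (Im z) * (exp (Re z) * cos (Im z) * 1) +
           exp (Re z) * sin (Im z) * (exp (Re z) * sin (Im z) * 1))
    with (exp (Re z) ^ 2 * (Rsqr (sin (Im z)) + Rsqr (cos (Im z)))) by (unfold Rsqr; ring).
  rewrite sin2_cos2, Rmult_1_r. apply sqrt_pow2, Rlt_le, exp_pos.
Qed.

Lemma Cexp_pow (z : C) (n : nat) : (Cexp z ^ n)%C = Cexp (RtoC (INR n) * z)%C.
Proof.
  induction n as [|n IH].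
  - simpl. rewrite Cmult_0_l. now rewrite Cexp_0.
  - rewrite S_INR, RtoC_plus, Cmult_plus_distr_r, Cexp_plus, <- IH, Cmult_1_l.
    rewrite Cpow_S. ring.
Qed.

Lemma C_neq (z w : C) : Re z <> Re w \/ Im z <> Im w -> z <> w.
Proof. intros [H|H] E; apply H; now rewrite E. Qed.

Fixpoint csum (n : nat) (f : nat -> C) : C :=
  match n with O => RtoC 0 | S n => (csum n f + f n)%C end.

Lemma csum_ext (n : nat) (f g : nat -> C) :
  (forall k, (k < n)%nat -> f k = g k) -> csum n f = csum n g.
Proof. induction n as [|n IH]; intros H; simpl; auto. rewrite IH, H; auto. Qed.

Lemma csum_plus (n : nat) (f g : nat -> C) :
  (csum n (fun k => f k + g k) = csum n f + csum n g)%C.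
Proof. induction n as [|n IH]; simpl. ring. rewrite IH. ring. Qed.

Lemma csum_scal (n : nat) (c : C) (f : nat -> C) :
  (csum n (fun k => c * f k) = c * csum n f)%C.
Proof. induction n as [|n IH]; simpl. ring. rewrite IH. ring. Qed.

Lemma csum_const (n : nat) (c : C) : (csum n (fun _ => c) = RtoC (INR n) * c)%C.
Proof.
  induction n as [|n IH]; [simpl; ring|]. simpl csum. rewrite IH, S_INR, RtoC_plus. ring.
Qed.

Lemma csum_S_l (n : nat) (f : nat -> C) :
  (csum (S n) f = f 0%nat + csum n (fun k => f (S k)))%C.
Proof.
  induction n as [|n IH]; [simpl; ring|].
  change (csum (S (S n)) f) with (csum (S n) f + f (S n))%C. rewrite IH. simpl. ring.
Qed.

Lemma csum_swap (n m : nat) (f : nat -> nat -> C) :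
  csum n (fun i => csum m (f i)) = csum m (fun j => csum n (fun i => f i j)).
Proof.
  induction n as [|n IH]; simpl.
  - rewrite csum_const. ring.
  - rewrite IH, <- csum_plus. reflexivity.
Qed.

Lemma csum_geom (n : nat) (w : C) : ((1 - w) * csum n (fun k => w ^ k) = 1 - w ^ n)%C.
Proof.
  induction n as [|n IH]; simpl csum.
  - simpl. ring.
  - rewrite Cmult_plus_distr_l, IH, Cpow_S. ring.
Qed.

Lemma sum_n_csum (f : nat -> C) (n : nat) :
  sum_n (G := C_AbelianMonoid) f n = csum (S n) f.
Proof.
  induction n as [|n IH]. rewrite sum_O. simpl. ring. rewrite sum_Sn, IH. reflexivity.
Qed.

Definition ssum (h : nat) (f : Z -> C) : C :=
  csum (2 * h + 1) (fun l => f (Z.of_nat l - Z.of_nat h)%Z).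

Lemma ssum_ext (h : nat) (f g : Z -> C) :
  (forall j, (- Z.of_nat h <= j <= Z.of_nat h)%Z -> f j = g j) -> ssum h f = ssum h g.
Proof. intros H. apply csum_ext. intros k Hk. apply H. lia. Qed.

Lemma ssum_plus (h : nat) (f g : Z -> C) :
  (ssum h (fun j => f j + g j) = ssum h f + ssum h g)%C.
Proof. unfold ssum. apply csum_plus. Qed.

Lemma ssum_scal (h : nat) (c : C) (f : Z -> C) :
  (ssum h (fun j => c * f j) = c * ssum h f)%C.
Proof. unfold ssum. apply csum_scal. Qed.

Lemma ssum_const (h : nat) (c : C) : (ssum h (fun _ => c) = RtoC (INR (2 * h + 1)) * c)%C.
Proof. unfold ssum. apply csum_const. Qed.

Lemma ssum_pair (h : nat) (f : Z -> C) :
  (ssum h f = f 0%Z + csum h (fun j => f (Z.of_nat (S j)) + f (- Z.of_nat (S j))%Z))%C.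
Proof.
  induction h as [|h IH]; unfold ssum in *.
  - simpl. ring.
  - replace (2 * S h + 1)%nat with (S (S (2 * h + 1))) by lia.
    rewrite csum_S_l. cbn [csum].
    rewrite (csum_ext _ (fun k => f (Z.of_nat (S k) - Z.of_nat (S h))%Z)
       (fun l => f (Z.of_nat l - Z.of_nat h)%Z)) by (intros; f_equal; lia).
    rewrite IH.
    replace (Z.of_nat (S (2 * h + 1)) - Z.of_nat (S h))%Z with (Z.of_nat (S h)) by lia.
    replace (Z.of_nat 0 - Z.of_nat (S h))%Z with (- Z.of_nat (S h))%Z by lia.
    ring.
Qed.

Lemma ssum_opp (h : nat) (f : Z -> C) : ssum h (fun j => f (- j)%Z) = ssum h f.
Proof.
  rewrite !ssum_pair. f_equal. apply csum_ext. intros k _. rewrite Z.opp_involutive. ring.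
Qed.

Lemma Csum_Z_ssum (h : nat) (f : Z -> C) : Csum_Z f (- Z.of_nat h) (Z.of_nat h) = ssum h f.
Proof.
  unfold Csum_Z, ssum. replace (Z.to_nat (Z.of_nat h - - Z.of_nat h + 1)) with (S (2 * h)) by lia.
  rewrite <- sum_n_m_S.
  change (sum_n (G := C_AbelianMonoid) (fun k => f (- Z.of_nat h + Z.of_nat (S k) - 1)%Z) (2 * h) =
    csum (2 * h + 1) (fun l => f (Z.of_nat l - Z.of_nat h)%Z)).
  rewrite sum_n_csum. replace (2 * h + 1)%nat with (S (2 * h)) by lia.
  apply csum_ext. intros; f_equal; lia.
Qed.

Definition cis (t : R) : C := Cexp (Ci * RtoC t)%C.

Lemma cis_eq (t : R) : cis t = (cos t, sin t).
Proof.
  unfold cis, Cexp; simpl. replace (0 * t - 1 * 0) with 0 by ring.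
  replace (0 * 0 + 1 * t) with t by ring. rewrite exp_0. f_equal; ring.
Qed.

Lemma cis_plus (s t : R) : cis (s + t) = (cis s * cis t)%C.
Proof. unfold cis. rewrite RtoC_plus, Cmult_plus_distr_l. apply Cexp_plus. Qed.

Lemma cis_pow (t : R) (n : nat) : (cis t ^ n)%C = cis (INR n * t).
Proof. unfold cis. rewrite Cexp_pow. f_equal. rewrite RtoC_mult. ring. Qed.

Lemma cis_2PI_Z (k : Z) : cis (2 * PI * IZR k) = 1.
Proof.
  rewrite cis_eq.
  assert (H : forall n : nat, cos (2 * PI * INR n) = 1 /\ sin (2 * PI * INR n) = 0).
  { intros n. generalize (cos_period 0 n) (sin_period 0 n).
    rewrite cos_0, sin_0, Rplus_0_l. replace (2 * INR n * PI) with (2 * PI * INR n) by ring. auto. }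
  destruct (Z_le_gt_dec 0 k) as [Hk|Hk].
  - destruct (H (Z.to_nat k)) as [H1 H2]. rewrite INR_IZR_INZ, Z2Nat.id in H1, H2 by auto.
    now rewrite H1, H2.
  - destruct (H (Z.to_nat (- k))) as [H1 H2]. rewrite INR_IZR_INZ, Z2Nat.id, opp_IZR in H1, H2 by lia.
    replace (2 * PI * - IZR k) with (- (2 * PI * IZR k)) in H1, H2 by ring.
    rewrite cos_neg in H1. rewrite sin_neg in H2. unfold RtoC. f_equal; lra.
Qed.

Lemma cis_neq_1 (t : R) : 0 < t < 2 * PI -> cis t <> 1.
Proof.
  intros Ht. rewrite cis_eq. apply C_neq. left. simpl. intros H.
  assert (Hs : 0 < sin (t / 2)) by (apply sin_gt_0; lra).
  assert (E := cos_2a_sin (t / 2)). replace (2 * (t / 2)) with t in E by field. nra.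
Qed.

Lemma ssum_cis_pow (h l : nat) : (0 < l < 2 * h + 1)%nat ->
  ssum h (fun j => cis (2 * PI * IZR j / INR (2 * h + 1)) ^ l)%C = 0.
Proof.
  intros Hl. set (n := (2 * h + 1)%nat) in *.
  assert (Hn : 0 < INR n) by (apply lt_0_INR; lia).
  set (w := cis (2 * PI * INR l / INR n)).
  assert (Hw : w <> 1).
  { apply cis_neq_1. assert (Hlp : 0 < INR l) by (apply lt_0_INR; lia).
    assert (Hln : INR l < INR n) by (apply lt_INR; lia).
    generalize PI_RGT_0; intros. split.
    - apply Rdiv_lt_0_compat; nra.
    - apply Rlt_div_l; nra. }
  unfold ssum. fold n.
  rewrite (csum_ext n _ (fun i => cis (- (2 * PI * INR l * INR h / INR n)) * w ^ i)%C).
  - rewrite csum_scal.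
    assert (E := csum_geom n w).
    replace (w ^ n)%C with (RtoC 1) in E.
    + assert (H1 : (1 - w <> 0)%C).
      { intros H. apply Hw. replace w with (1 - (1 - w))%C by ring. rewrite H. ring. }
      assert (E0 : csum n (fun k => w ^ k)%C = 0).
      { replace (csum n (fun k => w ^ k)%C) with (((1 - w) * csum n (fun k => w ^ k)) / (1 - w))%C
          by (field; auto). rewrite E. field. auto. }
      etransitivity; [apply f_equal; exact E0|ring].
    + unfold w. rewrite cis_pow. replace (INR n * (2 * PI * INR l / INR n)) with (2 * PI * IZR (Z.of_nat l)).
      * now rewrite cis_2PI_Z.
      * rewrite <- INR_IZR_INZ. field. lra.
  - intros i _. unfold w. rewrite !cis_pow, <- cis_plus. f_equal.
    rewrite minus_IZR, <- !INR_IZR_INZ. field. lra.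
Qed.

(** Since w^n = 1, 1/(1 - w X) is the finite geometric sum of (w X)^l, l < n, divided by 1 - X^n;
    summation over the roots w leaves only l = 0. *)
Lemma ssum_roots (h : nat) (X : C) : (X ^ (2 * h + 1) <> 1)%C ->
  ssum h (fun j => / (1 - cis (2 * PI * IZR j / INR (2 * h + 1)) * X))%C =
  (RtoC (INR (2 * h + 1)) / (1 - X ^ (2 * h + 1)))%C.
Proof.
  intros HX. set (n := (2 * h + 1)%nat) in *.
  assert (Hn : 0 < INR n) by (apply lt_0_INR; unfold n; lia).
  assert (H1 : (1 - X ^ n <> 0)%C).
  { intros H. apply HX. replace (X ^ n)%C with (1 - (1 - X ^ n))%C by ring. rewrite H. ring. }
  rewrite (ssum_ext h _ (fun j => / (1 - X ^ n) *
     csum n (fun l => cis (2 * PI * IZR j / INR n) ^ l * X ^ l))%C).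
  - rewrite ssum_scal. unfold ssum. fold n. rewrite csum_swap.
    rewrite (csum_ext n _ (fun l => if Nat.eqb l 0 then RtoC (INR n) else 0)%C).
    + assert (E0 : forall (m : nat) (c : C), csum (S m) (fun l => if Nat.eqb l 0 then c else 0)%C = c).
      { intros m c. rewrite csum_S_l. simpl Nat.eqb. cbv iota. rewrite csum_const. ring. }
      replace n with (S (2 * h)) at 2 by (unfold n; lia). rewrite E0. field. auto.
    + intros l Hl. destruct l as [|l]; simpl Nat.eqb; cbv iota.
      * rewrite (csum_ext n _ (fun _ => 1)) by (intros; simpl; ring). rewrite csum_const. ring.
      * rewrite (csum_ext n _ (fun i => X ^ (S l) *
          cis (2 * PI * IZR (Z.of_nat i - Z.of_nat h) / INR n) ^ (S l))%C) by (intros; ring).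
        rewrite csum_scal.
        assert (E := ssum_cis_pow h (S l) ltac:(unfold n in Hl; lia)). unfold ssum in E. fold n in E.
        rewrite E. ring.
  - intros j _. set (w := cis _).
    assert (Hw : (w ^ n)%C = 1).
    { unfold w. rewrite cis_pow. replace (INR n * (2 * PI * IZR j / INR n)) with (2 * PI * IZR j).
      apply cis_2PI_Z. field. lra. }
    rewrite (csum_ext n _ (fun l => (w * X) ^ l)%C) by (intros; now rewrite Cpow_mult_l).
    assert (E := csum_geom n (w * X)%C). rewrite Cpow_mult_l, Hw, Cmult_1_l in E.
    assert (H2 : (1 - w * X <> 0)%C).
    { intros H. rewrite H, Cmult_0_l in E. now rewrite <- E in H1. }
    rewrite <- E. field. split; auto. intros H. rewrite H, Cmult_0_r in E.
    now rewrite <- E in H1.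
Qed.

(** * Limits of complex sequences and Tannery's theorem *)

Definition Clim (u : nat -> C) (l : C) : Prop :=
  forall e, 0 < e -> exists H, forall h, (H <= h)%nat -> Cmod (u h - l)%C < e.

Lemma Clim_ext (u v : nat -> C) (l : C) : (forall h, u h = v h) -> Clim u l -> Clim v l.
Proof.
  intros E H e He. destruct (H e He) as [K HK]. exists K. intros h Hh. rewrite <- E. auto.
Qed.

Lemma Clim_const (c : C) : Clim (fun _ => c) c.
Proof.
  intros e He. exists 0%nat. intros h _. unfold Cminus. rewrite Cplus_opp_r, Cmod_0. auto.
Qed.

Lemma Clim_plus (u v : nat -> C) (l m : C) :
  Clim u l -> Clim v m -> Clim (fun h => u h + v h)%C (l + m)%C.
Proof.
  intros Hu Hv e He. destruct (Hu (e / 2)) as [K1 H1]; [lra|]. destruct (Hv (e / 2)) as [K2 H2]; [lra|].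
  exists (K1 + K2)%nat. intros h Hh.
  replace (u h + v h - (l + m))%C with ((u h - l) + (v h - m))%C by ring.
  eapply Rle_lt_trans; [apply Cmod_triangle|].
  specialize (H1 h ltac:(lia)). specialize (H2 h ltac:(lia)). lra.
Qed.

Lemma Cmod_sub_le (z w : C) : Cmod z <= Cmod w + Cmod (z - w)%C.
Proof.
  replace z with (w + (z - w))%C at 1 by ring. apply Cmod_triangle.
Qed.

Lemma Clim_bound (u : nat -> C) (l : C) :
  Clim u l -> exists H, forall h, (H <= h)%nat -> Cmod (u h) <= Cmod l + 1.
Proof.
  intros Hu. destruct (Hu 1) as [K HK]; [lra|]. exists K. intros h Hh.
  specialize (HK h Hh). generalize (Cmod_sub_le (u h) l). lra.
Qed.

Lemma Clim_mult (u v : nat -> C) (l m : C) :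
  Clim u l -> Clim v m -> Clim (fun h => u h * v h)%C (l * m)%C.
Proof.
  intros Hu Hv e He. destruct (Clim_bound v m Hv) as [K0 H0].
  set (M := Cmod m + Cmod l + 1).
  assert (HM : 0 < M) by (unfold M; generalize (Cmod_ge_0 m) (Cmod_ge_0 l); lra).
  assert (He' : 0 < e / (2 * M)) by (apply Rdiv_lt_0_compat; lra).
  destruct (Hu _ He') as [K1 H1]. destruct (Hv _ He') as [K2 H2].
  exists (K0 + K1 + K2)%nat. intros h Hh.
  replace (u h * v h - l * m)%C with ((u h - l) * v h + l * (v h - m))%C by ring.
  eapply Rle_lt_trans; [apply Cmod_triangle|]. rewrite !Cmod_mult.
  specialize (H0 h ltac:(lia)). specialize (H1 h ltac:(lia)). specialize (H2 h ltac:(lia)).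
  assert (e = e / (2 * M) * M + M * (e / (2 * M))) by (field; lra).
  set (d := e / (2 * M)) in *.
  assert (Cmod (u h - l)%C * Cmod (v h) <= d * (Cmod m + 1)).
  { apply Rmult_le_compat; try apply Cmod_ge_0; lra. }
  assert (Cmod l * Cmod (v h - m)%C <= Cmod l * d).
  { apply Rmult_le_compat_l; try apply Cmod_ge_0; lra. }
  unfold M in *. generalize (Cmod_ge_0 l) (Cmod_ge_0 m). intros. nra.
Qed.

Lemma Clim_inv (u : nat -> C) (l : C) : l <> 0 -> Clim u l -> Clim (fun h => / u h)%C (/ l)%C.
Proof.
  intros Hl Hu e He. assert (Hl' : 0 < Cmod l) by now apply Cmod_gt_0.
  destruct (Hu (Cmod l / 2)) as [K1 H1]; [lra|].
  destruct (Hu (e * (Cmod l * Cmod l / 2))) as [K2 H2].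
  { apply Rmult_lt_0_compat; auto. nra. }
  exists (K1 + K2)%nat. intros h Hh. specialize (H1 h ltac:(lia)). specialize (H2 h ltac:(lia)).
  assert (Hh' : Cmod l / 2 < Cmod (u h)).
  { generalize (Cmod_sub_le l (u h)). replace (l - u h)%C with (- (u h - l))%C by ring.
    rewrite Cmod_opp. lra. }
  assert (Hn : u h <> 0) by (apply Cmod_gt_0; lra).
  replace (/ u h - / l)%C with (- (u h - l) * / (u h * l))%C by (field; auto).
  rewrite Cmod_mult, Cmod_opp, Cmod_inv, Cmod_mult by (apply Cmult_neq_0; auto).
  apply Rmult_lt_reg_r with (Cmod (u h) * Cmod l). nra.
  rewrite Rmult_assoc, Rinv_l, Rmult_1_r by nra.
  eapply Rlt_le_trans; [exact H2|]. apply Rmult_le_compat_l; [lra|]. nra.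
Qed.

Lemma Clim_unique (u : nat -> C) (l m : C) : Clim u l -> Clim u m -> l = m.
Proof.
  intros Hl Hm. destruct (Req_dec (Cmod (l - m)%C) 0) as [E|E].
  - apply Cmod_eq_0 in E. replace l with (m + (l - m))%C by ring. rewrite E. ring.
  - assert (Hp := Cmod_ge_0 (l - m)%C). set (d := Cmod (l - m)%C) in *.
    destruct (Hl (d / 2)) as [K1 H1]; [lra|]. destruct (Hm (d / 2)) as [K2 H2]; [lra|].
    specialize (H1 (K1 + K2)%nat ltac:(lia)). specialize (H2 (K1 + K2)%nat ltac:(lia)).
    assert (d <= Cmod (u (K1 + K2)%nat - m)%C + Cmod (u (K1 + K2)%nat - l)%C).
    { unfold d. replace (l - m)%C with ((u (K1 + K2)%nat - m) + - (u (K1 + K2)%nat - l))%C by ring.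
      eapply Rle_trans; [apply Cmod_triangle|]. rewrite Cmod_opp. lra. }
    lra.
Qed.

Lemma Clim_Re_Im (u : nat -> C) (l : C) :
  is_lim_seq (fun h => Re (u h)) (Re l) -> is_lim_seq (fun h => Im (u h)) (Im l) -> Clim u l.
Proof.
  intros Hr Hi e He. apply is_lim_seq_Reals in Hr. apply is_lim_seq_Reals in Hi.
  destruct (Hr (e / 2)) as [K1 H1]; [lra|]. destruct (Hi (e / 2)) as [K2 H2]; [lra|].
  exists (K1 + K2)%nat. intros h Hh. specialize (H1 h ltac:(lia)). specialize (H2 h ltac:(lia)).
  eapply Rle_lt_trans; [apply Cmod_le_Re_Im|]. unfold Rdist in *.
  replace (Re (u h - l)%C) with (Re (u h) - Re l) by reflexivity.
  replace (Im (u h - l)%C) with (Im (u h) - Im l) by reflexivity. lra.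
Qed.

Lemma Csummable_tail (J : nat) (a : nat -> C) (M : nat -> R) :
  (forall j, (J <= j)%nat -> Cmod (a j) <= M j) -> ex_series M -> Csummable a.
Proof.
  intros H HM. apply (ex_series_incr_n (fun j => Cmod (a j)) J).
  apply ex_series_bound with (fun k => M (J + k)%nat).
  - intros k. rewrite Rabs_pos_eq by apply Cmod_ge_0. apply H. lia.
  - now apply (ex_series_incr_n M J).
Qed.

Lemma CSeries_Clim (a : nat -> C) : Csummable a -> Clim (fun n => csum n a) (CSeries a).
Proof.
  intros Ha.
  assert (Hr := Series_correct _ (ex_series_Rabs _ (Csummable_Re _ Ha))).
  assert (Hi := Series_correct _ (ex_series_Rabs _ (Csummable_Im _ Ha))).
  assert (H : Clim (fun n => csum (S n) a) (CSeries a)).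
  { apply Clim_Re_Im.
    - apply is_lim_seq_ext with (2 := Hr). intros n. now rewrite <- sum_n_csum, Re_sum_n.
    - apply is_lim_seq_ext with (2 := Hi). intros n. now rewrite <- sum_n_csum, Im_sum_n. }
  intros e He. destruct (H e He) as [K HK]. exists (S K). intros h Hh.
  destruct h as [|h]; [lia|]. apply HK. lia.
Qed.

Lemma csum_split (J n : nat) (a : nat -> C) :
  (csum (J + n) a = csum J a + csum n (fun k => a (J + k)%nat))%C.
Proof.
  induction n as [|n IH]; simpl.
  - rewrite Nat.add_0_r. ring.
  - rewrite Nat.add_succ_r. simpl. rewrite IH. ring.
Qed.

Lemma Cmod_csum_le (n : nat) (a : nat -> C) (M : nat -> R) :
  (forall k, (k < n)%nat -> Cmod (a k) <= M k) -> (forall k, 0 <= M k) -> ex_series M ->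
  Cmod (csum n a) <= Series M.
Proof.
  intros H Hp HM. destruct n as [|n].
  { simpl. rewrite Cmod_0. now apply Series_nonneg. }
  apply Rle_trans with (sum_n M n); [|now apply sum_n_le_Series].
  induction n as [|n IH].
  - simpl. rewrite sum_O, Cplus_0_l. apply H. lia.
  - rewrite sum_Sn. change (plus (sum_n M n) (M (S n))) with (sum_n M n + M (S n)).
    change (csum (S (S n)) a) with (csum (S n) a + a (S n))%C.
    eapply Rle_trans; [apply Cmod_triangle|]. apply Rplus_le_compat; auto.
Qed.

Lemma Clim_csum (J : nat) (T : nat -> nat -> C) (L : nat -> C) :
  (forall j, Clim (fun h => T h j) (L j)) ->
  Clim (fun h => csum J (T h)) (csum J L).
Proof.
  intros H. induction J as [|J IH]; simpl. apply Clim_const. now apply Clim_plus.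
Qed.

(** Dominated convergence for sums whose length grows with h: finitely many terms converge, and the
    tail is bounded by that of [M] uniformly in h. The bound is asked only from [J0] and [H0] on,
    because the denominators to which it is applied are under control only there. *)
Lemma tannery (T : nat -> nat -> C) (L : nat -> C) (M : nat -> R) (J0 H0 : nat) :
  (forall j, Clim (fun h => T h j) (L j)) -> Csummable L ->
  (forall h j, (H0 <= h)%nat -> (J0 <= j < h)%nat -> Cmod (T h j) <= M j) ->
  (forall j, 0 <= M j) -> ex_series M ->
  Clim (fun h => csum h (T h)) (CSeries L).
Proof.
  intros HT HL Hb Hp HM e He.
  destruct (CSeries_Clim L HL (e / 3)) as [K1 HK1]; [lra|].
  assert (Htail : exists K, forall J, (K <= J)%nat -> Series (fun k => M (J + k)%nat) < e / 3).
  { assert (Hs := Series_correct _ HM). apply is_lim_seq_Reals in Hs.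
    destruct (Hs (e / 3)) as [K HK]; [lra|]. exists (S K). intros J HJ.
    destruct J as [|J]; [lia|]. specialize (HK J ltac:(lia)). unfold Rdist in HK.
    rewrite sum_n_Reals in HK. rewrite (Series_incr_n M (S J)) in HK by (lia || auto).
    simpl pred in HK. rewrite Rabs_minus_sym in HK.
    apply Rle_lt_trans with (2 := HK). eapply Rle_trans; [|apply Rle_abs]. lra. }
  destruct Htail as [K2 HK2].
  set (J := (J0 + K1 + K2)%nat).
  destruct (Clim_csum J T L HT (e / 3)) as [K3 HK3]; [lra|].
  exists (H0 + J + K3)%nat. intros h Hh.
  assert (E : csum h (T h) = (csum J (T h) + csum (h - J) (fun k => T h (J + k)%nat))%C).
  { rewrite <- csum_split. f_equal. lia. }
  rewrite E.
  specialize (HK3 h ltac:(lia)). specialize (HK1 J ltac:(unfold J; lia)).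
  specialize (HK2 J ltac:(unfold J; lia)).
  assert (Hc : Cmod (csum (h - J) (fun k => T h (J + k)%nat)) <= Series (fun k => M (J + k)%nat)).
  { apply Cmod_csum_le; auto.
    - intros k Hk. apply Hb; unfold J in *; lia.
    - now apply (ex_series_incr_n M J). }
  set (a := csum J (T h)) in *. set (b := csum (h - J) _) in *. set (c := csum J L) in *.
  replace (a + b - CSeries L)%C with ((a - c) + ((c - CSeries L) + b))%C by ring.
  eapply Rle_lt_trans; [apply Cmod_triangle|].
  assert (H := Cmod_triangle (c - CSeries L)%C b). lra.
Qed.

Lemma lim_scaled_derive (F : R -> R) (l : R) :
  is_derive F 0 l -> F 0 = 0 ->
  is_lim_seq (fun h => INR (2 * h + 1) * F (/ INR (2 * h + 1))) l.
Proof.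
  intros HF H0. apply is_derive_Reals in HF. apply is_lim_seq_Reals. intros e He.
  destruct (HF e He) as [d Hd]. destruct (nfloor_ex (/ d)) as [K [_ HK]].
  { apply Rinv_ge_0, cond_pos. }
  exists K. intros h Hh. unfold Rdist.
  assert (Hn : INR K + 1 <= INR (2 * h + 1)).
  { rewrite plus_INR, mult_INR. simpl. apply le_INR in Hh. generalize (pos_INR h). lra. }
  set (n := INR (2 * h + 1)) in *.
  assert (Hn0 : 0 < n) by (generalize (pos_INR K); lra).
  specialize (Hd (/ n)). rewrite Rplus_0_l, H0, Rminus_0_r in Hd.
  replace (F (/ n) / / n) with (n * F (/ n)) in Hd by (field; lra).
  apply Hd.
  - apply Rinv_neq_0_compat. lra.
  - rewrite Rabs_pos_eq by (apply Rinv_ge_0; lra).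
    rewrite <- (Rinv_inv d). apply Rinv_lt_contravar; [|lra].
    apply Rmult_lt_0_compat; auto. apply Rinv_0_lt_compat, cond_pos.
Qed.

Lemma Clim_Cexp_scaled (z : C) :
  Clim (fun h => RtoC (INR (2 * h + 1)) * (Cexp (RtoC (/ INR (2 * h + 1)) * z) - 1))%C z.
Proof.
  destruct z as [x y]. apply Clim_Re_Im; simpl.
  - apply is_lim_seq_ext with (fun h => INR (2 * h + 1) *
      (fun t => exp (t * x) * cos (t * y) - 1) (/ INR (2 * h + 1))).
    + intros h. simpl. replace (/ INR (h + (h + 0) + 1) * x - 0 * y) with (/ INR (h + (h + 0) + 1) * x) by ring.
      replace (/ INR (h + (h + 0) + 1) * y + 0 * x) with (/ INR (h + (h + 0) + 1) * y) by ring. ring.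
    + apply (lim_scaled_derive (fun t => exp (t * x) * cos (t * y) - 1)).
      * auto_derive; auto. rewrite !Rmult_0_l, exp_0, cos_0, sin_0. ring.
      * rewrite !Rmult_0_l, exp_0, cos_0. ring.
  - apply is_lim_seq_ext with (fun h => INR (2 * h + 1) *
      (fun t => exp (t * x) * sin (t * y)) (/ INR (2 * h + 1))).
    + intros h. simpl. replace (/ INR (h + (h + 0) + 1) * x - 0 * y) with (/ INR (h + (h + 0) + 1) * x) by ring.
      replace (/ INR (h + (h + 0) + 1) * y + 0 * x) with (/ INR (h + (h + 0) + 1) * y) by ring. ring.
    + apply (lim_scaled_derive (fun t => exp (t * x) * sin (t * y))).
      * auto_derive; auto. rewrite !Rmult_0_l, exp_0, cos_0, sin_0. ring.
      * rewrite !Rmult_0_l, exp_0, sin_0. ring.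
Qed.

(** * Partial fractions of the hyperbolic cotangent *)

(** This is coth(z/2)/2. *)
Definition Ccoth (z : C) : C := (/ 2 + / (Cexp z - 1))%C.

Lemma Cexp_neq_1 (z : C) : Re z <> 0 -> Cexp z <> 1.
Proof.
  intros Hz E. apply (f_equal Cmod) in E. rewrite Cmod_Cexp, Cmod_1 in E.
  apply Hz, exp_inv. now rewrite exp_0.
Qed.

Lemma Cminus_neq_0 (z w : C) : z <> w -> (z - w)%C <> 0.
Proof. intros H E. apply H. replace z with (z - w + w)%C by ring. rewrite E. ring. Qed.

Lemma Ccoth_inv (z : C) : Re z <> 0 -> (/ (1 - Cexp (- z)) = / 2 + Ccoth z)%C.
Proof.
  intros Hz. assert (H1 := Cminus_neq_0 _ _ (Cexp_neq_1 z Hz)).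
  unfold Ccoth. rewrite Cexp_opp. assert (H0 := Cexp_neq_0 z).
  set (w := Cexp z) in *. field. repeat split; auto.
Qed.

(** The root-of-unity sum at X = exp(-z/n), with 1/(1 - exp(-z)) = 1/2 + [Ccoth z]; the constants
    n/2 cancel. *)
Lemma Ccoth_multisection (z : C) (h : nat) : Re z <> 0 ->
  ssum h (fun j => Ccoth (RtoC (/ INR (2 * h + 1)) * z - Ci * RtoC (2 * PI * IZR j / INR (2 * h + 1))))%C
   = (RtoC (INR (2 * h + 1)) * Ccoth z)%C.
Proof.
  intros Hz. set (n := INR (2 * h + 1)).
  assert (Hn : 0 < n) by (apply lt_0_INR; lia).
  set (X := Cexp (- (RtoC (/ n) * z))%C).
  assert (HX : (X ^ (2 * h + 1) = Cexp (- z))%C).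
  { unfold X. rewrite Cexp_pow. f_equal. fold n.
    replace (RtoC n * - (RtoC (/ n) * z))%C with (- (RtoC n * RtoC (/ n) * z))%C by ring.
    rewrite <- RtoC_mult, Rinv_r by lra. ring. }
  assert (E := ssum_roots h X). fold n in E.
  rewrite (ssum_ext h _ (fun j => / 2 + Ccoth (RtoC (/ n) * z - Ci * RtoC (2 * PI * IZR j / n)))%C) in E.
  - rewrite ssum_plus, ssum_const in E. fold n in E.
    assert (E' : (X ^ (2 * h + 1))%C <> 1) by (rewrite HX; apply Cexp_neq_1; now apply Ropp_neq_0_compat).
    specialize (E E'). rewrite HX in E. unfold Cdiv in E. rewrite Ccoth_inv in E by auto.
    set (S := ssum _ _) in *. replace S with (RtoC n * / 2 + S - RtoC n * / 2)%C by ring.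
    rewrite E. ring.
  - intros j _. rewrite <- Ccoth_inv.
    + do 2 f_equal. unfold X. unfold cis. rewrite <- Cexp_plus. f_equal. f_equal. ring.
    + simpl. assert (0 < / n) by now apply Rinv_0_lt_compat.
      replace (/ n * fst z - 0 * snd z + - (0 * (2 * PI * IZR j / n) - 1 * 0)) with (/ n * Re z) by (unfold Re; ring).
      apply Rmult_integral_contrapositive. split; [lra|auto].
Qed.

(** With p = exp(a/2) and q = exp(i b/2) this is a rational identity. The denominator is (2
    sinh(a/2))^2 + (2 sin(b/2))^2, a form in which a and b can be scaled by 1/n and passed to the
    limit. *)
Lemma Ccoth_pair (a : C) (b : R) : Re a <> 0 ->
  ((Cexp (a / 2) - Cexp (- (a / 2))) * (Cexp (a / 2) - Cexp (- (a / 2)))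
     + RtoC ((2 * sin (b / 2)) ^ 2))%C <> 0 /\
  (Ccoth (a - Ci * RtoC b) + Ccoth (a + Ci * RtoC b) =
   (Cexp a - Cexp (- a)) / ((Cexp (a / 2) - Cexp (- (a / 2))) * (Cexp (a / 2) - Cexp (- (a / 2)))
     + RtoC ((2 * sin (b / 2)) ^ 2)))%C.
Proof.
  intros Ha.
  set (p := Cexp (a / 2)%C). set (q := cis (b / 2)).
  assert (Hp : p <> 0) by apply Cexp_neq_0.
  assert (Hq : q <> 0) by apply Cexp_neq_0.
  assert (Ep : Cexp a = (p * p)%C) by (unfold p; rewrite <- Cexp_plus; f_equal; field).
  assert (Eq : Cexp (Ci * RtoC b)%C = (q * q)%C).
  { unfold q. rewrite <- cis_plus. unfold cis. do 2 f_equal. f_equal. field. }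
  assert (Es : RtoC ((2 * sin (b / 2)) ^ 2) = (- ((q - / q) * (q - / q)))%C).
  { assert (Ei : (/ q)%C = (cos (b / 2), - sin (b / 2))).
    { unfold q, cis. rewrite <- Cexp_opp. replace (- (Ci * RtoC (b / 2)))%C with (Ci * RtoC (- (b / 2)))%C
       by (rewrite RtoC_opp; ring). change (Cexp (Ci * RtoC (- (b / 2)))%C) with (cis (- (b / 2))).
      rewrite cis_eq, cos_neg, sin_neg. reflexivity. }
    rewrite Ei. unfold q. rewrite cis_eq. apply injective_projections; simpl; ring. }
  assert (R1 : Re (a - Ci * RtoC b)%C <> 0).
  { simpl. replace (fst a + - (0 * b - 1 * 0)) with (Re a) by (unfold Re; ring). auto. }
  assert (R2 : Re (a + Ci * RtoC b)%C <> 0).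
  { simpl. replace (fst a + (0 * b - 1 * 0)) with (Re a) by (unfold Re; ring). auto. }
  assert (N1 := Cminus_neq_0 _ _ (Cexp_neq_1 _ R1)).
  assert (N2 := Cminus_neq_0 _ _ (Cexp_neq_1 _ R2)).
  assert (X1 : Cexp (a - Ci * RtoC b)%C = (p * p * / (q * q))%C)
    by (unfold Cminus; now rewrite Cexp_plus, Cexp_opp, Ep, Eq).
  assert (X2 : Cexp (a + Ci * RtoC b)%C = (p * p * (q * q))%C)
    by now rewrite Cexp_plus, Ep, Eq.
  unfold Ccoth. rewrite X1 in *. rewrite X2 in *. rewrite !Cexp_opp, Ep. fold p. rewrite Es.
  assert (M1 : (p * p - q * q)%C <> 0).
  { intros E. apply N1. replace (p * p * / (q * q) - 1)%C with ((p * p - q * q) * / (q * q))%C by (field; auto).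
    rewrite E. ring. }
  assert (M2 : ((p * p - q * q) * (p * p * (q * q) - 1))%C <> 0) by (apply Cmult_neq_0; auto).
  split.
  - intros E. apply M2.
    replace ((p * p - q * q) * (p * p * (q * q) - 1))%C with
      (((p - / p) * (p - / p) + - ((q - / q) * (q - / q))) * (p * p * (q * q)))%C by (field; auto).
    rewrite E. ring.
  - field. repeat split; auto. intros E. apply M2. rewrite <- E. ring.
Qed.

(** A weak form of Jordan's inequality, from the Taylor lower bound of sin for x <= 2. The constant
    1/4 suffices for 2 n sin(pi (j+1)/n) >= pi (j+1)/2 >= j + 1. *)
Lemma sin_ge_quarter (x : R) : 0 <= x <= PI / 2 -> x / 4 <= sin x.
Proof.
  intros [H0 H1]. assert (HP := PI_4).
  destruct (SIN x) as [H _]; try lra.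
  eapply Rle_trans; [|exact H]. unfold sin_lb, sin_approx, sin_term. simpl.
  assert (Hx : x <= 2) by lra.
  assert (Hx2 : 0 <= x * x <= 4) by nra.
  set (y := x * x) in *.
  replace (_ + _) with (x * (1 - y / 6 + y * y / 120 - y * y * y / 5040)) by (unfold y; field).
  assert (/ 4 <= 1 - y / 6 + y * y / 120 - y * y * y / 5040).
  { assert (0 <= y * y) by nra. assert (y * y * y <= 64) by nra. lra. }
  nra.
Qed.

Lemma C_sum_sqr_neq_0 (z : C) (t : R) : 0 < Re z -> (z * z + RtoC (t ^ 2))%C <> 0.
Proof.
  intros Hz E.
  assert (E' : ((z + Ci * RtoC t) * (z - Ci * RtoC t))%C = 0).
  { rewrite <- E. simpl pow. rewrite Rmult_1_r, RtoC_mult.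
    replace (z * z + RtoC t * RtoC t)%C with (z * z - (Ci * Ci) * RtoC t * RtoC t)%C.
    - ring.
    - replace (Ci * Ci)%C with (- (1))%C by (apply injective_projections; simpl; ring). ring. }
  revert E'. apply Cmult_neq_0; apply C_neq; left; simpl; unfold Re in Hz; lra.
Qed.

(** The contributions of the two conjugate poles 2 pi i (k+1) and -2 pi i (k+1), taken together; [k]
    counts from 0. *)
Definition coth_term (z : C) (k : nat) : C := (2 * z / (z * z + RtoC ((2 * PI * (INR k + 1)) ^ 2)))%C.

Lemma Cmod_den_ge (w : C) (d j : R) :
  0 <= j <= Rabs d -> Cmod w * Cmod w <= j ^ 2 / 2 -> j ^ 2 / 2 <= Cmod (w * w + RtoC (d ^ 2))%C.
Proof.
  intros Hj Hw. generalize (Cmod_sub_le (RtoC (d ^ 2)) (w * w + RtoC (d ^ 2))%C).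
  replace (RtoC (d ^ 2) - (w * w + RtoC (d ^ 2)))%C with (- (w * w))%C by ring.
  rewrite Cmod_opp, Cmod_mult, Cmod_R, <- RPow_abs. intros H.
  assert (j ^ 2 <= Rabs d ^ 2) by (apply pow_incr; lra). lra.
Qed.

Lemma exists_sqr_ge (M : R) : exists J : nat, forall k : nat, (J <= k)%nat -> M <= (INR k + 1) ^ 2 / 2.
Proof.
  destruct (nfloor_ex (Rabs M)) as [J [_ HJ]]; [apply Rabs_pos|].
  exists (2 * J + 2)%nat. intros k Hk. apply le_INR in Hk. rewrite plus_INR, mult_INR in Hk. simpl in Hk.
  generalize (Rle_abs M) (pos_INR J). intros. nra.
Qed.

Lemma Csummable_coth_term (z : C) : Csummable (coth_term z).
Proof.
  destruct (exists_sqr_ge (Cmod z * Cmod z)) as [J HJ].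
  apply (Csummable_tail J _ (fun k => (4 * Cmod z) * / (INR k + 1) ^ 2)).
  - intros k Hk. unfold coth_term.
    assert (Hd : (INR k + 1) ^ 2 / 2 <= Cmod (z * z + RtoC ((2 * PI * (INR k + 1)) ^ 2))%C).
    { apply Cmod_den_ge; auto. assert (0 < INR k + 1) by apply INR_S_pos. generalize PI2_1; intros.
      rewrite Rabs_pos_eq; nra. }
    assert (Hk1 := INR_S_pos k). assert (Hk0 : 0 < (INR k + 1) ^ 2) by (apply pow_lt; auto).
    rewrite Cmod_div by (apply Cmod_gt_0; lra). rewrite Cmod_mult, Cmod_R, Rabs_pos_eq by lra.
    replace (4 * Cmod z * / (INR k + 1) ^ 2) with (2 * Cmod z * / ((INR k + 1) ^ 2 / 2)) by (field; lra).
    apply Rmult_le_compat_l; [generalize (Cmod_ge_0 z); lra|]. apply Rinv_le_contravar; lra.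
  - apply ex_series_mult_l, ex_series_inv_sqr.
Qed.

Lemma Clim_RtoC (u : nat -> R) (l : R) : is_lim_seq u l -> Clim (fun h => RtoC (u h)) (RtoC l).
Proof. intros H. apply Clim_Re_Im; simpl; auto. apply is_lim_seq_const. Qed.

(** The limit of the multisection formula divided by n = 2h+1: the central term tends to 1/z and
    each symmetric pair of shifts to one [coth_term], under the domination required by Tannery's
    theorem. *)
Theorem Ccoth_partial_fractions (z : C) : 0 < Re z ->
  Ccoth z = (/ z + CSeries (coth_term z))%C.
Proof.
  intros Hz.
  assert (Hz0 : z <> 0) by (intros E; rewrite E in Hz; simpl in Hz; lra).
  set (n := fun h : nat => INR (2 * h + 1)).
  assert (Hn : forall h, 0 < n h) by (intros; apply lt_0_INR; lia).
  (* 2 n sinh(w/n), with limit 2 w. *)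
  set (sg := fun (w : C) (h : nat) => (RtoC (n h) * (Cexp (RtoC (/ n h) * w) - Cexp (RtoC (/ n h) * (- w))))%C).
  assert (Hsg : forall w, Clim (sg w) (2 * w)%C).
  { intros w. apply Clim_ext with (fun h => RtoC (n h) * (Cexp (RtoC (/ n h) * w) - 1) +
       - (1) * (RtoC (n h) * (Cexp (RtoC (/ n h) * (- w)) - 1)))%C.
    - intros h. unfold sg. ring.
    - replace (2 * w)%C with (w + - (1) * (- w))%C by ring.
      apply Clim_plus; [apply Clim_Cexp_scaled|].
      apply Clim_mult; [apply Clim_const|apply Clim_Cexp_scaled]. }
  (* 2 n sin(pi (j+1)/n), with limit 2 pi (j+1). *)
  set (D := fun (h j : nat) => n h * (2 * sin (/ n h * (PI * (INR j + 1))))).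
  set (T := fun h j => (sg z h / (sg (z / 2)%C h * sg (z / 2)%C h + RtoC (D h j ^ 2)))%C).
  assert (HD : forall j, is_lim_seq (fun h => D h j) (2 * PI * (INR j + 1))).
  { intros j. unfold D, n. apply (lim_scaled_derive (fun t => 2 * sin (t * (PI * (INR j + 1))))).
    - auto_derive; auto. rewrite Rmult_0_l, cos_0. ring.
    - rewrite Rmult_0_l, sin_0. ring. }
  assert (HT : forall j, Clim (fun h => T h j) (coth_term z j)).
  { intros j. unfold T, coth_term. apply Clim_mult; [apply Hsg|]. apply Clim_inv.
    - now apply C_sum_sqr_neq_0.
    - apply Clim_plus.
      + assert (Hh := Hsg (z / 2)%C). replace (2 * (z / 2))%C with z in Hh by field.
        now apply Clim_mult.
      + simpl pow. apply Clim_ext with (fun h => RtoC (D h j) * RtoC (D h j))%C.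
        * intros h. rewrite Rmult_1_r. now rewrite RtoC_mult.
        * rewrite Rmult_1_r, RtoC_mult. apply Clim_mult; apply Clim_RtoC, HD. }
  assert (HS : Clim (fun h => csum h (T h)) (CSeries (coth_term z))).
  { destruct (Clim_bound _ _ (Hsg z)) as [H1 HB1].
    destruct (Clim_bound _ _ (Hsg (z / 2)%C)) as [H2 HB2].
    set (M1 := Cmod (2 * z)%C + 1) in *. set (M2 := Cmod (2 * (z / 2))%C + 1) in *.
    destruct (exists_sqr_ge (M2 * M2)) as [J HJ].
    apply (tannery T (coth_term z) (fun k => (2 * M1) * / (INR k + 1) ^ 2) J (H1 + H2)); auto.
    - apply Csummable_coth_term.
    - intros h j Hh Hj. unfold T. specialize (HB1 h ltac:(lia)). specialize (HB2 h ltac:(lia)).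
      specialize (HJ j ltac:(lia)).
      assert (Hj1 := INR_S_pos j). assert (Hj0 : 0 < (INR j + 1) ^ 2) by (apply pow_lt; auto).
      assert (Hd : (INR j + 1) ^ 2 / 2 <= Cmod (sg (z / 2)%C h * sg (z / 2)%C h + RtoC (D h j ^ 2))%C).
      { apply Cmod_den_ge.
        - split; [generalize (pos_INR j); lra|].
          eapply Rle_trans; [|apply Rle_abs]. unfold D.
          assert (Hjh : INR j + 1 <= INR h) by (rewrite <- S_INR; apply le_INR; lia).
          assert (Hnh : n h = 2 * INR h + 1) by (unfold n; rewrite plus_INR, mult_INR; simpl; ring).
          assert (Hpi := PI2_1). specialize (Hn h).
          assert (Hs : / n h * (PI * (INR j + 1)) / 4 <= sin (/ n h * (PI * (INR j + 1)))).
          { apply sin_ge_quarter. split.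
            - apply Rmult_le_pos; [apply Rinv_ge_0; auto|]. nra.
            - apply Rmult_le_reg_l with (n h); auto.
              rewrite <- Rmult_assoc, Rinv_r, Rmult_1_l by lra. nra. }
          apply Rle_trans with (n h * (2 * (/ n h * (PI * (INR j + 1)) / 4))).
          + replace (n h * (2 * (/ n h * (PI * (INR j + 1)) / 4))) with (PI / 2 * (INR j + 1)) by (field; lra).
            nra.
          + apply Rmult_le_compat_l; lra.
        - eapply Rle_trans; [|exact HJ]. apply Rmult_le_compat; try apply Cmod_ge_0; auto. }
      rewrite Cmod_div by (apply Cmod_gt_0; lra).
      replace (2 * M1 * / (INR j + 1) ^ 2) with (M1 * / ((INR j + 1) ^ 2 / 2)) by (field; lra).
      apply Rmult_le_compat; auto.
      + apply Cmod_ge_0.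
      + apply Rinv_ge_0. lra.
      + apply Rinv_le_contravar; lra.
    - intros j. apply Rmult_le_pos.
      + unfold M1. generalize (Cmod_ge_0 (2 * z)%C). lra.
      + apply Rinv_ge_0, pow_lt, INR_S_pos.
    - apply ex_series_mult_l, ex_series_inv_sqr. }
  assert (Hinv : Clim (fun h => RtoC (/ n h)) 0).
  { assert (H := lim_scaled_derive (fun t => t ^ 2) 0). simpl in H.
    apply Clim_RtoC. apply is_lim_seq_ext with (fun h => n h * (fun t => t ^ 2) (/ n h)).
    - intros h. simpl. field. specialize (Hn h). lra.
    - apply (lim_scaled_derive (fun t => t ^ 2)).
      + auto_derive; auto. ring.
      + ring. }
  (* The central term of the multisection, which is [Ccoth] at z/n, divided by n. *)
  assert (H1 : Clim (fun h => RtoC (/ n h) * / 2 + / (RtoC (n h) * (Cexp (RtoC (/ n h) * z) - 1)))%C (/ z)%C).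
  { replace (/ z)%C with (0 * / 2 + / z)%C by ring. apply Clim_plus.
    - apply Clim_mult; auto. apply Clim_const.
    - apply Clim_inv; auto. apply Clim_Cexp_scaled. }
  assert (Hsum := Clim_plus _ _ _ _ H1 HS).
  apply (Clim_unique (fun _ => Ccoth z)); [apply Clim_const|].
  apply Clim_ext with (2 := Hsum). intros h. specialize (Hn h).
  assert (Hnz : RtoC (n h) <> 0) by (intros E; apply RtoC_inj in E; lra).
  assert (E := Ccoth_multisection z h ltac:(lra)). fold (n h) in E.
  rewrite ssum_pair in E.
  set (a := (RtoC (/ n h) * z)%C) in *.
  assert (Ha : 0 < Re a).
  { unfold a. simpl. replace (/ n h * fst z - 0 * snd z) with (/ n h * Re z) by (unfold Re; ring).
    apply Rmult_lt_0_compat; auto. now apply Rinv_0_lt_compat. }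
  rewrite (csum_ext h _ (fun j => RtoC (n h) * T h j)%C) in E.
  - rewrite csum_scal in E.
    replace (a - Ci * RtoC (2 * PI * 0 / n h))%C with a in E.
    + replace (Ccoth z) with (/ RtoC (n h) * (RtoC (n h) * Ccoth z))%C by (field; auto).
      rewrite <- E. unfold Ccoth. rewrite RtoC_inv by lra.
      assert (Hd := Cminus_neq_0 _ _ (Cexp_neq_1 a ltac:(lra))). field. auto.
    + unfold Rdiv. rewrite Rmult_0_r, Rmult_0_l. ring.
  - intros j _. rewrite opp_IZR, <- INR_IZR_INZ.
    replace (2 * PI * - INR (S j) / n h) with (- (2 * PI * INR (S j) / n h)) by (field; lra).
    set (b := 2 * PI * INR (S j) / n h).
    replace (a - Ci * RtoC (- b))%C with (a + Ci * RtoC b)%C by (rewrite RtoC_opp; ring).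
    destruct (Ccoth_pair a b ltac:(lra)) as [HPQ ->].
    unfold T, sg, D.
    replace (RtoC (/ n h) * - z)%C with (- a)%C by (unfold a; ring).
    replace (RtoC (/ n h) * (z / 2))%C with (a / 2)%C by (unfold a; field).
    replace (RtoC (/ n h) * - (z / 2))%C with (- (a / 2))%C by (unfold a; field).
    fold a.
    replace (/ n h * (PI * (INR j + 1))) with (b / 2) by (unfold b; rewrite S_INR; field; lra).
    replace (RtoC ((n h * (2 * sin (b / 2))) ^ 2)) with (RtoC (n h) * RtoC (n h) * RtoC ((2 * sin (b / 2)) ^ 2))%C
      by (rewrite <- !RtoC_mult; f_equal; ring).
    set (P := (Cexp (a / 2) - Cexp (- (a / 2)))%C) in *. set (Q := RtoC ((2 * sin (b / 2)) ^ 2)) in *.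
    field. split; auto.
    replace (RtoC (n h) * P * (RtoC (n h) * P) + RtoC (n h) * RtoC (n h) * Q)%C with
      (RtoC (n h) * RtoC (n h) * (P * P + Q))%C by ring.
    repeat apply Cmult_neq_0; auto.
Qed.

(** * Bernoulli numbers *)

Lemma ex_pseries_CV_radius (a : nat -> R) (x : R) :
  ex_pseries a x -> Rbar_le (Rabs x) (CV_radius a).
Proof.
  intros H. apply Rbar_not_lt_le. intros Hlt. apply (CV_disk_outside a x Hlt).
  apply ex_series_lim_0. apply ex_series_ext with (2 := H).
  intros n. rewrite pow_n_pow. unfold scal; simpl. unfold mult; simpl. ring.
Qed.

(** Continuity at 0 gives [a 0 = 0]; division by t shifts the series and the argument repeats. A
    one-sided interval suits the expansion of coth, known for t > 0, and the identity theorem, where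
    vanishing spreads from the right. *)
Lemma pseries_right_zero (a : nat -> R) (e : R) :
  0 < e -> (forall t, 0 < t < e -> is_pseries a t 0) -> forall k, a k = 0.
Proof.
  intros He H k. revert a H.
  assert (H0 : forall a : nat -> R, (forall t, 0 < t < e -> is_pseries a t 0) -> a 0%nat = 0).
  { intros a H. assert (Hr : Rbar_lt (Rabs 0) (CV_radius a)).
    { apply Rbar_lt_le_trans with (Rabs (e / 2)).
      - simpl. rewrite Rabs_R0. apply Rabs_pos_lt. lra.
      - apply ex_pseries_CV_radius. exists 0. apply H; lra. }
    assert (Hc := PSeries_continuity a 0 Hr). rewrite <- PSeries_0.
    destruct (Req_dec (PSeries a 0) 0) as [E|E]; auto. exfalso.
    destruct (Hc (Rabs (PSeries a 0))) as (d & Hd & Hd'); [now apply Rabs_pos_lt|].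
    set (t := Rmin d e / 2).
    assert (Ht : 0 < t < d /\ t < e).
    { assert (0 < Rmin d e) by (apply Rmin_glb_lt; lra).
      generalize (Rmin_l d e) (Rmin_r d e). unfold t. lra. }
    specialize (Hd' t). unfold D_x, no_cond in Hd'. simpl in Hd'. unfold Rdist in Hd'.
    rewrite (is_pseries_unique a t 0) in Hd' by (apply H; lra).
    rewrite Rminus_0_l, Rabs_Ropp, Rminus_0_r, (Rabs_pos_eq t) in Hd' by lra.
    apply (Rlt_irrefl (Rabs (PSeries a 0))). apply Hd'. repeat split; auto; lra. }
  induction k as [|k IH]; intros a H; [now apply H0|].
  change (a (S k)) with (PS_decr_1 a k). apply IH. intros t Ht.
  assert (Ht' : ex_pseries a t) by (exists 0; now apply H).
  assert (E := PSeries_decr_1 a t Ht').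
  rewrite (is_pseries_unique a t 0), (H0 a H) in E by now apply H.
  assert (Ex : ex_pseries (PS_decr_1 a) t).
  { apply ex_pseries_decr_1; auto. right. exists (/ t).
    unfold mult; simpl. unfold one; simpl. field. lra. }
  replace 0 with (PSeries (PS_decr_1 a) t); [now apply PSeries_correct|].
  nra.
Qed.

(* zeta(2k) / (2 pi)^(2k), with zeta(0) = -1/2. *)
Definition zeta_even (k : nat) : R :=
  match k with O => - / 2 | S _ => Series (fun n => / (2 * PI * (INR n + 1)) ^ (2 * k)) end.

Lemma coth_partial_fractions_R (x : R) : 0 < x ->
  / 2 + / (exp x - 1) = / x + Series (fun k => 2 * x / (x ^ 2 + (2 * PI * (INR k + 1)) ^ 2)).
Proof.
  intros Hx. assert (E := Ccoth_partial_fractions (RtoC x) Hx).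
  unfold Ccoth in E. rewrite Cexp_RtoC in E.
  assert (He : exp x - 1 <> 0) by (assert (H := exp_ineq1 x ltac:(lra)); lra).
  rewrite (CSeries_ext (coth_term (RtoC x)) (fun k => RtoC (2 * x / (x ^ 2 + (2 * PI * (INR k + 1)) ^ 2)))) in E.
  - rewrite CSeries_RtoC, <- RtoC_minus, <- !RtoC_inv, <- !RtoC_plus in E by lra.
    now apply RtoC_inj in E.
  - intros k. unfold coth_term. rewrite <- !RtoC_mult, <- RtoC_plus, <- RtoC_div.
    + f_equal. f_equal. f_equal. f_equal. ring.
    + assert (0 <= (2 * PI * (INR k + 1)) ^ 2) by apply pow2_ge_0. nra.
Qed.

Lemma is_series_geom_1 (q : R) : Rabs q < 1 -> is_series (fun j => q ^ (S j)) (q / (1 - q)).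
Proof.
  intros Hq. apply is_series_ext with (fun j => q * q ^ j); [reflexivity|].
  apply (is_series_scal (V := R_NormedModule) q). now apply is_series_geom.
Qed.

(** Euler's evaluation of zeta at the even integers. Expanding 2 t^2/(t^2 + V) in powers of t^2/V
    and exchanging the sums turns the partial fractions of coth into a power series for t/(e^t - 1)
    on (0, 1), whose coefficients are unique. For j = 0 it reads -1/2 = -B_0/2. *)
Lemma is_bernoulli_coef (B : nat -> R) : is_bernoulli B ->
  forall j, zeta_even j = (-1) ^ (S j) * (B (2 * j)%nat / INR (fact (2 * j))) / 2.
Proof.
  intros [d Hd].
  (* The coefficients that the partial fractions produce: zeta values at even indices, and -t/2 as
     the only odd term. *)
  set (b := fun n : nat => if Nat.even n then -2 * (-1) ^ (Nat.div2 n) * zeta_even (Nat.div2 n)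
               else if Nat.eqb n 1 then - / 2 else 0).
  set (V := fun k : nat => (2 * PI * (INR k + 1)) ^ 2).
  assert (HV : forall k, (INR k + 1) ^ 2 * 4 <= V k).
  { intros k. unfold V. assert (Hk := INR_S_pos k). assert (Hpi := PI2_1).
    replace ((INR k + 1) ^ 2 * 4) with ((2 * (INR k + 1)) ^ 2) by ring. apply pow_incr. split; nra. }
  assert (Hs : forall t, 0 < t < 1 -> is_pseries b t (t / (exp t - 1))).
  { intros t Ht.
    set (q := fun k => t ^ 2 / V k).
    assert (HVp : forall k, 0 < V k).
    { intros k. specialize (HV k). assert (0 < (INR k + 1) ^ 2) by apply pow_lt, INR_S_pos. lra. }
    assert (Hq : forall k, 0 <= q k <= / 4 * / (INR k + 1) ^ 2 /\ q k <= / 2).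
    { intros k. unfold q. specialize (HV k). specialize (HVp k). assert (Hk := INR_S_pos k).
      assert (H1 : 1 <= (INR k + 1) ^ 2) by (apply pow_R1_Rle; generalize (pos_INR k); lra).
      assert (Ht2 : 0 < t ^ 2 <= 1) by (split; [apply pow_lt; lra|]; simpl; nra).
      assert (H2 : t ^ 2 / V k <= / 4 * / (INR k + 1) ^ 2).
      { rewrite <- Rinv_mult. apply Rle_trans with (1 / V k).
        - apply Rmult_le_compat_r; [apply Rinv_ge_0; auto|lra].
        - unfold Rdiv. rewrite Rmult_1_l. apply Rinv_le_contravar; lra. }
      split; [split|]; auto.
      - apply Rmult_le_pos; [lra|]. apply Rinv_ge_0; auto.
      - assert (/ (INR k + 1) ^ 2 <= / 1) by (apply Rinv_le_contravar; lra). rewrite Rinv_1 in *. lra. }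
    set (a := fun k j : nat => 2 * (-1) ^ j * q k ^ (S j)).
    assert (Habs : forall k j, Rabs (a k j) = 2 * q k ^ S j).
    { intros k j. unfold a. rewrite !Rabs_mult, pow_1_abs, (Rabs_pos_eq 2), Rmult_1_r by lra.
      rewrite Rabs_pos_eq; auto. apply pow_le, Hq. }
    assert (Hrow : forall k, is_series (fun j => Rabs (a k j)) (2 * (q k / (1 - q k)))).
    { intros k. apply is_series_ext with (fun j => 2 * q k ^ S j). intros; now rewrite Habs.
      apply (is_series_scal (V := R_NormedModule) 2). apply is_series_geom_1.
      destruct (Hq k) as [[H1 _] H2]. rewrite Rabs_pos_eq; lra. }
    assert (Hsumabs : ex_series (fun k => Series (fun j => Rabs (a k j)))).
    { apply ex_series_bound with (fun k => / (INR k + 1) ^ 2); [|apply ex_series_inv_sqr].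
      intros k. rewrite (is_series_unique _ _ (Hrow k)).
      destruct (Hq k) as [[H1 H3] H2].
      assert (Hk : 0 < / (INR k + 1) ^ 2) by apply Rinv_0_lt_compat, pow_lt, INR_S_pos.
      assert (H4 : q k / (1 - q k) <= 2 * q k) by (apply Rle_div_l; nra).
      assert (0 <= q k / (1 - q k)) by (apply Rmult_le_pos; [lra|]; apply Rinv_ge_0; lra).
      rewrite Rabs_pos_eq; lra. }
    destruct (double_series_nonneg (fun k j => Rabs (a k j))) as (Hcol & Hcols & _); auto.
    { intros; apply Rabs_pos. }
    { intros k; eexists; apply Hrow. }
    assert (Hfub := double_series a ltac:(intros k; eexists; apply Hrow) Hsumabs).
    assert (Hcolval : forall j, Series (fun k => a k j) = b (2 * (S j))%nat * (t ^ 2) ^ (S j)).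
    { intros j. unfold b. replace (Nat.even (2 * S j)) with true by (symmetry; apply Nat.even_spec; now exists (S j)).
      rewrite Nat.div2_double. unfold zeta_even, a, q.
      rewrite (Series_ext _ (fun k => (2 * (-1) ^ j * (t ^ 2) ^ S j) * / (2 * PI * (INR k + 1)) ^ (2 * S j))).
      - rewrite Series_scal_l. set (W := Series _). set (P := (t ^ 2) ^ S j). rewrite <- (tech_pow_Rmult (-1)). ring.
      - intros k. unfold Rdiv. rewrite Rpow_mult_distr, pow_inv. unfold V.
        rewrite (pow_mult (2 * PI * (INR k + 1))). set (P := (t ^ 2) ^ S j). set (Q := / _). ring. }
    assert (Hrowval : forall k, Series (a k) = 2 * t ^ 2 / (t ^ 2 + V k)).
    { intros k. unfold a. rewrite (Series_ext _ (fun j => -2 * (- q k) ^ S j)).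
      - rewrite Series_scal_l, (is_series_unique _ _ (is_series_geom_1 (- q k) ltac:(rewrite Rabs_Ropp, Rabs_pos_eq; apply Hq || destruct (Hq k); lra))).
        unfold q. specialize (HVp k). field. split; [|lra]. assert (0 < t ^ 2) by (apply pow_lt; lra). lra.
      - intros j. replace (- q k) with (-1 * q k) by ring. rewrite Rpow_mult_distr. simpl. ring. }
    assert (Heven : is_pseries (fun n => b (2 * n)%nat) (t ^ 2) (1 + Series (fun k => 2 * t ^ 2 / (t ^ 2 + V k)))).
    { rewrite (Series_ext _ (fun k => Series (a k))) by (intros; now rewrite Hrowval).
      rewrite <- Hfub.
      assert (Hx : is_series (fun j => b (2 * (S j))%nat * (t ^ 2) ^ (S j)) (Series (fun j => Series (fun k => a k j)))).
      { apply is_series_ext with (fun j => Series (fun k => a k j)); auto.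
        apply Series_correct. apply ex_series_bound with (2 := Hcols). intros j.
        apply (Series_Rabs (fun k => a k j)). apply Hcol. }
      apply is_pseries_R. apply (is_series_decr_1 (fun j => b (2 * j)%nat * (t ^ 2) ^ j)).
      match goal with |- is_series _ ?l =>
        replace l with (Series (fun j => Series (fun k => a k j))) by (unfold plus, opp, b; simpl; field) end.
      exact Hx. }
    assert (Hodd : is_pseries (fun n => b (2 * n + 1)%nat) (t ^ 2) (- / 2)).
    { assert (Hb : forall n, b (2 * n + 1)%nat = if Nat.eqb n 0 then - / 2 else 0).
      { intros n. unfold b. replace (Nat.even (2 * n + 1)) with false.
        - destruct n as [|n]; [reflexivity|].
          replace (Nat.eqb (2 * S n + 1) 1) with false by (symmetry; apply Nat.eqb_neq; lia). reflexivity.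
        - symmetry. rewrite Nat.even_add. rewrite Nat.even_mul. reflexivity. }
      apply is_pseries_R. apply is_series_ext with (fun n => (if Nat.eqb n 0 then - / 2 else 0) * (t ^ 2) ^ n).
      { intros n. now rewrite Hb. }
      apply is_series_decr_1.
      match goal with |- is_series _ ?l => replace l with 0 by (unfold plus, opp; simpl; field) end.
      apply is_series_zero. intros n. simpl. ring. }
    assert (E := coth_partial_fractions_R t ltac:(lra)).
    replace (t / (exp t - 1)) with (1 + Series (fun k => 2 * t ^ 2 / (t ^ 2 + V k)) + t * (- / 2)).
    - now apply is_pseries_odd_even.
    - rewrite (Series_ext (fun k => 2 * t ^ 2 / (t ^ 2 + V k)) (fun k => t * (2 * t / (t ^ 2 + V k)))).
      + rewrite Series_scal_l. fold V in E. unfold V in *. unfold Rdiv.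
        replace (Series (fun n => 2 * t * / (t ^ 2 + (2 * PI * (INR n + 1)) ^ 2))) with
          (/ 2 + / (exp t - 1) - / t) by (rewrite E; unfold Rdiv; ring).
        field. assert (H := exp_ineq1 t ltac:(lra)). split; lra.
      + intros k. unfold Rdiv. ring. }
  assert (Hz : forall n, B n / INR (fact n) - b n = 0).
  { assert (He : 0 < Rmin d 1) by (apply Rmin_glb_lt; [apply cond_pos|lra]).
    apply (pseries_right_zero (fun n => B n / INR (fact n) - b n) (Rmin d 1) He).
    intros t Ht. assert (Ht1 := Rmin_l d 1). assert (Ht2 := Rmin_r d 1).
    replace 0 with (minus (t / (exp t - 1)) (t / (exp t - 1))) by (unfold minus, plus, opp; simpl; ring).
    apply (is_pseries_minus (K := R_AbsRing) (V := R_NormedModule) (fun n => B n / INR (fact n)) b).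
    - apply Hd; [|lra]. unfold ball; simpl. unfold AbsRing_ball; simpl. unfold abs, minus, plus, opp; simpl.
      rewrite Ropp_0, Rplus_0_r, Rabs_pos_eq; lra.
    - apply Hs; lra. }
  intros j. specialize (Hz (2 * j)%nat). unfold b in Hz.
  replace (Nat.even (2 * j)) with true in Hz by (symmetry; apply Nat.even_spec; now exists j).
  rewrite Nat.div2_double in Hz.
  assert (Hm := pow_m1_sqr j).
  replace (B (2 * j)%nat / INR (fact (2 * j))) with (-2 * (-1) ^ j * zeta_even j) by lra.
  transitivity (zeta_even j * ((-1) ^ j * (-1) ^ j)); [rewrite Hm; ring|simpl; field].
Qed.

(** * Dirichlet terms n^(-s) and their Taylor coefficients in s *)

(** Real combinations of the real and imaginary parts of x^(-s) (ln x)^j / j! for s = sg + i tau.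
    Carrying both a and b makes the family stable under differentiation, and the factor 1/j! absorbs
    the j that the derivative of the logarithmic power produces. *)
Definition logpow (sg tau : R) (j : nat) (a b : R) (x : R) : R :=
  exp (- sg * ln x) * ((ln x) ^ j / INR (fact j)) * (a * cos (tau * ln x) + b * sin (tau * ln x)).

Lemma is_derive_logpow (sg tau : R) (j : nat) (a b x : R) : 0 < x ->
  is_derive (logpow sg tau j a b) x
    (logpow (sg + 1) tau j (- sg * a + tau * b) (- sg * b - tau * a) x
      + match j with O => 0 | S i => logpow (sg + 1) tau i a b x end).
Proof.
  intros Hx. unfold logpow.
  assert (E : exp (- (sg + 1) * ln x) = exp (- sg * ln x) * / x).
  { replace (- (sg + 1) * ln x) with (- sg * ln x + - ln x) by ring.
    rewrite exp_plus, exp_Ropp, exp_ln by auto. reflexivity. }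
  auto_derive; [auto|].
  destruct j as [|i].
  - rewrite !E. simpl. field. lra.
  - rewrite !E. simpl pred. rewrite fact_simpl, mult_INR.
    assert (INR (fact i) <> 0) by apply INR_fact_neq_0.
    assert (INR (S i) <> 0) by (apply not_0_INR; lia).
    simpl pow. field. repeat split; auto; lra.
Qed.

(** The point xi lies between x and 2 x, so moving an estimate from xi back to x costs at most the
    factor 2^|e|. *)
Lemma exp_ln_shift_le (e x xi : R) : 1 <= x -> x <= xi <= x + 1 ->
  exp (e * ln xi) <= exp (Rabs e * ln 2) * exp (e * ln x).
Proof.
  intros Hx Hxi. rewrite <- exp_plus.
  assert (H1 : ln x <= ln xi) by (apply ln_le; lra).
  assert (H2 : ln xi <= ln 2 + ln x) by (rewrite <- ln_mult by lra; apply ln_le; lra).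
  assert (H3 : 0 < ln 2) by (rewrite <- ln_1; apply ln_increasing; lra).
  assert (H : e * ln xi <= Rabs e * ln 2 + e * ln x).
  { destruct (Rle_dec 0 e) as [He|He].
    - rewrite Rabs_pos_eq by auto. nra.
    - rewrite Rabs_left by lra. nra. }
  destruct H as [H|H]; [left; now apply exp_increasing|rewrite H; lra].
Qed.

(** Each difference gains a factor 1/x, while (ln x)^j / j! <= exp(ln x) = x costs one power of x,
    whatever j is. This uniformity in j makes the Taylor series in s summable together with the sum
    over k. *)
Lemma fdiffs_logpow_bound (r : nat) : forall sg tau : R,
  exists K, 0 <= K /\ forall j a b x, 1 <= x ->
    Rabs (fdiffs r (logpow sg tau j a b) x)
      <= K * (Rabs a + Rabs b) * exp ((1 - sg - INR r) * ln x).
Proof.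
  induction r as [|r IH]; intros sg tau.
  - exists 1. split; [lra|]. intros j a b x Hx. simpl. unfold logpow.
    assert (Hl : 0 <= ln x) by (rewrite <- ln_1; apply ln_le; lra).
    assert (Hj : ln x ^ j / INR (fact j) <= exp (ln x)).
    { assert (Hs := is_exp_Reals (ln x)). apply is_pseries_R in Hs.
      rewrite <- (is_series_unique _ _ Hs).
      apply Rle_trans with (/ INR (fact j) * ln x ^ j); [right; unfold Rdiv; ring|].
      apply (term_le_Series (fun n => / INR (fact n) * ln x ^ n)).
      - intros k. apply Rmult_le_pos; [apply Rinv_ge_0, INR_fact_lt_0|now apply pow_le].
      - now exists (exp (ln x)). }
    assert (Hj0 : 0 <= ln x ^ j / INR (fact j)).
    { apply Rmult_le_pos; [now apply pow_le|]. apply Rinv_ge_0, INR_fact_lt_0. }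
    assert (Hcs : Rabs (a * cos (tau * ln x) + b * sin (tau * ln x)) <= Rabs a + Rabs b).
    { eapply Rle_trans; [apply Rabs_triang|]. rewrite !Rabs_mult.
      assert (Rabs (cos (tau * ln x)) <= 1) by (apply Rabs_le, COS_bound).
      assert (Rabs (sin (tau * ln x)) <= 1) by (apply Rabs_le, SIN_bound).
      generalize (Rabs_pos a) (Rabs_pos b). intros. nra. }
    assert (He := exp_pos (- sg * ln x)).
    rewrite !Rabs_mult, (Rabs_pos_eq (exp _)), (Rabs_pos_eq (_ / _)) by (auto; lra).
    replace ((1 - sg - 0) * ln x) with (- sg * ln x + ln x) by ring. rewrite exp_plus.
    assert (H1 : exp (- sg * ln x) * (ln x ^ j / INR (fact j)) <= exp (- sg * ln x) * exp (ln x))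
      by (apply Rmult_le_compat_l; lra).
    rewrite Rmult_1_l, (Rmult_comm (Rabs a + Rabs b)). apply Rmult_le_compat; auto.
    + apply Rmult_le_pos; lra.
    + apply Rabs_pos.
  - destruct (IH (sg + 1) tau) as (K & HK & HKb).
    set (e := 1 - (sg + 1) - INR r).
    set (c := Rabs sg + Rabs tau + 1).
    assert (Hc : 1 <= c) by (unfold c; generalize (Rabs_pos sg) (Rabs_pos tau); lra).
    assert (Hee := exp_pos (Rabs e * ln 2)).
    exists (K * c * exp (Rabs e * ln 2)). split.
    { apply Rmult_le_pos; [apply Rmult_le_pos|]; lra. }
    intros j a b x Hx.
    destruct (fdiffs_MVT r (logpow sg tau j a b)
      (fun y => logpow (sg + 1) tau j (- sg * a + tau * b) (- sg * b - tau * a) y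
      + match j with O => 0 | S i => logpow (sg + 1) tau i a b y end) x) as (xi & Hxi & E).
    { intros y Hy. apply is_derive_logpow. lra. }
    rewrite E, Rabs_Ropp, fdiffs_plus.
    set (X := exp (e * ln xi)).
    assert (HX := exp_ln_shift_le e x xi Hx Hxi). fold X in HX.
    assert (HX0 : 0 < X) by apply exp_pos.
    assert (B1 := HKb j (- sg * a + tau * b) (- sg * b - tau * a) xi ltac:(lra)). fold e in B1. fold X in B1.
    assert (B2 : Rabs (fdiffs r (fun y => match j with O => 0 | S i => logpow (sg + 1) tau i a b y end) xi)
       <= K * (Rabs a + Rabs b) * X).
    { destruct j as [|i].
      - rewrite (fdiffs_ext r _ (fun y => 0 * 0)) by (intros; ring). rewrite fdiffs_scal, Rmult_0_l, Rabs_R0.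
        apply Rmult_le_pos; [apply Rmult_le_pos; auto|lra]. generalize (Rabs_pos a) (Rabs_pos b); lra.
      - rewrite (fdiffs_ext r _ (logpow (sg + 1) tau i a b)) by reflexivity. apply HKb. lra. }
    assert (B3 : Rabs (- sg * a + tau * b) + Rabs (- sg * b - tau * a) <= (Rabs sg + Rabs tau) * (Rabs a + Rabs b)).
    { assert (H1 := Rabs_triang (- sg * a) (tau * b)). assert (H2 := Rabs_triang (- sg * b) (- (tau * a))).
      rewrite Rabs_Ropp, !Rabs_mult, Rabs_Ropp in H2. rewrite !Rabs_mult, Rabs_Ropp in H1.
      unfold Rminus. lra. }
    eapply Rle_trans; [apply Rabs_triang|].
    apply Rle_trans with (K * (c * (Rabs a + Rabs b)) * X).
    { assert (H4 : K * (Rabs (- sg * a + tau * b) + Rabs (- sg * b - tau * a)) * X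
         <= K * ((Rabs sg + Rabs tau) * (Rabs a + Rabs b)) * X).
      { apply Rmult_le_compat_r; [lra|]. now apply Rmult_le_compat_l. }
      unfold c. lra. }
    replace (1 - sg - INR (S r)) with e by (unfold e; rewrite S_INR; ring).
    replace (K * c * exp (Rabs e * ln 2) * (Rabs a + Rabs b) * exp (e * ln x)) with
      (K * (c * (Rabs a + Rabs b)) * (exp (Rabs e * ln 2) * exp (e * ln x))) by ring.
    apply Rmult_le_compat_l; auto. apply Rmult_le_pos; auto.
    apply Rmult_le_pos; [lra|]. generalize (Rabs_pos a) (Rabs_pos b); lra.
Qed.

Definition dirichlet_coef (s : C) (j k : nat) : C :=
  (Cexp (- s * RtoC (ln (INR k + 1))) * RtoC ((- ln (INR k + 1)) ^ j / INR (fact j)))%C.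

Lemma Re_sdiffs (r : nat) (a : nat -> C) (f : R -> R) (c : R) (k : nat) :
  (forall k, Re (a k) = f (INR k + c)) -> Re (sdiffs r a k) = fdiffs r f (INR k + c).
Proof.
  revert a f. induction r as [|r IH]; intros a f H; simpl; auto.
  apply (IH (sdiff a) (fun x => f x - f (x + 1))). intros i.
  change (Re (sdiff a i)) with (Re (a i) - Re (a (S i))). rewrite !H, S_INR. do 2 f_equal. ring.
Qed.

Lemma Im_sdiffs (r : nat) (a : nat -> C) (f : R -> R) (c : R) (k : nat) :
  (forall k, Im (a k) = f (INR k + c)) -> Im (sdiffs r a k) = fdiffs r f (INR k + c).
Proof.
  revert a f. induction r as [|r IH]; intros a f H; simpl; auto.
  apply (IH (sdiff a) (fun x => f x - f (x + 1))). intros i.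
  change (Im (sdiff a i)) with (Im (a i) - Im (a (S i))). rewrite !H, S_INR. do 2 f_equal. ring.
Qed.

(** The condition on r makes the exponent 1 - Re s - r at most -2. *)
Lemma sdiffs_dirichlet_coef_bound (r : nat) (s : C) : 3 - Re s <= INR r ->
  exists K, 0 <= K /\ forall j k, Cmod (sdiffs r (dirichlet_coef s j) k) <= K * / (INR k + 1) ^ 2.
Proof.
  intros Hr. destruct (fdiffs_logpow_bound r (Re s) (Im s)) as (K & HK & HKb).
  exists (2 * K). split; [lra|]. intros j k.
  assert (Hx : 1 <= INR k + 1) by (generalize (pos_INR k); lra).
  assert (HE : exp ((1 - Re s - INR r) * ln (INR k + 1)) <= / (INR k + 1) ^ 2).
  { rewrite <- (Rpower_pow 2) by lra. unfold Rpower. rewrite <- exp_Ropp.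
    assert (Hl : 0 <= ln (INR k + 1)) by (rewrite <- ln_1; apply ln_le; lra).
    assert (H : (1 - Re s - INR r) * ln (INR k + 1) <= - (INR 2 * ln (INR k + 1))) by (simpl; nra).
    destruct H as [H|H]; [left; now apply exp_increasing|rewrite H; lra]. }
  assert (Hm := pow_m1_sqr j).
  assert (Ex : Re (sdiffs r (dirichlet_coef s j) k) = fdiffs r (logpow (Re s) (Im s) j ((-1) ^ j) 0) (INR k + 1)).
  { apply Re_sdiffs. intros i. unfold dirichlet_coef, logpow, Cexp. simpl. unfold Re, Im.
    replace (- ln (INR i + 1)) with (-1 * ln (INR i + 1)) by ring. rewrite Rpow_mult_distr.
    replace (- fst s * ln (INR i + 1) - - snd s * 0) with (- fst s * ln (INR i + 1)) by ring.
    replace (- fst s * 0 + - snd s * ln (INR i + 1)) with (- (snd s * ln (INR i + 1))) by ring.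
    rewrite cos_neg, sin_neg. field. apply INR_fact_neq_0. }
  assert (Ey : Im (sdiffs r (dirichlet_coef s j) k) = fdiffs r (logpow (Re s) (Im s) j 0 (- (-1) ^ j)) (INR k + 1)).
  { apply Im_sdiffs. intros i. unfold dirichlet_coef, logpow, Cexp. simpl. unfold Re, Im.
    replace (- ln (INR i + 1)) with (-1 * ln (INR i + 1)) by ring. rewrite Rpow_mult_distr.
    replace (- fst s * ln (INR i + 1) - - snd s * 0) with (- fst s * ln (INR i + 1)) by ring.
    replace (- fst s * 0 + - snd s * ln (INR i + 1)) with (- (snd s * ln (INR i + 1))) by ring.
    rewrite cos_neg, sin_neg. field. apply INR_fact_neq_0. }
  eapply Rle_trans; [apply Cmod_le_Re_Im|]. rewrite Ex, Ey.
  assert (H1 := HKb j ((-1) ^ j) 0 (INR k + 1) Hx). assert (H2 := HKb j 0 (- (-1) ^ j) (INR k + 1) Hx).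
  rewrite Rabs_Ropp, pow_1_abs, Rabs_R0 in *.
  assert (K * exp ((1 - Re s - INR r) * ln (INR k + 1)) <= K * / (INR k + 1) ^ 2) by now apply Rmult_le_compat_l.
  lra.
Qed.

(** * The power series of the exponential *)

Lemma is_derive_Re_Cexp (c z : C) (t : R) :
  is_derive (fun t => Re (c * Cexp (RtoC t * z))%C) t (Re (c * z * Cexp (RtoC t * z))%C).
Proof.
  destruct c as [c1 c2]. destruct z as [x y]. simpl.
  eapply is_derive_ext with (fun t => c1 * (exp (t * x) * cos (t * y)) - c2 * (exp (t * x) * sin (t * y))).
  - intros u. replace (u * x - 0 * y) with (u * x) by ring.
    replace (u * y + 0 * x) with (u * y) by ring. reflexivity.
  - replace (t * x - 0 * y) with (t * x) by ring.
    replace (t * y + 0 * x) with (t * y) by ring.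
    auto_derive; auto. ring.
Qed.

Lemma is_derive_n_Re_Cexp (n : nat) (c z : C) (t : R) :
  is_derive_n (fun t => Re (c * Cexp (RtoC t * z))%C) n t (Re (c * z ^ n * Cexp (RtoC t * z))%C).
Proof.
  revert t. induction n as [|n IH]; intros t.
  - replace (c * z ^ 0)%C with c by (simpl; ring). reflexivity.
  - cbn [is_derive_n]. apply is_derive_ext with (fun t => Re (c * z ^ n * Cexp (RtoC t * z))%C).
    + intros u. symmetry. apply is_derive_n_unique, IH.
    + replace (c * z ^ S n * Cexp (RtoC t * z))%C with (c * z ^ n * z * Cexp (RtoC t * z))%C
       by (rewrite Cpow_S; ring). exact (is_derive_Re_Cexp (c * z ^ n)%C z t).
Qed.

(** Taylor's formula with Lagrange remainder is real, so it is applied to t -> Re (c exp(t z)) on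
    [0, 1]; the choice c = -i then yields the imaginary part of the exponential. *)
Lemma is_series_Re_Cexp (c z : C) :
  is_series (fun n => Re (c * z ^ n)%C / INR (fact n)) (Re (c * Cexp z)%C).
Proof.
  set (M := Cmod c * exp (Rabs (Re z))).
  apply is_series_Reals. intros e He.
  assert (Hlim : is_lim_seq (fun n => M * (Cmod z ^ S n / INR (fact (S n)))) 0).
  { replace (Finite 0) with (Rbar_mult M 0) by (simpl; f_equal; ring). apply is_lim_seq_scal_l.
    apply (is_lim_seq_incr_1 (fun n => Cmod z ^ n / INR (fact n))).
    apply ex_series_lim_0. exists (exp (Cmod z)). assert (H := is_exp_Reals (Cmod z)).
    apply is_pseries_R in H.
    apply is_series_ext with (fun n => / INR (fact n) * Cmod z ^ n); [|exact H].
    intros n. apply Rmult_comm. }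
  apply is_lim_seq_Reals in Hlim. destruct (Hlim e He) as [K HK]. exists K. intros n Hn.
  specialize (HK n Hn).
  destruct (Taylor_Lagrange (fun t => Re (c * Cexp (RtoC t * z))%C) n 0 1) as (xi & Hxi & E); [lra| |].
  { intros t _ k _. destruct k as [|k]; [exact I|]. eexists. apply (is_derive_n_Re_Cexp (S k)). }
  rewrite Cmult_1_l in E.
  assert (Es : sum_f_R0 (fun m => (1 - 0) ^ m / INR (fact m) * Derive_n (fun t => Re (c * Cexp (RtoC t * z))%C) m 0) n
    = sum_f_R0 (fun n => Re (c * z ^ n)%C / INR (fact n)) n).
  { apply sum_eq. intros i _. rewrite (is_derive_n_unique _ _ _ _ (is_derive_n_Re_Cexp i c z 0)).
    rewrite Cmult_0_l, Cexp_0, Cmult_1_r, Rminus_0_r, pow1. field. apply INR_fact_neq_0. }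
  rewrite Es, (is_derive_n_unique _ _ _ _ (is_derive_n_Re_Cexp (S n) c z xi)) in E.
  rewrite E. unfold Rdist in *. rewrite Rminus_0_r in HK.
  eapply Rle_lt_trans; [|apply Rle_lt_trans with (2 := HK); apply Rle_abs].
  rewrite Rminus_0_r, pow1.
  match goal with |- Rabs (?A - (?A + ?B)) <= _ => replace (A - (A + B)) with (- B) by ring end.
  rewrite Rabs_Ropp, Rabs_mult.
  assert (Hf : 0 < 1 / INR (fact (S n))) by (apply Rdiv_lt_0_compat; [lra|apply INR_fact_lt_0]).
  rewrite Rabs_pos_eq by lra.
  assert (H1 : Rabs (Re (c * z ^ S n * Cexp (RtoC xi * z))%C) <= M * Cmod z ^ S n).
  { eapply Rle_trans; [apply re_le_Cmod|]. rewrite !Cmod_mult, Cmod_Cexp, Cmod_pow. unfold M.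
    assert (Hexp : exp (Re (RtoC xi * z)%C) <= exp (Rabs (Re z))).
    { simpl. replace (xi * fst z - 0 * snd z) with (xi * Re z) by (unfold Re; ring).
      assert (H : xi * Re z <= Rabs (Re z)).
      { generalize (Rle_abs (Re z)) (Rabs_pos (Re z)). intros. nra. }
      destruct H as [H|H]; [left; now apply exp_increasing|rewrite H; lra]. }
    apply Rle_trans with (Cmod c * Cmod z ^ S n * exp (Rabs (Re z))); [|right; ring].
    apply Rle_trans with (Cmod c * Cmod z ^ S n * exp (Re (RtoC xi * z)%C)); [right; ring|].
    apply Rmult_le_compat_l; auto. apply Rmult_le_pos; [apply Cmod_ge_0|apply pow_le, Cmod_ge_0]. }
  apply Rle_trans with (1 / INR (fact (S n)) * (M * Cmod z ^ S n)).
  - apply Rmult_le_compat_l; lra.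
  - right. unfold Rdiv. ring.
Qed.

Lemma Csummable_exp (z : C) : Csummable (fun n => z ^ n * RtoC (/ INR (fact n)))%C.
Proof.
  exists (exp (Cmod z)). assert (H := is_exp_Reals (Cmod z)). apply is_pseries_R in H.
  apply is_series_ext with (fun n => / INR (fact n) * Cmod z ^ n); [|exact H].
  intros n. rewrite Cmod_mult, Cmod_pow, Cmod_R.
  rewrite Rabs_pos_eq by (apply Rinv_ge_0, INR_fact_lt_0). apply Rmult_comm.
Qed.

Lemma CSeries_exp (z : C) : CSeries (fun n => z ^ n * RtoC (/ INR (fact n)))%C = Cexp z.
Proof.
  apply injective_projections.
  - change (Series (fun n => Re (z ^ n * RtoC (/ INR (fact n)))%C) = Re (Cexp z)).
    rewrite <- (Cmult_1_l (Cexp z)), <- (is_series_unique _ _ (is_series_Re_Cexp 1 z)).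
    apply Series_ext. intros n. rewrite Cmult_1_l. simpl. unfold Re, Rdiv. ring.
  - change (Series (fun n => Im (z ^ n * RtoC (/ INR (fact n)))%C) = Im (Cexp z)).
    replace (Im (Cexp z)) with (Re (- Ci * Cexp z)%C) by (simpl; unfold Re; ring).
    rewrite <- (is_series_unique _ _ (is_series_Re_Cexp (- Ci) z)).
    apply Series_ext. intros n. simpl. unfold Re, Rdiv. ring.
Qed.

(** * The identity theorem along a segment *)

Definition R_analytic_at (f : R -> R) (T : R) : Prop :=
  exists a, locally T (fun t => is_pseries a (t - T) (f t)).

Lemma locally_R_abs (T : R) (P : R -> Prop) :
  locally T P <-> exists e, 0 < e /\ forall t, Rabs (t - T) < e -> P t.
Proof.
  split.
  - intros [e He]. exists e. split; [apply cond_pos|]. intros t Ht. apply He. exact Ht.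
  - intros (e & He & H). exists (mkposreal e He). intros t Ht. apply H. exact Ht.
Qed.

Lemma R_analytic_at_minus (f g : R -> R) (T : R) :
  R_analytic_at f T -> R_analytic_at g T -> R_analytic_at (fun t => f t - g t) T.
Proof.
  intros [a Ha] [b Hb]. exists (PS_minus a b). generalize (filter_and _ _ Ha Hb).
  apply filter_imp. intros t [H1 H2].
  now apply (is_pseries_minus (K := R_AbsRing) (V := R_NormedModule)).
Qed.

Lemma R_analytic_at_plus (f g : R -> R) (T : R) :
  R_analytic_at f T -> R_analytic_at g T -> R_analytic_at (fun t => f t + g t) T.
Proof.
  intros [a Ha] [b Hb]. exists (PS_plus a b). generalize (filter_and _ _ Ha Hb).
  apply filter_imp. intros t [H1 H2].
  now apply (is_pseries_plus (K := R_AbsRing) (V := R_NormedModule)).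
Qed.

Lemma R_analytic_at_radius (f : R -> R) (T : R) (a : nat -> R) :
  locally T (fun t => is_pseries a (t - T) (f t)) ->
  locally T (fun t => Rbar_lt (Rabs (t - T)) (CV_radius a)).
Proof.
  intros H%locally_R_abs. destruct H as (e & He & H). apply locally_R_abs.
  exists (e / 2). split; [lra|]. intros t Ht.
  apply Rbar_lt_le_trans with (Rabs (e / 2)).
  - simpl. rewrite (Rabs_pos_eq (e / 2)); lra.
  - apply ex_pseries_CV_radius. exists (f (T + e / 2)).
    specialize (H (T + e / 2)). replace (T + e / 2 - T) with (e / 2) in H by ring.
    apply H. rewrite Rabs_pos_eq; lra.
Qed.

Lemma R_analytic_at_mult (f g : R -> R) (T : R) :
  R_analytic_at f T -> R_analytic_at g T -> R_analytic_at (fun t => f t * g t) T.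
Proof.
  intros [a Ha] [b Hb]. exists (PS_mult a b).
  generalize (filter_and _ _ (filter_and _ _ Ha Hb)
    (filter_and _ _ (R_analytic_at_radius _ _ _ Ha) (R_analytic_at_radius _ _ _ Hb))).
  apply filter_imp. intros t [[H1 H2] [H3 H4]]. now apply is_pseries_mult.
Qed.

(** Complex analyticity is kept only along a real parameter, as real analyticity of both parts, so
    that the identity theorem is one about real functions. *)
Definition C_analytic_path (f : R -> C) (T : R) : Prop :=
  R_analytic_at (fun t => Re (f t)) T /\ R_analytic_at (fun t => Im (f t)) T.

Lemma C_analytic_path_minus (f g : R -> C) (T : R) :
  C_analytic_path f T -> C_analytic_path g T -> C_analytic_path (fun t => f t - g t)%C T.
Proof.
  intros [H1 H2] [H3 H4]. split.
  - exact (R_analytic_at_minus _ _ _ H1 H3).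
  - exact (R_analytic_at_minus _ _ _ H2 H4).
Qed.

Lemma C_analytic_path_mult (f g : R -> C) (T : R) :
  C_analytic_path f T -> C_analytic_path g T -> C_analytic_path (fun t => f t * g t)%C T.
Proof.
  intros [H1 H2] [H3 H4]. split.
  - exact (R_analytic_at_minus _ _ _ (R_analytic_at_mult _ _ _ H1 H3) (R_analytic_at_mult _ _ _ H2 H4)).
  - exact (R_analytic_at_plus _ _ _ (R_analytic_at_mult _ _ _ H1 H4) (R_analytic_at_mult _ _ _ H2 H3)).
Qed.

Lemma C_analytic_path_series (f : R -> C) (T e : R) (c : nat -> C) :
  0 < e ->
  (forall t, Rabs (t - T) < e ->
     is_series (K := C_AbsRing) (V := C_NormedModule) (fun k => RtoC ((t - T) ^ k) * c k)%C (f t)) ->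
  C_analytic_path f T.
Proof.
  intros He H. split.
  - exists (fun k => Re (c k)). apply locally_R_abs. exists e. split; auto. intros t Ht.
    destruct (proj1 (is_Cseries_iff _ _) (H t Ht)) as [Hr _]. apply is_pseries_R.
    apply is_series_ext with (fun k => Re (RtoC ((t - T) ^ k) * c k)%C); [|exact Hr].
    intros k. simpl. unfold Re. ring.
  - exists (fun k => Im (c k)). apply locally_R_abs. exists e. split; auto. intros t Ht.
    destruct (proj1 (is_Cseries_iff _ _) (H t Ht)) as [_ Hi]. apply is_pseries_R.
    apply is_series_ext with (fun k => Im (RtoC ((t - T) ^ k) * c k)%C); [|exact Hi].
    intros k. simpl. unfold Im. ring.
Qed.

Lemma pow_n_Cpow (z : C) (k : nat) : pow_n (K := C_Ring) z k = (z ^ k)%C.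
Proof. induction k as [|k IH]; [reflexivity|]. simpl. now rewrite IH. Qed.

Lemma C_analytic_at_path (f : C -> C) (z0 d : C) (T : R) :
  C_analytic_at f (z0 + RtoC T * d)%C -> C_analytic_path (fun t => f (z0 + RtoC t * d)%C) T.
Proof.
  intros [a [e He]].
  assert (Hd : 0 < Rabs (Re d) + Rabs (Im d) + 1) by (generalize (Rabs_pos (Re d)) (Rabs_pos (Im d)); lra).
  (* This radius keeps both coordinates of (t - T) d inside the square ball of radius e; the summand
     1 covers d = 0. *)
  apply (C_analytic_path_series _ T (e / (Rabs (Re d) + Rabs (Im d) + 1)) (fun k => d ^ k * a k)%C).
  { apply Rdiv_lt_0_compat; [apply cond_pos|auto]. }
  intros t Ht. set (z := (z0 + RtoC t * d)%C).
  assert (Hz : ball (z0 + RtoC T * d)%C e z).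
  { assert (Ht' : Rabs (t - T) * (Rabs (Re d) + Rabs (Im d) + 1) < e).
    { apply Rlt_div_r in Ht; auto. }
    assert (H0 := Rabs_pos (t - T)). assert (H1 := Rabs_pos (Re d)). assert (H2 := Rabs_pos (Im d)).
    split; unfold ball; simpl; unfold AbsRing_ball; simpl; unfold abs, minus, plus, opp; simpl.
    - replace (fst z0 + (t * fst d - 0 * snd d) + - (fst z0 + (T * fst d - 0 * snd d))) with
        ((t - T) * Re d) by (unfold Re; ring). rewrite Rabs_mult. nra.
    - replace (snd z0 + (t * snd d + 0 * fst d) + - (snd z0 + (T * snd d + 0 * fst d))) with
        ((t - T) * Im d) by (unfold Im; ring). rewrite Rabs_mult. nra. }
  specialize (He z Hz). unfold is_pseries in He.
  replace (fun k => RtoC ((t - T) ^ k) * (d ^ k * a k))%C with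
    (fun k => scal (K := C_AbsRing) (V := C_NormedModule) (pow_n (K := C_AbsRing) (z - (z0 + RtoC T * d))%C k) (a k)).
  - exact He.
  - extensionality k.
    change (pow_n (K := C_Ring) (z - (z0 + RtoC T * d))%C k * a k = RtoC ((t - T) ^ k) * (d ^ k * a k))%C.
    rewrite pow_n_Cpow. replace (z - (z0 + RtoC T * d))%C with (RtoC (t - T) * d)%C
      by (unfold z; rewrite RtoC_minus; ring).
    rewrite Cpow_mult_l, RtoC_pow. ring.
Qed.

(** The vanishing spreads leftwards from 1: at the end point of the largest interval on which f is
    0, the power series vanishes on the right, hence identically, and the interval could be
    enlarged. *)
Lemma R_analytic_identity (f : R -> R) (c : R) :
  (forall T, 0 <= T <= 1 -> R_analytic_at f T) ->
  c < 1 -> (forall t, c < t <= 1 -> f t = 0) -> f 0 = 0.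
Proof.
  intros Ha Hc Hf.
  (* Here x is the length of an interval ending at 1, so that the extremal interval is a
     supremum. *)
  set (E := fun x => 0 <= x <= 1 /\ forall t, 1 - x < t <= 1 -> f t = 0).
  assert (HE0 : E 0) by (split; [lra|intros; lra]).
  destruct (completeness E) as [X [HX1 HX2]].
  { exists 1. intros x [Hx _]. lra. }
  { now exists 0. }
  assert (HX0 : 0 < X).
  { assert (Hc1 := Rmin_glb_lt 1 (1 - c) 0 ltac:(lra) ltac:(lra)).
    assert (Hc2 := Rmin_l 1 (1 - c)). assert (Hc3 := Rmin_r 1 (1 - c)).
    apply Rlt_le_trans with (Rmin 1 (1 - c)); auto. apply HX1. split; [lra|].
    intros t Ht. apply Hf. lra. }
  assert (HXle : X <= 1) by (apply HX2; intros x [Hx _]; lra).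
  assert (Hz : forall t, 1 - X < t <= 1 -> f t = 0).
  { intros t Ht. destruct (Rle_dec X (1 - t)) as [H|H]; [lra|].
    assert (Hn : ~ (forall x, E x -> x <= 1 - t)).
    { intros Hub. apply H, HX2. exact Hub. }
    destruct (Classical_Prop.classic (exists x, E x /\ 1 - t < x)) as [(x & [Hx1 Hx2] & Hx3)|Hno].
    - apply Hx2. lra.
    - exfalso. apply Hn. intros x Hx. apply Rnot_lt_le. intros Hlt. apply Hno. now exists x. }
  destruct (Ha (1 - X)) as [a Haa]; [lra|]. apply locally_R_abs in Haa. destruct Haa as (e & He & Haa).
  assert (Ha0 : forall k, a k = 0).
  { assert (Hm := Rmin_glb_lt e X 0 He HX0). assert (Hm1 := Rmin_l e X). assert (Hm2 := Rmin_r e X).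
    apply (pseries_right_zero a (Rmin e X)); auto. intros t Ht.
    specialize (Haa (1 - X + t)). rewrite (Hz (1 - X + t)) in Haa by lra.
    replace (1 - X + t - (1 - X)) with t in Haa by ring. apply Haa. rewrite Rabs_pos_eq; lra. }
  assert (Hnear : forall t, Rabs (t - (1 - X)) < e -> f t = 0).
  { intros t Ht. specialize (Haa t Ht). rewrite <- (is_pseries_unique _ _ _ Haa).
    unfold PSeries. apply Series_zero. intros n. rewrite Ha0. ring. }
  destruct (Req_dec X 1) as [E1|E1].
  - apply Hnear. rewrite E1. replace (0 - (1 - 1)) with 0 by ring. now rewrite Rabs_R0.
  - exfalso. assert (Hm := Rmin_glb_lt (e / 2) (1 - X) 0 ltac:(lra) ltac:(lra)).
    set (m := Rmin (e / 2) (1 - X)) in *.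
    assert (Hm1 : m <= e / 2) by apply Rmin_l. assert (Hm2 : m <= 1 - X) by apply Rmin_r.
    assert (X + m <= X); [|lra]. apply HX1. split; [lra|]. intros t Ht.
    destruct (Rlt_dec (1 - X) t) as [H|H]; [apply Hz; lra|].
    apply Hnear. rewrite Rabs_left1; lra.
Qed.

(** * Euler sums of Dirichlet series and the continuation of zeta *)

Definition dirichlet (s : C) (k : nat) : C := Cexp (- s * RtoC (ln (INR k + 1)))%C.

Lemma dirichlet_coef_0 (s : C) : dirichlet_coef s 0 = dirichlet s.
Proof.
  extensionality k. unfold dirichlet_coef, dirichlet. simpl.
  replace (1 / 1) with 1 by field. ring.
Qed.

Lemma esummable_dirichlet_coef (r : nat) (s : C) (j : nat) :
  3 - Re s <= INR r -> esummable r (dirichlet_coef s j).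
Proof.
  intros Hr. destruct (sdiffs_dirichlet_coef_bound r s Hr) as (K & HK & HKb).
  apply Csummable_bound with (fun k => K * / (INR k + 1) ^ 2); auto.
  apply ex_series_mult_l, ex_series_inv_sqr.
Qed.

Lemma esummable_dirichlet (r : nat) (s : C) : 3 - Re s <= INR r -> esummable r (dirichlet s).
Proof. rewrite <- dirichlet_coef_0. apply esummable_dirichlet_coef. Qed.

(** The Taylor expansion of (k+1)^(-s-w) in w is Euler-summed over k and the two sums are exchanged,
    with majorant K |w|^j / (k+1)^2. So the Euler sum is analytic in s, with radius at least 1. *)
Lemma eulsum_dirichlet_series (r : nat) (s w : C) :
  3 - Re s <= INR r -> Cmod w < 1 ->
  Csummable (fun j => w ^ j * eulsum r (dirichlet_coef s j))%C /\
  CSeries (fun j => w ^ j * eulsum r (dirichlet_coef s j))%C = eulsum r (dirichlet (s + w)).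
Proof.
  intros Hr Hw. destruct (sdiffs_dirichlet_coef_bound r s Hr) as (K & HK & HKb).
  assert (Hb : forall j k, Cmod (sdiffs r (fun k => w ^ j * dirichlet_coef s j k)%C k)
     <= (K * Cmod w ^ j) * / (INR k + 1) ^ 2).
  { intros j k. rewrite sdiffs_scal, Cmod_mult, Cmod_pow.
    replace (K * Cmod w ^ j * / (INR k + 1) ^ 2) with (Cmod w ^ j * (K * / (INR k + 1) ^ 2)) by ring.
    apply Rmult_le_compat_l; auto. apply pow_le, Cmod_ge_0. }
  assert (Hterm : forall k j, (w ^ j * dirichlet_coef s j k)%C =
     (dirichlet s k * ((- w * RtoC (ln (INR k + 1))) ^ j * RtoC (/ INR (fact j))))%C).
  { intros k j. unfold dirichlet_coef, dirichlet, Rdiv.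
    replace (- w * RtoC (ln (INR k + 1)))%C with (w * RtoC (- ln (INR k + 1)))%C by (rewrite RtoC_opp; ring).
    rewrite Cpow_mult_l, RtoC_mult, RtoC_pow. ring. }
  destruct (eulsum_swap r (fun j k => w ^ j * dirichlet_coef s j k)%C) as (H1 & _ & H3).
  - intros k. apply Csummable_ext with (fun j => (dirichlet s k * ((- w * RtoC (ln (INR k + 1))) ^ j * RtoC (/ INR (fact j))))%C).
    + intros j. now rewrite Hterm.
    + apply Csummable_scal, Csummable_exp.
  - intros j. apply esummable_scal. now apply esummable_dirichlet_coef.
  - apply ex_series_bound with (fun j => (K * Series (fun k => / (INR k + 1) ^ 2)) * Cmod w ^ j).
    + intros j. rewrite Rabs_pos_eq.
      * replace (K * Series (fun k => / (INR k + 1) ^ 2) * Cmod w ^ j) with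
          (Series (fun k => (K * Cmod w ^ j) * / (INR k + 1) ^ 2)) by (rewrite Series_scal_l; ring).
        apply Series_le.
        -- intros k. split; [apply Cmod_ge_0|apply Hb].
        -- apply ex_series_mult_l, ex_series_inv_sqr.
      * apply Series_nonneg; [intros; apply Cmod_ge_0|].
        change (esummable r (fun k => w ^ j * dirichlet_coef s j k)%C).
        apply esummable_scal. now apply esummable_dirichlet_coef.
    + apply ex_series_mult_l, ex_series_geom. rewrite Rabs_pos_eq; auto. apply Cmod_ge_0.
  - assert (E : forall j, eulsum r (fun k => w ^ j * dirichlet_coef s j k)%C = (w ^ j * eulsum r (dirichlet_coef s j))%C).
    { intros j. apply eulsum_scal. now apply esummable_dirichlet_coef. }
    split.
    + now apply Csummable_ext with (2 := H1).
    + rewrite <- (CSeries_ext _ _ E), <- H3. f_equal. extensionality k.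
      rewrite (CSeries_ext _ _ (Hterm k)), CSeries_scal by apply Csummable_exp.
      rewrite CSeries_exp. unfold dirichlet. rewrite <- Cexp_plus. f_equal. ring.
Qed.

Lemma Csummable_even_odd (a : nat -> C) : Csummable a ->
  Csummable (fun k => a (2 * k)%nat) /\ Csummable (fun k => a (2 * k + 1)%nat).
Proof.
  intros Ha.
  assert (Hp : forall k, 0 <= Cmod (a k)) by (intros; apply Cmod_ge_0).
  assert (H : forall n, sum_n (fun k => Cmod (a (2 * k)%nat)) n + sum_n (fun k => Cmod (a (2 * k + 1)%nat)) n
      = sum_n (fun k => Cmod (a k)) (2 * n + 1)).
  { induction n as [|n IH].
    - simpl. rewrite !sum_Sn, !sum_O. reflexivity.
    - replace (2 * S n + 1)%nat with (S (S (2 * n + 1))) by lia. rewrite !sum_Sn, <- IH.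
      unfold plus; simpl plus. replace (S (S (2 * n + 1))) with (2 * S n + 1)%nat by lia.
      replace (S (2 * n + 1)) with (2 * S n)%nat by lia. simpl. ring. }
  assert (Hle : forall n, sum_n (fun k => Cmod (a k)) (2 * n + 1) <= Series (fun k => Cmod (a k)))
    by (intros; now apply sum_n_le_Series).
  split; apply (is_series_nonneg_le _ (Series (fun k => Cmod (a k)))); auto; intros n;
    specialize (H n); specialize (Hle n).
  - assert (0 <= sum_n (fun k => Cmod (a (2 * k + 1)%nat)) n) by (rewrite sum_n_Reals; apply cond_pos_sum; auto). lra.
  - assert (0 <= sum_n (fun k => Cmod (a (2 * k)%nat)) n) by (rewrite sum_n_Reals; apply cond_pos_sum; auto). lra.
Qed.

Lemma CSeries_even_odd (a : nat -> C) : Csummable a ->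
  CSeries a = (CSeries (fun k => a (2 * k)%nat) + CSeries (fun k => a (2 * k + 1)%nat))%C.
Proof.
  intros Ha. destruct (Csummable_even_odd a Ha) as [He Ho].
  apply (Clim_unique (fun n => csum (2 * n) a)).
  - intros e Hpe. destruct (CSeries_Clim a Ha e Hpe) as [K HK]. exists K. intros h Hh. apply HK. lia.
  - apply Clim_ext with (fun n => csum n (fun k => a (2 * k)%nat) + csum n (fun k => a (2 * k + 1)%nat))%C.
    + induction h as [|n IH]; [simpl; ring|].
      replace (2 * S n)%nat with (S (S (2 * n))) by lia. cbn [csum]. rewrite <- IH.
      replace (2 * n + 1)%nat with (S (2 * n)) by lia. ring.
    + apply Clim_plus; now apply CSeries_Clim.
Qed.

(** Index k stands for the integer k + 1, so the odd indices are the even integers: alternation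
    becomes a comparison of a sum with its dilate by 2. *)
Lemma CSeries_alt (a : nat -> C) : Csummable a ->
  CSeries (alt a) = (CSeries a - 2 * CSeries (fun k => a (2 * k + 1)%nat))%C.
Proof.
  intros Ha. destruct (Csummable_even_odd a Ha) as [He Ho].
  rewrite (CSeries_even_odd (alt a)) by now apply Csummable_alt.
  rewrite (CSeries_even_odd a) by auto.
  rewrite (CSeries_ext (fun k => alt a (2 * k)%nat) (fun k => a (2 * k)%nat)).
  - rewrite (CSeries_ext (fun k => alt a (2 * k + 1)%nat) (fun k => - a (2 * k + 1)%nat)%C).
    + rewrite CSeries_opp. ring.
    + intros k. unfold alt. rewrite pow_add, pow_1_even. simpl.
      replace (1 * (-1 * 1)) with (- (1)) by ring. rewrite RtoC_opp. ring.
  - intros k. unfold alt. rewrite pow_1_even. ring.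
Qed.

Lemma dirichlet_odd (s : C) (k : nat) :
  dirichlet s (2 * k + 1)%nat = (Cexp (- s * RtoC (ln 2)) * dirichlet s k)%C.
Proof.
  unfold dirichlet. rewrite <- Cexp_plus, <- Cmult_plus_distr_l, <- RtoC_plus.
  rewrite <- ln_mult by (lra || apply INR_S_pos). do 3 f_equal. f_equal.
  rewrite plus_INR, mult_INR. simpl. ring.
Qed.

(** The hypothesis gives plain convergence; absolute convergence at s comes from convergence at the
    real point Re s, whose terms are the moduli of those at s. *)
Lemma Csummable_dirichlet (zeta : C -> C) (s : C) :
  is_riemann_zeta zeta -> 1 < Re s -> Csummable (dirichlet s) /\ CSeries (dirichlet s) = zeta s.
Proof.
  intros [Hz _] Hs.
  assert (E : forall z, (fun n => Cexp (- z * RtoC (ln (INR (S n))))%C) = dirichlet z).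
  { intros z. extensionality n. unfold dirichlet. now rewrite S_INR. }
  assert (H1 := Hz (RtoC (Re s)) Hs). assert (H2 := Hz s Hs). rewrite E in H1, H2.
  split.
  - destruct (proj1 (is_Cseries_iff _ _) H1) as [Hr _]. eexists. apply is_series_ext with (2 := Hr).
    intros n. unfold dirichlet. rewrite Cmod_Cexp, <- RtoC_opp, <- RtoC_mult, Cexp_RtoC. simpl.
    unfold Re. f_equal. ring.
  - now apply is_Cseries_unique.
Qed.

(** The even integers carry the factor 2^(-s), and alternation subtracts them twice. *)
Lemma eulsum_dirichlet_right (zeta : C -> C) (r : nat) (s : C) :
  is_riemann_zeta zeta -> 1 < Re s ->
  eulsum r (dirichlet s) = ((1 - Cexp ((1 - s) * RtoC (ln 2))) * zeta s)%C.
Proof.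
  intros Hz Hs. destruct (Csummable_dirichlet zeta s Hz Hs) as [H1 H2].
  rewrite eulsum_Csummable, CSeries_alt, (CSeries_ext _ _ (dirichlet_odd s)), CSeries_scal, H2 by auto.
  replace ((1 - s) * RtoC (ln 2))%C with (RtoC (ln 2) + - s * RtoC (ln 2))%C by ring.
  rewrite Cexp_plus, Cexp_RtoC, exp_ln by lra. ring.
Qed.

Lemma C_analytic_path_Cexp (a b : C) (T : R) : C_analytic_path (fun t => Cexp (a + RtoC t * b)%C) T.
Proof.
  apply (C_analytic_path_series _ T 1 (fun k => Cexp (a + RtoC T * b) * (b ^ k * RtoC (/ INR (fact k))))%C); [lra|].
  intros t _.
  replace (Cexp (a + RtoC t * b)) with (CSeries (fun k => RtoC ((t - T) ^ k) * (Cexp (a + RtoC T * b) * (b ^ k * RtoC (/ INR (fact k)))))%C).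
  - apply Csummable_is_Cseries.
    apply Csummable_ext with (fun k => Cexp (a + RtoC T * b) * ((RtoC (t - T) * b) ^ k * RtoC (/ INR (fact k))))%C.
    + intros k. rewrite Cpow_mult_l, RtoC_pow. ring.
    + apply Csummable_scal, Csummable_exp.
  - rewrite (CSeries_ext _ (fun k => Cexp (a + RtoC T * b) * ((RtoC (t - T) * b) ^ k * RtoC (/ INR (fact k))))%C).
    + rewrite CSeries_scal, CSeries_exp, <- Cexp_plus by apply Csummable_exp. f_equal.
      rewrite RtoC_minus. ring.
    + intros k. rewrite Cpow_mult_l, RtoC_pow. ring.
Qed.

Lemma C_analytic_path_const (a : C) (T : R) : C_analytic_path (fun _ => a) T.
Proof.
  apply (C_analytic_path_series _ T 1 (fun k => if Nat.eqb k 0 then a else 0)%C); [lra|].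
  intros t _. apply is_Cseries_iff. split.
  - apply is_series_decr_1. match goal with |- is_series _ ?l => replace l with 0 by (unfold plus, opp; simpl; unfold Re; ring) end.
    apply is_series_zero. intros n. simpl. ring.
  - apply is_series_decr_1. match goal with |- is_series _ ?l => replace l with 0 by (unfold plus, opp; simpl; unfold Im; ring) end.
    apply is_series_zero. intros n. simpl. ring.
Qed.

(* The Euler sum continues (1 - 2^(1-s)) zeta(s) along the segment from s to
   2 + i, which avoids the pole at 1. *)
Lemma eulsum_dirichlet_zeta (zeta : C -> C) (r : nat) (s : R) :
  is_riemann_zeta zeta -> s < 1 -> 3 - s <= INR r ->
  eulsum r (dirichlet (RtoC s)) = ((1 - Cexp ((1 - RtoC s) * RtoC (ln 2))) * zeta (RtoC s))%C.
Proof.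
  intros Hz Hs Hr.
  set (d := ((2, 1) - RtoC s)%C : C).
  set (F := fun t => ((1 - Cexp ((1 - (RtoC s + RtoC t * d)) * RtoC (ln 2))) * zeta (RtoC s + RtoC t * d)
                      - eulsum r (dirichlet (RtoC s + RtoC t * d)))%C).
  assert (Hre : forall t, Re (RtoC s + RtoC t * d)%C = s + t * (2 - s)).
  { intros t. unfold d. simpl. ring. }
  assert (Him : forall t, Im (RtoC s + RtoC t * d)%C = t).
  { intros t. unfold d. simpl. ring. }
  assert (HF : forall T, 0 <= T <= 1 -> C_analytic_path F T).
  { intros T HT. apply C_analytic_path_minus; [apply C_analytic_path_mult|].
    - apply C_analytic_path_minus; [apply C_analytic_path_const|].
      replace (fun t => Cexp ((1 - (RtoC s + RtoC t * d)) * RtoC (ln 2))) with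
        (fun t => Cexp ((1 - RtoC s) * RtoC (ln 2) + RtoC t * (- d * RtoC (ln 2)))%C).
      + apply C_analytic_path_Cexp.
      + extensionality t. f_equal. ring.
    - apply C_analytic_at_path. apply (proj2 Hz). apply C_neq. rewrite Hre, Him. simpl.
      destruct (Req_dec T 0) as [->|HT0]; [left; lra|right; auto].
    - assert (Hd : 0 < Cmod d).
      { apply Cmod_gt_0, C_neq. right. unfold d. simpl. lra. }
      (* |t - T| < 1/|d| means |w| < 1 for the increment w = (t - T) d. *)
      apply (C_analytic_path_series _ T (/ Cmod d)
        (fun j => d ^ j * eulsum r (dirichlet_coef (RtoC s + RtoC T * d) j))%C).
      { now apply Rinv_0_lt_compat. }
      intros t Ht.
      destruct (eulsum_dirichlet_series r (RtoC s + RtoC T * d)%C (RtoC (t - T) * d)%C) as [H1 H2].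
      + rewrite Hre. nra.
      + rewrite Cmod_mult, Cmod_R. apply Rmult_lt_reg_r with (/ Cmod d); [now apply Rinv_0_lt_compat|].
        rewrite Rmult_assoc, Rinv_r by lra. lra.
      + replace (dirichlet (RtoC s + RtoC t * d)) with (dirichlet (RtoC s + RtoC T * d + RtoC (t - T) * d)).
        * rewrite <- H2. apply Csummable_is_Cseries in H1. revert H1. apply is_series_ext.
          intros j. rewrite Cpow_mult_l, RtoC_pow.
          symmetry. apply Cmult_assoc.
        * f_equal. rewrite RtoC_minus. ring. }
  (* Re (s + t d) = s + t (2 - s) exceeds 1 beyond this value of t. *)
  assert (HF1 : forall t, (1 - s) / (2 - s) < t <= 1 -> F t = 0).
  { intros t [Ht _]. apply Rlt_div_l in Ht; [|lra]. unfold F.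
    rewrite (eulsum_dirichlet_right zeta) by (auto; rewrite Hre; lra). ring. }
  assert (Hc : (1 - s) / (2 - s) < 1) by (apply Rlt_div_l; lra).
  assert (H0 : F 0 = 0).
  { apply injective_projections.
    - apply (R_analytic_identity (fun t => Re (F t)) ((1 - s) / (2 - s))); [|exact Hc|].
      + intros T HT. apply HF, HT.
      + intros t Ht. now rewrite HF1.
    - apply (R_analytic_identity (fun t => Im (F t)) ((1 - s) / (2 - s))); [|exact Hc|].
      + intros T HT. apply HF, HT.
      + intros t Ht. now rewrite HF1. }
  unfold F in H0. rewrite Cmult_0_l, Cplus_0_r in H0.
  set (A := (_ * _)%C) in H0. set (B := eulsum _ _) in *.
  fold A. replace A with (A - B + B)%C by ring. rewrite H0. ring.
Qed.

(** * Convergence of the Lambert-type series *)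

Lemma exp_minus_1_ge (K : nat) (t : R) : (1 <= K)%nat -> 0 < t -> t ^ K / INR (fact K) <= exp t - 1.
Proof.
  intros HK Ht. assert (H := is_exp_Reals t). apply is_pseries_R in H.
  assert (He : ex_series (fun n => / INR (fact n) * t ^ n)) by (eexists; exact H).
  rewrite <- (is_series_unique _ _ H). rewrite (Series_incr_1 _ He). simpl pow at 2. simpl fact at 2.
  destruct K as [|K]; [lia|].
  assert (H1 := term_le_Series (fun n => / INR (fact (S n)) * t ^ (S n)) K).
  replace (t ^ S K / INR (fact (S K))) with (/ INR (fact (S K)) * t ^ S K) by (unfold Rdiv; ring).
  assert (H2 : / INR (fact (S K)) * t ^ S K <= Series (fun k => / INR (fact (S k)) * t ^ S k)).
  { apply H1.
    - intros n. apply Rmult_le_pos; [apply Rinv_ge_0, INR_fact_lt_0|apply pow_le; lra].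
    - now apply (ex_series_incr_1 (fun n => / INR (fact n) * t ^ n)). }
  simpl INR in *. lra.
Qed.

Lemma exp_gt_1 (t : R) : 0 < t -> 0 < exp t - 1.
Proof. intros Ht. assert (H := exp_ineq1 t ltac:(lra)). lra. Qed.

(** The bound exp t - 1 >= t^K / K! with th K >= e + 2 leaves a multiple of 1/(n+1)^2. The two sides
    of the formula use th = N and th = 1/N. *)
Lemma ex_series_power_over_exp (e dl th : R) : 0 < dl -> 0 < th ->
  ex_series (fun n => Rpower (INR n + 1) e * / (exp (dl * Rpower (INR n + 1) th) - 1)).
Proof.
  intros Hd Ht. destruct (nfloor_ex (Rabs ((e + 2) / th))) as [K0 [_ HK]]; [apply Rabs_pos|].
  set (K := S K0).
  assert (HK' : e + 2 <= th * INR K).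
  { unfold K. rewrite S_INR. assert (H := Rle_abs ((e + 2) / th)).
    assert (H' : (e + 2) / th <= INR K0 + 1) by lra. apply Rle_div_l in H'; auto. lra. }
  apply ex_series_bound with (fun n => (INR (fact K) * / dl ^ K) * / (INR n + 1) ^ 2).
  2:{ apply ex_series_mult_l, ex_series_inv_sqr. }
  intros n. assert (Hn := INR_S_pos n).
  assert (HR : forall z, 0 < Rpower (INR n + 1) z) by (intros; apply exp_pos).
  set (t := dl * Rpower (INR n + 1) th).
  assert (Htp : 0 < t) by (apply Rmult_lt_0_compat; auto).
  assert (Hex := exp_gt_1 t Htp). assert (HKe := exp_minus_1_ge K t ltac:(unfold K; lia) Htp).
  rewrite Rabs_pos_eq.
  2:{ apply Rmult_le_pos; [apply Rlt_le, HR|]. now apply Rinv_ge_0. }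
  assert (Hf := INR_fact_lt_0 K). assert (HtK := pow_lt t K Htp).
  apply Rle_trans with (Rpower (INR n + 1) e * / (t ^ K / INR (fact K))).
  - apply Rmult_le_compat_l; [apply Rlt_le, HR|]. apply Rinv_le_contravar; auto.
    apply Rdiv_lt_0_compat; auto.
  - replace (t ^ K) with (dl ^ K * Rpower (INR n + 1) (th * INR K)).
    2:{ unfold t. rewrite Rpow_mult_distr. f_equal. rewrite <- Rpower_mult. apply Rpower_pow, HR. }
    assert (HdK := pow_lt dl K Hd).
    replace (/ (INR n + 1) ^ 2) with (Rpower (INR n + 1) (- INR 2)) by now rewrite Rpower_Ropp, Rpower_pow.
    replace (Rpower (INR n + 1) e * / (dl ^ K * Rpower (INR n + 1) (th * INR K) / INR (fact K))) with
      (INR (fact K) * / dl ^ K * (Rpower (INR n + 1) e * / Rpower (INR n + 1) (th * INR K))).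
    2:{ field. repeat split; apply Rgt_not_eq; auto. apply HR. }
    apply Rmult_le_compat_l.
    + apply Rmult_le_pos; [lra|]. now apply Rinv_ge_0.
    + rewrite <- Rpower_Ropp, <- Rpower_plus. apply Rle_Rpower; [generalize (pos_INR n); lra|]. assert (INR 2 = 2) by (simpl; ring). lra.
Qed.

Lemma csum_CSeries (n : nat) (F : nat -> nat -> C) :
  (forall i, (i < n)%nat -> Csummable (F i)) ->
  Csummable (fun k => csum n (fun i => F i k)) /\
  csum n (fun i => CSeries (F i)) = CSeries (fun k => csum n (fun i => F i k)).
Proof.
  induction n as [|n IH]; intros H.
  - simpl. split.
    + exists 0. apply is_series_zero. intros; apply Cmod_0.
    + now rewrite CSeries_0.
  - destruct IH as [H1 H2]; [intros; apply H; lia|]. simpl. split.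
    + apply Csummable_plus; [auto|apply H; lia].
    + rewrite H2, CSeries_plus; [auto|auto|apply H; lia].
Qed.

Lemma ssum_CSeries (h : nat) (F : Z -> nat -> C) :
  (forall j, (- Z.of_nat h <= j <= Z.of_nat h)%Z -> Csummable (F j)) ->
  Csummable (fun k => ssum h (fun j => F j k)) /\
  ssum h (fun j => CSeries (F j)) = CSeries (fun k => ssum h (fun j => F j k)).
Proof.
  intros H. apply (csum_CSeries (2 * h + 1) (fun l => F (Z.of_nat l - Z.of_nat h)%Z)).
  intros i Hi. apply H. lia.
Qed.

(** * The rays of argument pi j / N *)

Definition ray_angle (h : nat) (j : Z) : R := PI * IZR j / INR (2 * h + 1).

Lemma ray_angle_bound (h : nat) (j : Z) : (- Z.of_nat h <= j <= Z.of_nat h)%Z ->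
  Rabs (ray_angle h j) <= PI * INR h / INR (2 * h + 1) < PI / 2.
Proof.
  intros Hj. assert (Hn : 0 < INR (2 * h + 1)) by (apply lt_0_INR; lia).
  assert (HPI := PI_RGT_0). unfold ray_angle, Rdiv. split.
  - rewrite !Rabs_mult, (Rabs_pos_eq PI), (Rabs_pos_eq (/ _)) by (try apply Rinv_ge_0; lra).
    apply Rmult_le_compat_r; [apply Rinv_ge_0; lra|].
    apply Rmult_le_compat_l; [lra|]. apply Rabs_le. rewrite INR_IZR_INZ, <- opp_IZR.
    split; apply IZR_le; lia.
  - apply Rlt_div_l; [auto|]. rewrite plus_INR, mult_INR. simpl. nra.
Qed.

(** The smallest cosine among the rays, positive because |j| <= h keeps every angle below pi/2; it
    gives one decay rate for all j. *)
Definition ray_cos (h : nat) : R := cos (PI * INR h / INR (2 * h + 1)).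

Lemma ray_cos_pos (h : nat) : 0 < ray_cos h.
Proof.
  destruct (ray_angle_bound h (Z.of_nat h) ltac:(lia)) as [H1 H2].
  assert (H0 := Rabs_pos (ray_angle h (Z.of_nat h))). unfold ray_cos. apply cos_gt_0; lra.
Qed.

Lemma ray_cos_le (h : nat) (j : Z) : (- Z.of_nat h <= j <= Z.of_nat h)%Z ->
  ray_cos h <= cos (ray_angle h j).
Proof.
  intros Hj. destruct (ray_angle_bound h j Hj) as [H1 H2]. assert (HPI := PI_RGT_0).
  assert (H0 := Rabs_pos (ray_angle h j)).
  replace (cos (ray_angle h j)) with (cos (Rabs (ray_angle h j))).
  - unfold ray_cos. apply cos_decr_1; lra.
  - unfold Rabs. destruct (Rcase_abs _); auto. apply cos_neg.
Qed.

Lemma Re_ray (h : nat) (j : Z) (y : R) :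
  Re (RtoC y * cis (ray_angle h j))%C = y * cos (ray_angle h j).
Proof. rewrite cis_eq. simpl. ring. Qed.

(** Multiplication by 2 i sin(pi/(2N)) telescopes the sum to 2 i. This is where the sine in the
    formula comes from. *)
Lemma ssum_cis_ray (h : nat) :
  ssum h (fun j => cis (ray_angle h j)) = RtoC (/ sin (PI / (2 * INR (2 * h + 1)))).
Proof.
  set (n := INR (2 * h + 1)). assert (Hn : 1 <= n) by (unfold n; rewrite plus_INR; simpl INR; generalize (pos_INR (2 * h)); simpl; lra).
  assert (HPI := PI_RGT_0).
  set (th := PI / (2 * n)).
  assert (Hs : 0 < sin th).
  { apply sin_gt_0; unfold th.
    - apply Rdiv_lt_0_compat; lra.
    - apply Rlt_div_l; nra. }
  assert (Htel : forall m a, ((cis th - cis (- th)) * csum m (fun l => cis (a + 2 * th * INR l)))%C =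
      (cis (a + 2 * th * INR m - th) - cis (a - th))%C).
  { intros m a. induction m as [|m IH].
    - simpl. rewrite Rmult_0_r, Rplus_0_r. ring.
    - simpl csum. rewrite Cmult_plus_distr_l, IH, S_INR.
      replace (a + 2 * th * (INR m + 1) - th) with (th + (a + 2 * th * INR m)) by ring.
      replace (a + 2 * th * INR m - th) with (- th + (a + 2 * th * INR m)) by ring.
      rewrite !cis_plus. ring. }
  assert (E : ssum h (fun j => cis (ray_angle h j)) = csum (2 * h + 1) (fun l => cis (- (2 * th * INR h) + 2 * th * INR l))).
  { apply csum_ext. intros l _. f_equal. unfold ray_angle. fold n. rewrite minus_IZR, <- !INR_IZR_INZ.
    unfold th. field. lra. }
  assert (Ht := Htel (2 * h + 1)%nat (- (2 * th * INR h))). rewrite <- E in Ht.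
  assert (Hpi : INR (2 * h + 1) * th = PI / 2) by (fold n; unfold th; field; lra).
  assert (Hh : INR (2 * h + 1) = 2 * INR h + 1) by (rewrite plus_INR, mult_INR; simpl; ring).
  replace (- (2 * th * INR h) + 2 * th * INR (2 * h + 1) - th) with (PI / 2) in Ht by (rewrite <- Hpi, Hh; ring).
  replace (- (2 * th * INR h) - th) with (- (PI / 2)) in Ht by (rewrite <- Hpi, Hh; ring).
  rewrite !cis_eq, !cos_neg, !sin_neg, cos_PI2, sin_PI2 in Ht.
  set (S := ssum _ _) in *. apply injective_projections.
  - apply (f_equal snd) in Ht. simpl in Ht. simpl.
    apply Rmult_eq_reg_l with (2 * sin th); [|lra].
    transitivity 2; [|field; lra]. lra.
  - apply (f_equal fst) in Ht. simpl in Ht. simpl. nra.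
Qed.

(** * The two Lambert-type sums as double series *)

(* With N = 2h+1, c = 2^N alpha and n, k starting at 0: xx is (2(n+1))^N alpha,
   kap is 2^(1/N) beta, yy is (2(k+1))^(1/N) beta, and uu = xx^2. *)

Definition xx (h : nat) (c : R) (n : nat) : R := c * (INR n + 1) ^ (2 * h + 1).
Definition kap (h : nat) (c : R) : R := Rpower ((2 * PI) ^ (2 * h + 2) / c) (/ INR (2 * h + 1)).
Definition yy (h : nat) (c : R) (k : nat) : R := kap h c * Rpower (INR k + 1) (/ INR (2 * h + 1)).
Definition uu (h : nat) (c : R) (n : nat) : R := c ^ 2 * (INR n + 1) ^ (2 * (2 * h + 1)).
Definition vv (k : nat) : R := (2 * PI) ^ 2 * (INR k + 1) ^ 2.
Definition fser (h : nat) (c : R) (n : nat) : R :=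
  1 + 2 * Series (fun k => uu h c n / (uu h c n + vv k)).
Definition gser (h : nat) (c : R) (k : nat) : R :=
  1 + 2 * Series (fun n => vv k / (uu h c n + vv k)).

Lemma xx_pos h c n : 0 < c -> 0 < xx h c n.
Proof. intros. apply Rmult_lt_0_compat; auto. apply pow_lt, INR_S_pos. Qed.

Lemma uu_xx h c n : uu h c n = xx h c n ^ 2.
Proof. unfold uu, xx. rewrite Rpow_mult_distr, (Nat.mul_comm 2), pow_mult. reflexivity. Qed.

Lemma uu_pos h c n : 0 < c -> 0 < uu h c n.
Proof. intros. rewrite uu_xx. now apply pow_lt, xx_pos. Qed.

Lemma vv_pos k : 0 < vv k.
Proof.
  unfold vv. apply Rmult_lt_0_compat; apply pow_lt. generalize PI_RGT_0; lra. apply INR_S_pos.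
Qed.

Lemma vv_eq k : vv k = (2 * PI * (INR k + 1)) ^ 2.
Proof. unfold vv. ring. Qed.

Lemma INR_odd_pos h : 0 < INR (2 * h + 1).
Proof. apply lt_0_INR. lia. Qed.

Lemma kap_pos h c : 0 < kap h c.
Proof. apply exp_pos. Qed.

Lemma yy_pos h c k : 0 < yy h c k.
Proof. apply Rmult_lt_0_compat; apply exp_pos. Qed.

Lemma Rpower_inv_pow (x : R) (n : nat) : 0 < x -> (0 < n)%nat -> Rpower x (/ INR n) ^ n = x.
Proof.
  intros Hx Hn. rewrite <- Rpower_pow by apply exp_pos. rewrite Rpower_mult, Rinv_l.
  - now apply Rpower_1.
  - apply not_0_INR. lia.
Qed.

Lemma kap_pow h c : 0 < c -> kap h c ^ (2 * h + 1) = (2 * PI) ^ (2 * h + 2) / c.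
Proof.
  intros Hc. apply Rpower_inv_pow; [|lia]. apply Rdiv_lt_0_compat; auto.
  apply pow_lt. generalize PI_RGT_0; lra.
Qed.

Lemma yy_pow h c k : 0 < c -> yy h c k ^ (2 * h + 1) = (2 * PI) ^ (2 * h + 2) / c * (INR k + 1).
Proof.
  intros Hc. unfold yy. rewrite Rpow_mult_distr, kap_pow by auto. f_equal.
  apply Rpower_inv_pow; [apply INR_S_pos|lia].
Qed.

Lemma fser_eq h c n : 0 < c -> fser h c n = xx h c n * (/ 2 + / (exp (xx h c n) - 1)).
Proof.
  intros Hc. assert (Hx := xx_pos h c n Hc).
  rewrite (coth_partial_fractions_R _ Hx). unfold fser. rewrite uu_xx.
  rewrite Rmult_plus_distr_l, Rinv_r by lra. f_equal.
  rewrite <- !Series_scal_l. apply Series_ext. intros k. rewrite vv_eq. simpl. unfold Rdiv. ring.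
Qed.

(** As j runs over -h..h, the factors run over the N-th roots of unity, and N odd gives (-a)^N =
    -a^N. *)
Lemma ssum_rational_roots (h : nat) (a : R) : 0 < a ->
  ssum h (fun j => / (1 + RtoC a * cis (- (2 * ray_angle h j))))%C =
  RtoC (INR (2 * h + 1) / (1 + a ^ (2 * h + 1))).
Proof.
  intros Ha. set (n := INR (2 * h + 1)). assert (Hn : 0 < n) by apply INR_odd_pos.
  assert (Hodd : (- a) ^ (2 * h + 1) = - a ^ (2 * h + 1)).
  { rewrite !pow_add, !pow_mult. replace ((- a) ^ 2) with (a ^ 2) by ring. simpl. ring. }
  assert (Hap : 0 < a ^ (2 * h + 1)) by now apply pow_lt.
  rewrite <- (ssum_opp h).
  rewrite (ssum_ext h _ (fun j => / (1 - cis (2 * PI * IZR j / n) * RtoC (- a)))%C).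
  - unfold n. rewrite ssum_roots.
    + rewrite <- RtoC_pow, Hodd, <- RtoC_minus, <- RtoC_div.
      * f_equal. f_equal. ring.
      * lra.
    + rewrite <- RtoC_pow, Hodd. intros E. apply RtoC_inj in E. lra.
  - intros j _. f_equal. unfold ray_angle. rewrite opp_IZR, RtoC_opp. fold n.
    replace (- (2 * (PI * - IZR j / n))) with (2 * PI * IZR j / n) by (field; lra). ring.
Qed.

(** In the partial fractions of coth along the rays, the N terms 1/z contribute the constant 1. The
    terms belonging to one pole pair are (2/y) / (1 + a e^(-2 i theta)) with a = V/y^2; the root
    identity sums them to a rational function of a^N, which is u/v by the choice of [kap]. *)
Lemma gser_eq h c k : 0 < c ->
  RtoC (gser h c k) = (RtoC (yy h c k / INR (2 * h + 1)) *
    ssum h (fun j => cis (ray_angle h j) * Ccoth (RtoC (yy h c k) * cis (ray_angle h j))))%C.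
Proof.
  intros Hc. assert (Hy := yy_pos h c k). set (y := yy h c k) in *.
  set (n := INR (2 * h + 1)). assert (Hn : 0 < n) by apply INR_odd_pos.
  assert (Hyc : RtoC y <> 0) by (intros E; apply RtoC_inj in E; lra).
  set (z := fun j => (RtoC y * cis (ray_angle h j))%C).
  assert (Hre : forall j, (- Z.of_nat h <= j <= Z.of_nat h)%Z -> 0 < Re (z j)).
  { intros j Hj. unfold z. rewrite Re_ray. apply Rmult_lt_0_compat; auto.
    apply Rlt_le_trans with (ray_cos h); [apply ray_cos_pos|now apply ray_cos_le]. }
  rewrite (ssum_ext h _ (fun j => RtoC (/ y) + CSeries (fun i => cis (ray_angle h j) * coth_term (z j) i))%C).
  2:{ intros j Hj. fold (z j). rewrite Ccoth_partial_fractions by now apply Hre.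
      rewrite CSeries_scal by apply Csummable_coth_term. rewrite Cmult_plus_distr_l. f_equal.
      unfold z. rewrite RtoC_inv by lra. assert (H := Cexp_neq_0 (Ci * RtoC (ray_angle h j))%C).
      fold (cis (ray_angle h j)) in H. field. auto. }
  rewrite ssum_plus, ssum_const. fold n.
  destruct (ssum_CSeries h (fun j i => cis (ray_angle h j) * coth_term (z j) i)%C) as [_ ->].
  { intros j _. apply Csummable_scal, Csummable_coth_term. }
  rewrite (CSeries_ext _ (fun i => RtoC (2 * n / y * (vv k / (uu h c i + vv k))))).
  - rewrite CSeries_RtoC, Series_scal_l, <- RtoC_mult, <- RtoC_plus, <- RtoC_mult. f_equal.
    unfold gser. field. lra.
  - intros i. set (V := (2 * PI * (INR i + 1)) ^ 2).
    assert (HV : 0 < V) by (unfold V; rewrite <- vv_eq; apply vv_pos).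
    rewrite (ssum_ext h _ (fun j => RtoC (2 / y) * / (1 + RtoC (V / y ^ 2) * cis (- (2 * ray_angle h j))))%C).
    + assert (Hy2 : 0 < y ^ 2) by now apply pow_lt.
      rewrite ssum_scal, ssum_rational_roots by now apply Rdiv_lt_0_compat.
      rewrite <- RtoC_mult. f_equal. fold n.
      assert (Hu := uu_pos h c i Hc). assert (Hv := vv_pos k).
      replace ((V / y ^ 2) ^ (2 * h + 1)) with (uu h c i / vv k).
      * field. repeat split; lra.
      * assert (Hpi : 0 < 2 * PI) by (generalize PI_RGT_0; lra).
        assert (Hk := INR_S_pos k).
        assert (HQ := pow_lt (2 * PI) (2 * h + 1) Hpi).
        assert (EV : V ^ (2 * h + 1) = ((2 * PI) ^ (2 * h + 1) * (INR i + 1) ^ (2 * h + 1)) ^ 2).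
        { unfold V. rewrite <- pow_mult, (Nat.mul_comm 2), pow_mult, Rpow_mult_distr. reflexivity. }
        assert (Eu : uu h c i = (c * (INR i + 1) ^ (2 * h + 1)) ^ 2) by apply uu_xx.
        assert (Ey : (y ^ 2) ^ (2 * h + 1) = ((2 * PI) ^ (2 * h + 1) * (2 * PI) / c * (INR k + 1)) ^ 2).
        { rewrite <- pow_mult, (Nat.mul_comm 2), pow_mult. unfold y. rewrite yy_pow by auto.
          replace (2 * h + 2)%nat with (2 * h + 1 + 1)%nat by lia.
          rewrite (pow_add (2 * PI) (2 * h + 1) 1), pow_1.
          set (Q := (2 * PI) ^ (2 * h + 1)). apply (f_equal (fun t => t ^ 2)). unfold Rdiv. ring. }
        unfold Rdiv at 2. rewrite Rpow_mult_distr, pow_inv, EV, Eu, Ey. unfold vv.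
        field. repeat split; lra.
    + intros j Hj. unfold coth_term. fold V. assert (Hden := C_sum_sqr_neq_0 (z j) (2 * PI * (INR i + 1)) (Hre j Hj)).
      fold V in Hden.
      assert (Ei : cis (- (2 * ray_angle h j)) = (/ (cis (ray_angle h j) * cis (ray_angle h j)))%C).
      { rewrite <- cis_plus. replace (- (2 * ray_angle h j)) with (- (ray_angle h j + ray_angle h j)) by ring.
        unfold cis. rewrite <- Cexp_opp. f_equal. rewrite RtoC_opp. ring. }
      rewrite Ei. unfold z in *. assert (H := Cexp_neq_0 (Ci * RtoC (ray_angle h j))%C).
      fold (cis (ray_angle h j)) in H. set (w := cis (ray_angle h j)) in *.
      rewrite !RtoC_div by (apply Rgt_not_eq; auto; now apply pow_lt). rewrite RtoC_pow.
      simpl Cpow.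
      field. split; [auto|split; [auto|]]. intros E. apply Hden. rewrite <- E. ring.
Qed.

Definition lexp (h : nat) (m : Z) : R := 2 * INR (2 * h + 1) * IZR m + INR (2 * h + 1).
Definition rexp (h : nat) (m : Z) : R := 2 * IZR m + 2 - 1 / INR (2 * h + 1).

Definition lterm (h : nat) (c : R) (m : Z) (n : nat) : R :=
  Rpower (INR n + 1) (- lexp h m) / (exp (xx h c n) - 1).

Definition rterm (h : nat) (c : R) (m j : Z) (k : nat) : C :=
  (RtoC (Rpower (INR k + 1) (- rexp h m)) / (Cexp (RtoC (yy h c k) * cis (ray_angle h j)) - 1))%C.

Definition rterms (h : nat) (c : R) (m : Z) (k : nat) : C :=
  ssum h (fun j => cis (ray_angle h j) * rterm h c m j k)%C.

(** What remains of v^(-m-1) y / N once the power of k + 1 has been split off. *)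
Definition rcoef (h : nat) (c : R) (m : Z) : R :=
  Rpower (2 * PI) (- (2 * IZR m + 2)) * kap h c / INR (2 * h + 1).

Lemma two_PI_pos : 0 < 2 * PI.
Proof. generalize PI_RGT_0; lra. Qed.

Lemma dirichlet_R (s : R) (n : nat) : dirichlet (RtoC s) n = RtoC (Rpower (INR n + 1) (- s)).
Proof. unfold dirichlet. now rewrite <- RtoC_opp, <- RtoC_mult, Cexp_RtoC. Qed.

Lemma Rpower_sqr (x e : R) : 0 < x -> Rpower (x ^ 2) e = Rpower x (2 * e).
Proof.
  intros Hx. rewrite <- (Rpower_pow 2 x Hx), Rpower_mult. replace (INR 2) with 2 by (simpl; ring). reflexivity.
Qed.

(** Since u = x^2, u^(-m-1) x = x^(-2m-1); the 1/2 in coth becomes the zeta part and 1/(e^x - 1) the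
    Lambert part. *)
Lemma fser_weighted h c m n : 0 < c ->
  Rpower (uu h c n) (- (IZR m + 1)) * fser h c n =
  Rpower c (- (2 * IZR m + 1)) * (/ 2 * Rpower (INR n + 1) (- lexp h m) + lterm h c m n).
Proof.
  intros Hc. assert (Hx := xx_pos h c n Hc). assert (Hn := INR_S_pos n).
  rewrite fser_eq, uu_xx, Rpower_sqr by auto.
  assert (E : Rpower (xx h c n) (2 * - (IZR m + 1)) * xx h c n =
     Rpower c (- (2 * IZR m + 1)) * Rpower (INR n + 1) (- lexp h m)).
  { rewrite <- (Rpower_1 (xx h c n)) at 2 by auto. rewrite <- Rpower_plus.
    replace (2 * - (IZR m + 1) + 1) with (- (2 * IZR m + 1)) by ring.
    unfold xx. rewrite <- Rpower_mult_distr by (auto; now apply pow_lt). f_equal.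
    rewrite <- Rpower_pow, Rpower_mult by auto. f_equal. unfold lexp. ring. }
  rewrite <- Rmult_assoc, E. unfold lterm, Rdiv. ring.
Qed.

(** The same split on every ray; the halves add up to 1/(2 sin(pi/(2N))). *)
Lemma gser_weighted h c m k : 0 < c ->
  RtoC (Rpower (vv k) (- (IZR m + 1)) * gser h c k) =
  (RtoC (rcoef h c m) * (RtoC (/ (2 * sin (PI / (2 * INR (2 * h + 1))))) * dirichlet (RtoC (rexp h m)) k
    + rterms h c m k))%C.
Proof.
  intros Hc. assert (Hk := INR_S_pos k). assert (HN := INR_odd_pos h). assert (HP := two_PI_pos).
  rewrite RtoC_mult, gser_eq by auto. rewrite vv_eq, Rpower_sqr by (apply Rmult_lt_0_compat; auto).
  rewrite dirichlet_R.
  assert (E : Rpower (2 * PI * (INR k + 1)) (2 * - (IZR m + 1)) * (yy h c k / INR (2 * h + 1)) =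
      rcoef h c m * Rpower (INR k + 1) (- rexp h m)).
  { rewrite <- Rpower_mult_distr by auto. unfold yy, rcoef, rexp.
    replace (2 * - (IZR m + 1)) with (- (2 * IZR m + 2)) by ring.
    replace (- (2 * IZR m + 2 - 1 / INR (2 * h + 1))) with (- (2 * IZR m + 2) + / INR (2 * h + 1)) by (field; lra).
    rewrite Rpower_plus. field. lra. }
  rewrite Cmult_assoc, <- RtoC_mult, E, RtoC_mult, <- Cmult_assoc. f_equal.
  rewrite (ssum_ext h _ (fun j => / 2 * cis (ray_angle h j) + cis (ray_angle h j) * / (Cexp (RtoC (yy h c k) * cis (ray_angle h j)) - 1))%C)
    by (intros; unfold Ccoth; ring).
  rewrite ssum_plus, ssum_scal, ssum_cis_ray, Cmult_plus_distr_l. f_equal.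
  - rewrite Rinv_mult, (RtoC_mult (/ 2)), (RtoC_inv 2) by lra. ring.
  - unfold rterms, rterm, Cdiv. rewrite <- ssum_scal. apply ssum_ext. intros; ring.
Qed.

Lemma ex_series_lterm h c m : 0 < c -> ex_series (fun n => Rabs (lterm h c m n)).
Proof.
  intros Hc. apply ex_series_ext with (fun n => Rpower (INR n + 1) (- lexp h m) *
     / (exp (c * Rpower (INR n + 1) (INR (2 * h + 1))) - 1)).
  - intros n. rewrite Rpower_pow by apply INR_S_pos. fold (xx h c n).
    assert (Hx := exp_gt_1 _ (xx_pos h c n Hc)). rewrite Rabs_pos_eq; [reflexivity|].
    unfold lterm. apply Rmult_le_pos; [apply Rlt_le, exp_pos|]. now apply Rinv_ge_0.
  - apply ex_series_power_over_exp; auto. apply INR_odd_pos.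
Qed.

(** |e^z - 1| >= e^(Re z) - 1, and Re z is at least [ray_cos h] times y. *)
Lemma Csummable_rterm h c m j : (- Z.of_nat h <= j <= Z.of_nat h)%Z -> Csummable (rterm h c m j).
Proof.
  intros Hj. set (dl := kap h c * ray_cos h).
  assert (Hd : 0 < dl) by (apply Rmult_lt_0_compat; [apply kap_pos|apply ray_cos_pos]).
  apply Csummable_bound with (fun k => Rpower (INR k + 1) (- rexp h m) *
     / (exp (dl * Rpower (INR k + 1) (/ INR (2 * h + 1))) - 1)).
  2:{ apply ex_series_power_over_exp; auto. apply Rinv_0_lt_compat, INR_odd_pos. }
  intros k. unfold rterm. assert (HR : 0 < Rpower (INR k + 1) (/ INR (2 * h + 1))) by apply exp_pos.
  set (t := dl * Rpower (INR k + 1) (/ INR (2 * h + 1))).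
  assert (Ht : 0 < t) by now apply Rmult_lt_0_compat.
  assert (Hge : exp t - 1 <= Cmod (Cexp (RtoC (yy h c k) * cis (ray_angle h j)) - 1)%C).
  { generalize (Cmod_sub_le (Cexp (RtoC (yy h c k) * cis (ray_angle h j))) (Cexp (RtoC (yy h c k) * cis (ray_angle h j)) - 1)%C).
    replace (Cexp (RtoC (yy h c k) * cis (ray_angle h j)) - (Cexp (RtoC (yy h c k) * cis (ray_angle h j)) - 1))%C
      with (RtoC 1) by ring. rewrite Cmod_1, Cmod_Cexp, Re_ray.
    assert (H : t <= yy h c k * cos (ray_angle h j)).
    { unfold t, dl, yy. rewrite Rmult_assoc, (Rmult_comm (ray_cos h)), <- Rmult_assoc.
      apply Rmult_le_compat_l; [apply Rlt_le, Rmult_lt_0_compat; auto; apply kap_pos|now apply ray_cos_le]. }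
    assert (exp t <= exp (yy h c k * cos (ray_angle h j))).
    { destruct H as [H|H]; [left; now apply exp_increasing|rewrite H; lra]. }
    lra. }
  assert (Hex := exp_gt_1 t Ht).
  rewrite Cmod_div by (apply Cmod_gt_0; lra). rewrite Cmod_R, Rabs_pos_eq by apply Rlt_le, exp_pos.
  apply Rmult_le_compat_l; [apply Rlt_le, exp_pos|]. apply Rinv_le_contravar; lra.
Qed.

Lemma Csummable_rterms h c m : Csummable (rterms h c m).
Proof.
  apply (ssum_CSeries h (fun j k => cis (ray_angle h j) * rterm h c m j k)%C).
  intros j Hj. now apply Csummable_scal, Csummable_rterm.
Qed.

(* The two sides of the formula, divided by a common factor; they are the
   (regularised) sums of uu^(-m-1) fser and vv^(-m-1) gser. *)
Definition Lside (zeta : C -> C) (h : nat) (c : R) (m : Z) : C :=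
  (RtoC (Rpower c (- (2 * IZR m + 1))) *
     (/ 2 * zeta (RtoC (lexp h m)) + RtoC (Series (lterm h c m))))%C.

Definition Rside (zeta : C -> C) (h : nat) (c : R) (m : Z) : C :=
  (RtoC (rcoef h c m) * (RtoC (/ (2 * sin (PI / (2 * INR (2 * h + 1))))) * zeta (RtoC (rexp h m))
    + CSeries (rterms h c m)))%C.

(** * Dilations *)

Lemma uu_half h c n : uu h (c / 2) n = uu h c n / 4.
Proof. unfold uu. field. Qed.

Lemma vv_odd k : vv (2 * k + 1) = 4 * vv k.
Proof. unfold vv. rewrite plus_INR, mult_INR. simpl. ring. Qed.

Lemma xx_odd h c n : xx h c (2 * n + 1) = xx h (2 ^ (2 * h + 1) * c) n.
Proof.
  unfold xx. replace (INR (2 * n + 1) + 1) with (2 * (INR n + 1)) by (rewrite plus_INR, mult_INR; simpl; ring).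
  rewrite Rpow_mult_distr. ring.
Qed.

Lemma uu_odd h c n : uu h c (2 * n + 1) = uu h (2 ^ (2 * h + 1) * c) n.
Proof. now rewrite !uu_xx, xx_odd. Qed.

Lemma Series_alt (a : nat -> R) : ex_series (fun k => Rabs (a k)) ->
  Series (fun k => (-1) ^ k * a k) = Series a - 2 * Series (fun k => a (2 * k + 1)%nat).
Proof.
  intros Ha. assert (E := CSeries_alt (fun k => RtoC (a k)) (Csummable_RtoC a Ha)).
  unfold alt in E. rewrite (CSeries_ext _ (fun k => RtoC ((-1) ^ k * a k))) in E
    by (intros; now rewrite RtoC_mult).
  rewrite !CSeries_RtoC, <- RtoC_mult, <- RtoC_minus in E. now apply RtoC_inj.
Qed.

Lemma ex_series_ratio (a : R) (w : nat -> R) :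
  0 < a -> (forall k, 0 < w k) -> ex_series (fun k => / w k) ->
  ex_series (fun k => Rabs (a / (a + w k))).
Proof.
  intros Ha Hw He. apply ex_series_bound with (fun k => a * / w k); [|now apply ex_series_mult_l].
  intros k. specialize (Hw k). rewrite Rabs_Rabsolu, Rabs_pos_eq.
  - apply Rmult_le_compat_l; [lra|]. apply Rinv_le_contravar; lra.
  - apply Rmult_le_pos; [lra|]. apply Rinv_ge_0; lra.
Qed.

Lemma ex_series_uu_vv (h : nat) (c : R) (n : nat) : 0 < c ->
  ex_series (fun k => Rabs (uu h c n / (uu h c n + vv k))).
Proof.
  intros Hc. apply ex_series_ratio; [now apply uu_pos|apply vv_pos|].
  apply ex_series_inv_pow; [lia|apply pow_lt, two_PI_pos].
Qed.

Lemma ex_series_vv_uu (h : nat) (c : R) (k : nat) : 0 < c ->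
  ex_series (fun n => Rabs (vv k / (vv k + uu h c n))).
Proof.
  intros Hc. apply ex_series_ratio; [apply vv_pos|intros; now apply uu_pos|].
  apply ex_series_inv_pow; [lia|now apply pow_lt].
Qed.

(** Passing to odd k turns v into 4 v, and u/(u + 4 v) is the same ratio with u/4 and v, that is,
    with c/2. *)
Lemma fser_half h c n : 0 < c ->
  1 - 2 * Series (fun k => (-1) ^ k * (uu h c n / (uu h c n + vv k))) = 2 * fser h (c / 2) n - fser h c n.
Proof.
  intros Hc. rewrite Series_alt by now apply ex_series_uu_vv. unfold fser.
  rewrite (Series_ext (fun k => uu h c n / (uu h c n + vv (2 * k + 1)))
    (fun k => uu h (c / 2) n / (uu h (c / 2) n + vv k))); [ring|].
  intros k. rewrite vv_odd, uu_half. assert (Hu := uu_pos h c n Hc). assert (Hv := vv_pos k). field. lra.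
Qed.

(** Odd n stand for doubled integers, whose extra factor 2^N is absorbed into c. *)
Lemma gser_double h c k : 0 < c ->
  1 - 2 * Series (fun n => (-1) ^ n * (vv k / (vv k + uu h c n))) = 2 * gser h (2 ^ (2 * h + 1) * c) k - gser h c k.
Proof.
  intros Hc.
  rewrite Series_alt by now apply ex_series_vv_uu. unfold gser.
  rewrite (Series_ext (fun n => vv k / (vv k + uu h c n)) (fun n => vv k / (uu h c n + vv k)))
    by (intros; now rewrite Rplus_comm).
  rewrite (Series_ext (fun n => vv k / (vv k + uu h c (2 * n + 1)))
    (fun n => vv k / (uu h (2 ^ (2 * h + 1) * c) n + vv k))); [ring|].
  intros n. now rewrite uu_odd, Rplus_comm.
Qed.

(** * The case m < 0 *)

(** The Dirichlet part is evaluated by continuation; [b] is absolutely summable and is simply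
    alternated. *)
Lemma eulsum_dirichlet_plus (zeta : C -> C) (r : nat) (s : R) (A : C) (b : nat -> C) :
  is_riemann_zeta zeta -> s < 1 -> 3 - s <= INR r -> Csummable b ->
  eulsum r (fun k => A * dirichlet (RtoC s) k + b k)%C =
  (A * ((1 - RtoC (2 * Rpower 2 (- s))) * zeta (RtoC s)) + (CSeries b - 2 * CSeries (fun k => b (2 * k + 1)%nat)))%C.
Proof.
  intros Hz Hs Hr Hb.
  assert (Hd : esummable r (dirichlet (RtoC s))) by (apply esummable_dirichlet; auto).
  rewrite eulsum_plus, eulsum_scal, (eulsum_dirichlet_zeta zeta), eulsum_Csummable, CSeries_alt by
    (auto; try apply esummable_scal; auto; now apply Csummable_esummable).
  replace (Cexp ((1 - RtoC s) * RtoC (ln 2))) with (RtoC (2 * Rpower 2 (- s))); [reflexivity|].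
  rewrite <- RtoC_minus, <- RtoC_mult, Cexp_RtoC. f_equal.
  replace ((1 - s) * ln 2) with (ln 2 + - s * ln 2) by ring. rewrite exp_plus, exp_ln by lra. reflexivity.
Qed.

Lemma Rpower_2_pow (n : nat) (e : R) : Rpower (2 ^ n) e = Rpower 2 (INR n * e).
Proof. rewrite <- Rpower_pow, Rpower_mult by lra. reflexivity. Qed.

Lemma kap_scale h c a : 0 < c -> 0 < a -> kap h (a * c) = kap h c * Rpower a (- / INR (2 * h + 1)).
Proof.
  intros Hc Ha. unfold kap.
  assert (HP : 0 < (2 * PI) ^ (2 * h + 2)) by apply pow_lt, two_PI_pos.
  replace ((2 * PI) ^ (2 * h + 2) / (a * c)) with ((2 * PI) ^ (2 * h + 2) / c * / a) by (field; lra).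
  rewrite <- Rpower_mult_distr by (try apply Rdiv_lt_0_compat; try apply Rinv_0_lt_compat; auto).
  f_equal. rewrite <- (Rpower_1 a) at 1 by auto. rewrite <- Rpower_Ropp, Rpower_mult. f_equal. ring.
Qed.

Lemma kap_half h c : 0 < c -> kap h (c / 2) = kap h c * Rpower 2 (/ INR (2 * h + 1)).
Proof.
  intros Hc. replace (c / 2) with (/ 2 * c) by field. rewrite kap_scale by lra. f_equal.
  rewrite <- (Rpower_1 2) at 1 by lra. rewrite <- Rpower_Ropp, Rpower_mult. f_equal. ring.
Qed.

Lemma kap_double h c : 0 < c -> kap h (2 ^ (2 * h + 1) * c) = kap h c / 2.
Proof.
  intros Hc. rewrite kap_scale by (auto; apply pow_lt; lra). rewrite Rpower_2_pow.
  replace (INR (2 * h + 1) * - / INR (2 * h + 1)) with (- (1)) by (field; apply Rgt_not_eq, INR_odd_pos).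
  rewrite Rpower_Ropp, Rpower_1 by lra. reflexivity.
Qed.

Lemma lterm_odd h c m n :
  lterm h c m (2 * n + 1) = Rpower 2 (- lexp h m) * lterm h (2 ^ (2 * h + 1) * c) m n.
Proof.
  unfold lterm. rewrite xx_odd.
  replace (INR (2 * n + 1) + 1) with (2 * (INR n + 1)) by (rewrite plus_INR, mult_INR; simpl; ring).
  rewrite <- Rpower_mult_distr by (lra || apply INR_S_pos). unfold Rdiv. ring.
Qed.

Lemma rterm_odd h c m j k : 0 < c ->
  rterm h c m j (2 * k + 1) = (RtoC (Rpower 2 (- rexp h m)) * rterm h (c / 2) m j k)%C.
Proof.
  intros Hc. unfold rterm.
  replace (INR (2 * k + 1) + 1) with (2 * (INR k + 1)) by (rewrite plus_INR, mult_INR; simpl; ring).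
  replace (yy h c (2 * k + 1)) with (yy h (c / 2) k).
  - rewrite <- Rpower_mult_distr by (lra || apply INR_S_pos). rewrite RtoC_mult. unfold Cdiv. ring.
  - unfold yy. rewrite kap_half by auto.
    replace (INR (2 * k + 1) + 1) with (2 * (INR k + 1)) by (rewrite plus_INR, mult_INR; simpl; ring).
    rewrite <- (Rpower_mult_distr 2) by (lra || apply INR_S_pos). ring.
Qed.

Lemma exists_nat_ge (x : R) : exists n : nat, x <= INR n.
Proof.
  destruct (nfloor_ex (Rabs x)) as [n [_ Hn]]; [apply Rabs_pos|]. exists (S n).
  rewrite S_INR. generalize (Rle_abs x). lra.
Qed.

Section Negative.

Variables (zeta : C -> C) (h p : nat) (m : Z).
Hypotheses (Hz : is_riemann_zeta zeta) (Hp : (1 <= p)%nat) (Hm : (m = - Z.of_nat p)%Z).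

Lemma neg_IZR : IZR m = - INR p.
Proof. rewrite Hm, opp_IZR, <- INR_IZR_INZ. reflexivity. Qed.

Lemma neg_INR_ge_1 : 1 <= INR p.
Proof. apply (le_INR 1) in Hp. simpl in Hp. exact Hp. Qed.

Lemma neg_Rpower x : 0 < x -> Rpower x (- (IZR m + 1)) = x ^ (p - 1).
Proof.
  intros Hx. rewrite neg_IZR, <- Rpower_pow, minus_INR by auto. f_equal. simpl. ring.
Qed.

Lemma neg_lexp : lexp h m < 1.
Proof.
  unfold lexp. rewrite neg_IZR. generalize (INR_odd_pos h) neg_INR_ge_1. intros. nra.
Qed.

Lemma neg_rexp : rexp h m < 1.
Proof.
  unfold rexp. rewrite neg_IZR. generalize (Rinv_0_lt_compat _ (INR_odd_pos h)) neg_INR_ge_1. intros.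
  unfold Rdiv. lra.
Qed.

Lemma Csummable_lterm c : 0 < c -> Csummable (fun n => RtoC (lterm h c m n)).
Proof. intros. now apply Csummable_RtoC, ex_series_lterm. Qed.

(** In other words 2 * 4^(p-1) = 2^(-2m-1), the scalar attached to the doubling of c. *)
Lemma neg_scale_pow : 2 * 4 ^ (p - 1) * Rpower 2 (2 * IZR m + 1) = 1.
Proof.
  rewrite neg_IZR. replace 4 with (2 ^ 2) by ring. rewrite <- pow_mult, <- Rpower_pow, mult_INR, minus_INR by (auto; lra).
  rewrite <- (Rpower_1 2) at 1 by lra. rewrite <- !Rpower_plus.
  replace (1 + INR 2 * (INR p - INR 1) + (2 * - INR p + 1)) with 0 by (simpl; ring).
  apply Rpower_O. lra.
Qed.

(** Alternation subtracts the even integers twice, and on these the zeta part and the Lambert part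
    alike pass from c to 2^N c. *)
Lemma neg_eulsum_f c r : 0 < c -> 3 - lexp h m <= INR r ->
  eulsum r (fun n => RtoC (uu h c n ^ (p - 1) * fser h c n)) =
  (Lside zeta h c m - 2 * Lside zeta h (2 ^ (2 * h + 1) * c)%R m)%C.
Proof.
  intros Hc Hr. set (a := Rpower c (- (2 * IZR m + 1))).
  set (c' := 2 ^ (2 * h + 1) * c). assert (Hc' : 0 < c') by (apply Rmult_lt_0_compat; auto; apply pow_lt; lra).
  replace (fun n => RtoC (uu h c n ^ (p - 1) * fser h c n)) with
    (fun n => RtoC (a / 2) * dirichlet (RtoC (lexp h m)) n + RtoC a * RtoC (lterm h c m n))%C.
  2:{ extensionality n. rewrite <- neg_Rpower by now apply uu_pos. rewrite fser_weighted, dirichlet_R by auto.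
      rewrite <- !RtoC_mult, <- RtoC_plus. f_equal. unfold a. field. }
  rewrite (eulsum_dirichlet_plus zeta) by (auto; try apply neg_lexp; now apply Csummable_scal, Csummable_lterm).
  rewrite CSeries_scal by now apply Csummable_lterm.
  rewrite (CSeries_ext (fun k => RtoC a * RtoC (lterm h c m (2 * k + 1)))%C
     (fun k => RtoC (a * Rpower 2 (- lexp h m)) * RtoC (lterm h c' m k))%C).
  2:{ intros k. rewrite lterm_odd, !RtoC_mult. fold c'. ring. }
  rewrite CSeries_scal by now apply Csummable_lterm.
  rewrite !CSeries_RtoC. unfold Lside. fold a.
  replace (Rpower c' (- (2 * IZR m + 1))) with (a * Rpower 2 (- lexp h m)).
  - unfold Rdiv. rewrite !RtoC_mult, RtoC_inv by lra.
    change (Series (fun n => lterm h c m n)) with (Series (lterm h c m)).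
    change (Series (fun n => lterm h c' m n)) with (Series (lterm h c' m)). field.
  - unfold c', a. rewrite <- Rpower_mult_distr, Rpower_2_pow by (auto; apply pow_lt; lra).
    rewrite Rmult_comm. f_equal. f_equal. unfold lexp. ring.
Qed.

(** As for [fser], except that the even integers k + 1 replace c by c/2 and leave the power
    2^(-2m-1). *)
Lemma neg_eulsum_g c r : 0 < c -> 3 - rexp h m <= INR r ->
  eulsum r (fun k => RtoC (vv k ^ (p - 1) * gser h c k)) =
  (Rside zeta h c m - RtoC (2 * 4 ^ (p - 1)) * Rside zeta h (c / 2)%R m)%C.
Proof.
  intros Hc Hr. assert (HN := INR_odd_pos h).
  set (sn := / (2 * sin (PI / (2 * INR (2 * h + 1))))).
  replace (fun k => RtoC (vv k ^ (p - 1) * gser h c k)) with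
    (fun k => (RtoC (rcoef h c m) * RtoC sn) * dirichlet (RtoC (rexp h m)) k +
       RtoC (rcoef h c m) * rterms h c m k)%C.
  2:{ extensionality k. rewrite <- neg_Rpower by apply vv_pos. rewrite gser_weighted by auto. fold sn. ring. }
  assert (Hc2 : 0 < c / 2) by lra.
  rewrite (eulsum_dirichlet_plus zeta) by (auto; try apply neg_rexp; apply Csummable_scal, Csummable_rterms).
  rewrite CSeries_scal by apply Csummable_rterms.
  rewrite (CSeries_ext (fun k => RtoC (rcoef h c m) * rterms h c m (2 * k + 1)%nat)%C
     (fun k => RtoC (rcoef h c m * Rpower 2 (- rexp h m)) * rterms h (c / 2)%R m k)%C).
  2:{ intros k. rewrite RtoC_mult, <- Cmult_assoc. f_equal. unfold rterms. rewrite <- ssum_scal. apply ssum_ext.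
      intros j _. rewrite rterm_odd by auto. ring. }
  rewrite CSeries_scal by apply Csummable_rterms.
  unfold Rside. fold sn.
  replace (RtoC (2 * 4 ^ (p - 1)) * (RtoC (rcoef h (c / 2) m) * (RtoC sn * zeta (RtoC (rexp h m)) +
    CSeries (rterms h (c / 2)%R m))))%C with
   (RtoC (2 * (rcoef h c m * Rpower 2 (- rexp h m))) * (RtoC sn * zeta (RtoC (rexp h m)) +
    CSeries (rterms h (c / 2)%R m)))%C.
  - rewrite !RtoC_mult. ring.
  - rewrite (Cmult_assoc (RtoC (2 * 4 ^ (p - 1)))), <- RtoC_mult. do 2 f_equal.
    unfold rcoef. rewrite kap_half by auto. unfold rexp.
    replace (- (2 * IZR m + 2 - 1 / INR (2 * h + 1))) with (/ INR (2 * h + 1) + (- (2 * IZR m + 1) + - (1))) by (field; lra).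
    rewrite (Rpower_plus (/ INR (2 * h + 1))), Rpower_plus.
    replace (Rpower 2 (- (2 * IZR m + 1))) with (2 * 4 ^ (p - 1)).
    + rewrite (Rpower_Ropp 2 1), Rpower_1 by lra. field. lra.
    + assert (E := neg_scale_pow). rewrite Rpower_Ropp. assert (0 < Rpower 2 (2 * IZR m + 1)) by apply exp_pos.
      apply Rmult_eq_reg_r with (Rpower 2 (2 * IZR m + 1)); [|lra]. rewrite E. field. lra.
Qed.

(** Here the sum is an ordinary one: the pure powers of n cancel between c/2 and c, and what is left
    decays exponentially. The continued zeta value cancels in the same way between the two [Lside],
    so it can be inserted. *)
Lemma neg_sum_f c : 0 < c ->
  CSeries (fun n => RtoC (uu h c n ^ (p - 1) * (2 * fser h (c / 2) n - fser h c n))) =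
  (RtoC (2 * 4 ^ (p - 1)) * Lside zeta h (c / 2)%R m - Lside zeta h c m)%C.
Proof.
  intros Hc. assert (Hc2 : 0 < c / 2) by lra. set (a := Rpower c (- (2 * IZR m + 1))).
  assert (Ea : 2 * 4 ^ (p - 1) * Rpower (c / 2) (- (2 * IZR m + 1)) = a).
  { unfold Rdiv. rewrite <- Rpower_mult_distr by lra. fold a.
    replace (Rpower (/ 2) (- (2 * IZR m + 1))) with (Rpower 2 (2 * IZR m + 1)).
    - replace (2 * 4 ^ (p - 1) * (a * Rpower 2 (2 * IZR m + 1))) with (a * (2 * 4 ^ (p - 1) * Rpower 2 (2 * IZR m + 1))) by ring.
      rewrite neg_scale_pow. ring.
    - replace (/ 2) with (Rpower 2 (- (1))) by (rewrite Rpower_Ropp, Rpower_1 by lra; reflexivity).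
      rewrite Rpower_mult. f_equal. ring. }
  rewrite (CSeries_ext _ (fun n => RtoC a * (RtoC (lterm h (c / 2) m n) - RtoC (lterm h c m n)))%C).
  - rewrite CSeries_scal, CSeries_minus by (try apply Csummable_minus; now apply Csummable_lterm).
    rewrite !CSeries_RtoC. unfold Lside. fold a. rewrite (Cmult_assoc (RtoC (2 * _))), <- RtoC_mult, Ea.
    change (Series (fun n => lterm h c m n)) with (Series (lterm h c m)).
    change (Series (fun n => lterm h (c / 2) m n)) with (Series (lterm h (c / 2) m)). ring.
  - intros n. rewrite <- RtoC_minus, <- RtoC_mult. f_equal.
    transitivity (2 * 4 ^ (p - 1) * (Rpower (uu h (c / 2) n) (- (IZR m + 1)) * fser h (c / 2) n)
       - Rpower (uu h c n) (- (IZR m + 1)) * fser h c n).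
    + rewrite !neg_Rpower by now apply uu_pos. rewrite uu_half, (Rdiv_def (uu h c n) 4), Rpow_mult_distr.
      assert (H4 : 4 ^ (p - 1) * (/ 4) ^ (p - 1) = 1).
      { rewrite <- Rpow_mult_distr, Rinv_r by lra. apply pow1. }
      transitivity (2 * (4 ^ (p - 1) * (/ 4) ^ (p - 1)) * uu h c n ^ (p - 1) * fser h (c / 2) n - uu h c n ^ (p - 1) * fser h c n); [rewrite H4|]; ring.
    + rewrite !fser_weighted by auto. fold a. rewrite <- Rmult_assoc, Ea. ring.
Qed.

Lemma rcoef_double c : 0 < c -> rcoef h (2 ^ (2 * h + 1) * c) m = rcoef h c m / 2.
Proof. intros Hc. unfold rcoef. rewrite kap_double by auto. field. apply Rgt_not_eq, INR_odd_pos. Qed.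

(** The pure powers of k cancel because twice [rcoef] at 2^N c is [rcoef] at c. *)
Lemma neg_sum_g c : 0 < c ->
  CSeries (fun k => RtoC (vv k ^ (p - 1) * (2 * gser h (2 ^ (2 * h + 1) * c) k - gser h c k))) =
  (2 * Rside zeta h (2 ^ (2 * h + 1) * c)%R m - Rside zeta h c m)%C.
Proof.
  intros Hc. set (c' := 2 ^ (2 * h + 1) * c). assert (Hc' : 0 < c') by (apply Rmult_lt_0_compat; auto; apply pow_lt; lra).
  assert (Er : (2 * RtoC (rcoef h c' m))%C = RtoC (rcoef h c m)).
  { unfold c'. rewrite rcoef_double, <- RtoC_mult by auto. f_equal. field. }
  rewrite (CSeries_ext _ (fun k => RtoC (rcoef h c m) * (rterms h c' m k
      - rterms h c m k))%C).
  - rewrite CSeries_scal, CSeries_minus by (try apply Csummable_minus; apply Csummable_rterms).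
    unfold Rside. rewrite (Cmult_assoc 2), Er. ring.
  - intros k. replace (vv k ^ (p - 1) * (2 * gser h c' k - gser h c k)) with
      (2 * (vv k ^ (p - 1) * gser h c' k) - vv k ^ (p - 1) * gser h c k) by ring.
    rewrite <- neg_Rpower by apply vv_pos. rewrite RtoC_minus, (RtoC_mult 2), !gser_weighted by auto.
    rewrite (Cmult_assoc 2), Er. ring.
Qed.

(** The normalised finite sum of the theorem for m < 0: empty for m <= -2, the single term j = 0 for
    m = -1. *)
Let delta : R := if Nat.eqb p 1 then - / 2 else 0.
Let D (c : R) : C := (Lside zeta h c m - RtoC ((-1) ^ p) * Rside zeta h c m - RtoC delta)%C.

(** The exchange contributes delta once, while the relation for the defect asks for (K - 1) delta
    with K = 2 * 4^(p-1); these agree because delta vanishes unless p = 1, where K = 2. *)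
Lemma neg_delta_scale : (2 * 4 ^ (p - 1) - 2) * delta = 0.
Proof.
  unfold delta. destruct (Nat.eqb_spec p 1) as [E|E]; [|ring]. rewrite E. simpl. ring.
Qed.

Lemma neg_delta_sign : (-1) ^ p * delta = - delta.
Proof.
  unfold delta. destruct (Nat.eqb_spec p 1) as [E|E]; [|ring]. rewrite E. simpl. ring.
Qed.

(* Alternation in k amounts to halving c, alternation in n to multiplying c by 2^N. *)
Lemma neg_dilation_half c : 0 < c -> (RtoC (2 * 4 ^ (p - 1)) * D (c / 2)%R = D c)%C.
Proof.
  intros Hc. destruct (exists_nat_ge (3 - rexp h m)) as [r0 Hr0].
  (* Large enough both for the exchange and for Euler summability of the Dirichlet terms. *)
  set (r := (r0 + 2 * (p + 1))%nat).
  assert (Hr : 3 - rexp h m <= INR r) by (unfold r; rewrite plus_INR; generalize (pos_INR (2 * (p + 1))); lra).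
  destruct (regularised_exchange (2 * (2 * h + 1)) 2 (c ^ 2) ((2 * PI) ^ 2) p) with (r := r) as [_ E].
  - lia.
  - lia.
  - now exists 1%nat.
  - now apply pow_lt.
  - apply pow_lt, two_PI_pos.
  - exact Hp.
  - unfold r. lia.
  - change (fun n => c ^ 2 * (INR n + 1) ^ (2 * (2 * h + 1))) with (uu h c) in E.
    rewrite (CSeries_ext _ (fun n => RtoC (uu h c n ^ (p - 1) * (2 * fser h (c / 2) n - fser h c n)))) in E
      by (intros n; now rewrite <- fser_half).
    change (eulsum r _) with (eulsum r (fun k => RtoC (vv k ^ (p - 1) * gser h c k))) in E.
    fold delta in E. rewrite neg_sum_f, neg_eulsum_g in E by auto.
    assert (Hds := f_equal RtoC neg_delta_scale). rewrite !RtoC_mult, RtoC_minus in Hds.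
    set (K := RtoC (2 * 4 ^ (p - 1))) in *.
    unfold D.
    set (L1 := Lside _ _ (c / 2) _) in *. set (L2 := Lside _ _ c _) in *.
    set (R1 := Rside _ _ (c / 2) _) in *. set (R2 := Rside _ _ c _) in *.
    rewrite RtoC_opp in E. set (s := RtoC ((-1) ^ p)) in *.
    replace (K * (L1 - s * R1 - RtoC delta))%C with ((K * L1 - L2) + L2 - s * (K * R1) - K * RtoC delta)%C by ring.
    rewrite E. replace (K * RtoC delta)%C with ((K - RtoC 2) * RtoC delta + 2 * RtoC delta)%C by ring.
    rewrite Hds. ring.
Qed.

Lemma neg_dilation_double c : 0 < c -> (2 * D (2 ^ (2 * h + 1) * c)%R = D c)%C.
Proof.
  intros Hc. destruct (exists_nat_ge (3 - lexp h m)) as [r0 Hr0].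
  set (r := (r0 + 2 * (2 * h + 1) * (p + 1))%nat).
  assert (Hr : 3 - lexp h m <= INR r) by (unfold r; rewrite plus_INR; generalize (pos_INR (2 * (2 * h + 1) * (p + 1))); lra).
  (* The roles of u and v are interchanged: Euler summation runs over n, the ordinary sum over k. *)
  destruct (regularised_exchange 2 (2 * (2 * h + 1)) ((2 * PI) ^ 2) (c ^ 2) p) with (r := r) as [_ E].
  - lia.
  - lia.
  - now exists (2 * h + 1)%nat.
  - apply pow_lt, two_PI_pos.
  - now apply pow_lt.
  - exact Hp.
  - unfold r. lia.
  - rewrite (CSeries_ext _ (fun k => RtoC (vv k ^ (p - 1) * (2 * gser h (2 ^ (2 * h + 1) * c) k - gser h c k)))) in E
      by (intros n; now rewrite <- gser_double).
    replace (eulsum r _) with (eulsum r (fun n => RtoC (uu h c n ^ (p - 1) * fser h c n))) in E.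
    2:{ f_equal. extensionality n. unfold fser. do 4 f_equal. apply Series_ext. intros k.
        fold (vv k). fold (uu h c n). now rewrite Rplus_comm. }
    fold delta in E. rewrite neg_sum_g, neg_eulsum_f in E by auto.
    assert (Hds := f_equal RtoC neg_delta_sign). rewrite RtoC_mult, RtoC_opp in Hds.
    assert (Hss := f_equal RtoC (pow_m1_sqr p)). rewrite RtoC_mult in Hss.
    unfold D. set (c' := 2 ^ (2 * h + 1) * c) in *.
    set (L1 := Lside _ _ c' _) in *. set (L2 := Lside _ _ c _) in *.
    set (R1 := Rside _ _ c' _) in *. set (R2 := Rside _ _ c _) in *.
    rewrite RtoC_opp in E. set (s := RtoC ((-1) ^ p)) in *.
    replace (2 * (L1 - s * R1 - RtoC delta))%C with
      (2 * L1 - s * (2 * R1 - R2) - s * R2 - 2 * RtoC delta)%C by ring.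
    rewrite E.
    replace (s * (- s * (L2 - 2 * L1) + RtoC delta))%C with (- (s * s) * (L2 - 2 * L1) + s * RtoC delta)%C by ring.
    rewrite Hss, Hds. ring.
Qed.

Lemma neg_dilation_iter (i : nat) c : 0 < c -> (RtoC ((2 * 4 ^ (p - 1)) ^ i) * D c = D (2 ^ i * c)%R)%C.
Proof.
  intros Hc. induction i as [|i IH].
  - simpl. rewrite Rmult_1_l. ring.
  - assert (H2 : 0 < 2 ^ i) by (apply pow_lt; lra).
    rewrite <- (neg_dilation_half (2 ^ S i * c)) by (apply Rmult_lt_0_compat; auto; simpl; lra).
    replace (2 ^ S i * c / 2) with (2 ^ i * c) by (simpl; field). rewrite <- IH.
    simpl pow. rewrite RtoC_mult. ring.
Qed.

(* The two dilations act on the defect D by incompatible scalars: D (2^N c) is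
   both D c / 2 and (2 * 4^(p-1))^N D c. *)
Theorem Lside_Rside_neg c : 0 < c ->
  Lside zeta h c m = (RtoC ((-1) ^ p) * Rside zeta h c m + RtoC (if Nat.eqb p 1 then - / 2 else 0))%C.
Proof.
  intros Hc. assert (E := neg_dilation_double c Hc). rewrite <- neg_dilation_iter in E by auto.
  set (K := (2 * 4 ^ (p - 1)) ^ (2 * h + 1)) in *.
  assert (HK : 1 <= K).
  { unfold K. apply pow_R1_Rle. assert (1 <= 4 ^ (p - 1)) by (apply pow_R1_Rle; lra). lra. }
  assert (H0 : (RtoC (2 * K - 1) * D c)%C = 0).
  { rewrite RtoC_minus, RtoC_mult. replace ((2 * RtoC K - 1) * D c)%C with (2 * (RtoC K * D c) - D c)%C by ring.
    rewrite E. ring. }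
  assert (HD : D c = 0).
  { replace (D c) with (/ RtoC (2 * K - 1) * (RtoC (2 * K - 1) * D c))%C.
    - rewrite H0. ring.
    - field. intros E'. apply RtoC_inj in E'. lra. }
  unfold D in HD. fold delta.
  replace (Lside zeta h c m) with (Lside zeta h c m - RtoC ((-1) ^ p) * Rside zeta h c m - RtoC delta +
    (RtoC ((-1) ^ p) * Rside zeta h c m + RtoC delta))%C by ring.
  rewrite HD. ring.
Qed.

End Negative.

(** * The case m > 0 *)

Definition dsummable (f : nat -> nat -> R) : Prop :=
  (forall n, ex_series (fun k => Rabs (f n k))) /\ ex_series (fun n => Series (fun k => Rabs (f n k))).

Definition DSeries (f : nat -> nat -> R) : R := Series (fun n => Series (f n)).

Lemma dsummable_bound (f : nat -> nat -> R) (a b : nat -> R) :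
  (forall n k, Rabs (f n k) <= a n * b k) -> ex_series a -> ex_series b -> dsummable f.
Proof.
  intros H Ha Hb.
  assert (Hr : forall n, ex_series (fun k => Rabs (f n k))).
  { intros n. apply ex_series_bound with (fun k => a n * b k).
    - intros k. rewrite Rabs_Rabsolu. apply H.
    - now apply ex_series_mult_l. }
  split; auto. apply ex_series_bound with (fun n => Series b * a n).
  - intros n. rewrite Rabs_pos_eq by (apply Series_nonneg; auto; intros; apply Rabs_pos).
    rewrite Rmult_comm, <- Series_scal_l. apply Series_le.
    + intros k. split; [apply Rabs_pos|apply H].
    + now apply ex_series_mult_l.
  - now apply ex_series_mult_l.
Qed.

Lemma dsummable_row (f : nat -> nat -> R) : dsummable f -> ex_series (fun n => Series (f n)).
Proof.
  intros [H1 H2]. apply ex_series_bound with (2 := H2). intros n. now apply Series_Rabs.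
Qed.

Lemma DSeries_plus (f g : nat -> nat -> R) : dsummable f -> dsummable g ->
  DSeries (fun n k => f n k + g n k) = DSeries f + DSeries g.
Proof.
  intros Hf Hg. unfold DSeries. rewrite <- Series_plus by now apply dsummable_row.
  apply Series_ext. intros n. apply Series_plus; apply ex_series_Rabs; [apply Hf|apply Hg].
Qed.

Lemma DSeries_swap (f : nat -> nat -> R) : dsummable f -> DSeries (fun k n => f n k) = DSeries f.
Proof. intros [H1 H2]. now apply double_series. Qed.

Lemma DSeries_prod (a b : nat -> R) : DSeries (fun n k => a n * b k) = Series a * Series b.
Proof.
  unfold DSeries. rewrite (Series_ext _ (fun n => Series b * a n)).
  - rewrite Series_scal_l. ring.
  - intros n. rewrite Series_scal_l. ring.
Qed.

(** For a >= 1 this is the sum of u^(-a); at a = 0 it is -1/2 = zeta(0), the value that the extreme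
    term of the Bernoulli sum requires. *)
Definition zeta_even_scaled (h : nat) (c : R) (a : nat) : R :=
  (2 * PI) ^ (2 * ((2 * h + 1) * a)) / c ^ (2 * a) * zeta_even ((2 * h + 1) * a).

Lemma Series_inv_vv (b : nat) : (1 <= b)%nat -> Series (fun k => / vv k ^ b) = zeta_even b.
Proof.
  intros Hb. destruct b as [|b]; [lia|]. unfold zeta_even. apply Series_ext. intros k.
  now rewrite vv_eq, <- pow_mult.
Qed.

Lemma Series_inv_uu h c a : 0 < c -> (1 <= a)%nat -> Series (fun n => / uu h c n ^ a) = zeta_even_scaled h c a.
Proof.
  intros Hc Ha. unfold zeta_even_scaled. remember ((2 * h + 1) * a)%nat as b eqn:Eb.
  destruct b as [|b]; [nia|]. unfold zeta_even. rewrite <- Series_scal_l. apply Series_ext. intros n.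
  rewrite (Rpow_mult_distr (2 * PI)), uu_xx. unfold xx. rewrite <- (pow_mult (c * _)), (Rpow_mult_distr c), <- (pow_mult (INR n + 1)).
  replace ((2 * h + 1) * (2 * a))%nat with (2 * S b)%nat by lia.
  assert (H1 := pow_lt _ (2 * S b) (INR_S_pos n)). assert (H2 := pow_lt _ (2 * S b) two_PI_pos).
  assert (H3 := pow_lt c (2 * a) Hc).
  set (x := (INR n + 1) ^ _) in *. set (y := (2 * PI) ^ _) in *. set (z := c ^ _) in *. field. lra.
Qed.

Section Positive.

Variables (h q : nat) (c : R).
Hypotheses (Hc : 0 < c) (Hq : (1 <= q)%nat).

Lemma ex_series_inv_uu_pow a : (1 <= a)%nat -> ex_series (fun n => / uu h c n ^ a).
Proof.
  intros Ha. apply ex_series_ext with (fun n => / (c ^ (2 * a) * (INR n + 1) ^ (2 * (2 * h + 1) * a))).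
  - intros n. f_equal. unfold uu. rewrite Rpow_mult_distr, <- !pow_mult. reflexivity.
  - apply ex_series_inv_pow; [nia|now apply pow_lt].
Qed.

Lemma ex_series_inv_vv_pow b : (1 <= b)%nat -> ex_series (fun n => / vv n ^ b).
Proof.
  intros Hb. apply ex_series_ext with (fun n => / ((2 * PI) ^ (2 * b) * (INR n + 1) ^ (2 * b))).
  - intros n. f_equal. unfold vv. rewrite (Rpow_mult_distr ((2 * PI) ^ 2)), <- !pow_mult. reflexivity.
  - apply ex_series_inv_pow; [lia|apply pow_lt, two_PI_pos].
Qed.

Let T (a b : nat) (n k : nat) : R := / (uu h c n ^ a * vv k ^ b * (uu h c n + vv k)).

(** The factor u + v is bounded below by u when a = 0 and by v otherwise, so that each variable
    receives a positive power. *)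
Lemma dsummable_T a b : (1 <= a + b)%nat -> dsummable (T a b).
Proof.
  intros Hab.
  assert (HT : forall n k, 0 < uu h c n ^ a /\ 0 < vv k ^ b /\ 0 < uu h c n /\ 0 < vv k).
  { intros n k. assert (Hu := uu_pos h c n Hc). assert (Hv := vv_pos k). repeat split; auto; now apply pow_lt. }
  destruct (Nat.eq_dec a 0) as [->|Ha].
  - apply dsummable_bound with (fun n => / uu h c n ^ 1) (fun k => / vv k ^ b).
    + intros n k. unfold T. destruct (HT n k) as (H1 & H2 & H3 & H4). rewrite <- Rinv_mult.
      rewrite Rabs_pos_eq by (apply Rinv_ge_0; repeat apply Rmult_lt_0_compat; lra).
      apply Rinv_le_contravar; [nra|]. simpl. nra.
    + apply ex_series_inv_uu_pow. lia.
    + apply ex_series_inv_vv_pow. lia.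
  - apply dsummable_bound with (fun n => / uu h c n ^ a) (fun k => / vv k ^ (S b)).
    + intros n k. unfold T. destruct (HT n k) as (H1 & H2 & H3 & H4). rewrite <- Rinv_mult.
      rewrite Rabs_pos_eq by (apply Rinv_ge_0; repeat apply Rmult_lt_0_compat; lra).
      assert (Hp : 0 < uu h c n ^ a * vv k ^ b) by now apply Rmult_lt_0_compat.
      replace (uu h c n ^ a * vv k ^ S b) with (uu h c n ^ a * vv k ^ b * vv k) by (simpl; ring).
      apply Rinv_le_contravar; [nra|]. apply Rmult_le_compat_l; lra.
    + apply ex_series_inv_uu_pow. lia.
    + apply ex_series_inv_vv_pow. lia.
Qed.

(* 1/(u^(a+1) v^(b+1)) = 1/(u^(a+1) v^b (u+v)) + 1/(u^a v^(b+1) (u+v)). *)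
Lemma DSeries_T_step a b :
  DSeries (T (S a) b) = zeta_even_scaled h c (S a) * zeta_even (S b) - DSeries (T a (S b)).
Proof.
  rewrite <- Series_inv_uu, <- Series_inv_vv, <- DSeries_prod by (auto; lia).
  assert (E : DSeries (fun n k => / uu h c n ^ S a * / vv k ^ S b) = DSeries (T (S a) b) + DSeries (T a (S b))).
  { rewrite <- DSeries_plus by (apply dsummable_T; lia).
    unfold DSeries. apply Series_ext. intros n. apply Series_ext. intros k. unfold T.
    assert (Hu := uu_pos h c n Hc). assert (Hv := vv_pos k).
    assert (Hua := pow_lt _ a Hu). assert (Hvb := pow_lt _ b Hv). simpl pow.
    set (x := uu h c n ^ a) in *. set (y := vv k ^ b) in *. field. repeat split; lra. }
  lra.
Qed.

(** Powers move from u to v one at a time, from (q, 0) towards (0, q), with alternating signs. *)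
Lemma DSeries_T_telescope s : (s < q)%nat ->
  DSeries (T q 0) = sum_f_R0 (fun i => (-1) ^ i * (zeta_even_scaled h c (q - i) * zeta_even (S i))) s
    + (-1) ^ (S s) * DSeries (T (q - S s) (S s)).
Proof.
  induction s as [|s IH]; intros Hs.
  - simpl sum_f_R0. replace q with (S (q - 1)) at 1 by lia. rewrite DSeries_T_step.
    rewrite Nat.sub_0_r. replace (S (q - 1)) with q by lia. simpl. ring.
  - rewrite IH by lia. rewrite tech5.
    replace (q - S s)%nat with (S (q - S (S s))) at 1 by lia. rewrite DSeries_T_step.
    replace (S (q - S (S s))) with (q - S s)%nat by lia. simpl pow. ring.
Qed.

(** The telescoping supplies the products with 1 <= j <= q. The constants 1 in [fser] and [gser]
    contribute single zeta sums, which the convention [zeta_even 0] = -1/2 turns into the terms j =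
    0 and j = q + 1. *)
Lemma Series_fser_gser :
  Series (fun n => / uu h c n ^ (S q) * fser h c n) =
  (-1) ^ q * Series (fun k => / vv k ^ (S q) * gser h c k)
  - 2 * sum_f_R0 (fun j => (-1) ^ j * (zeta_even_scaled h c (S q - j) * zeta_even j)) (S q).
Proof.
  assert (HA : Series (fun n => / uu h c n ^ (S q) * fser h c n) = zeta_even_scaled h c (S q) + 2 * DSeries (T q 0)).
  { rewrite <- Series_inv_uu by (auto; lia). unfold DSeries. rewrite <- Series_scal_l, <- Series_plus.
    - apply Series_ext. intros n. unfold fser. rewrite Rmult_plus_distr_l, Rmult_1_r. f_equal.
      rewrite <- !Series_scal_l. apply Series_ext. intros k. unfold T.
      assert (Hu := uu_pos h c n Hc). assert (Hv := vv_pos k). assert (Hua := pow_lt _ q Hu). simpl pow.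
      set (x := uu h c n ^ q) in *. field. repeat split; lra.
    - apply ex_series_inv_uu_pow. lia.
    - apply ex_series_mult_l, dsummable_row, dsummable_T. lia. }
  assert (HB : Series (fun k => / vv k ^ (S q) * gser h c k) = zeta_even (S q) + 2 * DSeries (T 0 q)).
  { rewrite <- (DSeries_swap (T 0 q)) by (apply dsummable_T; lia).
    rewrite <- Series_inv_vv by lia. unfold DSeries. rewrite <- Series_scal_l, <- Series_plus.
    - apply Series_ext. intros k. unfold gser. rewrite Rmult_plus_distr_l, Rmult_1_r. f_equal.
      rewrite <- !Series_scal_l. apply Series_ext. intros n. unfold T.
      assert (Hu := uu_pos h c n Hc). assert (Hv := vv_pos k). assert (Hvb := pow_lt _ q Hv). simpl pow.
      set (x := vv k ^ q) in *. field. repeat split; lra.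
    - apply ex_series_inv_vv_pow. lia.
    - apply ex_series_mult_l. destruct (double_series_nonneg (T 0 q)) as (_ & H & _); auto.
      + intros n k. unfold T. assert (Hu := uu_pos h c n Hc). assert (Hv := vv_pos k).
        apply Rinv_ge_0. repeat apply Rmult_lt_0_compat; try lra; now apply pow_lt.
      + intros n. apply ex_series_Rabs. apply dsummable_T; lia.
      + apply dsummable_row, dsummable_T; lia. }
  rewrite HA, HB. rewrite (DSeries_T_telescope (q - 1)) by lia.
  replace (S (q - 1)) with q by lia. rewrite Nat.sub_diag.
  rewrite (decomp_sum _ (S q)) by lia. simpl pred.
  replace (sum_f_R0 (fun i => (-1) ^ S i * (zeta_even_scaled h c (S q - S i) * zeta_even (S i))) q) with
    (- sum_f_R0 (fun i => (-1) ^ i * (zeta_even_scaled h c (q - i) * zeta_even (S i))) (q - 1)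
      - (-1) ^ q * (zeta_even_scaled h c 0 * zeta_even (S q))).
  - replace (zeta_even_scaled h c 0) with (- / 2).
    + change (zeta_even 0) with (- / 2). rewrite Nat.sub_0_r. simpl pow. field.
    + unfold zeta_even_scaled. rewrite Nat.mul_0_r. simpl. field.
  - replace q with (S (q - 1)) at 4 by lia. rewrite tech5.
    replace (S (q - 1)) with q by lia. simpl (S q - S q)%nat. rewrite Nat.sub_diag.
    rewrite (sum_eq (fun i => (-1) ^ S i * (zeta_even_scaled h c (S q - S i) * zeta_even (S i)))
       (fun i => (-1) ^ i * (zeta_even_scaled h c (q - i) * zeta_even (S i)) * (-1))).
    + rewrite <- scal_sum. simpl pow. ring.
    + intros i _. simpl. ring.
Qed.

End Positive.

(** Both exponents exceed 1, so zeta is replaced by its Dirichlet series and recombined with the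
    Lambert terms under one sum. *)
Theorem Lside_Rside_pos (zeta : C -> C) (h q : nat) (c : R) :
  is_riemann_zeta zeta -> (1 <= q)%nat -> 0 < c ->
  Lside zeta h c (Z.of_nat q) = (RtoC ((-1) ^ q) * Rside zeta h c (Z.of_nat q)
   - RtoC (2 * sum_f_R0 (fun j => (-1) ^ j * (zeta_even_scaled h c (S q - j) * zeta_even j))%R (S q)))%C.
Proof.
  intros Hz Hq Hc. assert (HN := INR_odd_pos h). assert (Hq1 : 1 <= INR q) by (apply (le_INR 1) in Hq; exact Hq).
  assert (HN1 : 1 <= INR (2 * h + 1)) by (apply (le_INR 1); lia).
  assert (Hm : IZR (Z.of_nat q) = INR q) by now rewrite <- INR_IZR_INZ.
  assert (Hpw : forall x, 0 < x -> Rpower x (- (IZR (Z.of_nat q) + 1)) = / x ^ (S q)).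
  { intros x Hx. rewrite Rpower_Ropp, Hm, <- S_INR, Rpower_pow; auto. }
  assert (Hl : 1 < lexp h (Z.of_nat q)) by (unfold lexp; rewrite Hm; nra).
  assert (Hr : 1 < rexp h (Z.of_nat q)).
  { unfold rexp. rewrite Hm. assert (/ INR (2 * h + 1) <= / 1) by (apply Rinv_le_contravar; lra).
    rewrite Rinv_1 in *. unfold Rdiv. lra. }
  set (m := Z.of_nat q) in *.
  destruct (Csummable_dirichlet zeta (RtoC (lexp h m)) Hz Hl) as [Dl1 Dl2].
  destruct (Csummable_dirichlet zeta (RtoC (rexp h m)) Hz Hr) as [Dr1 Dr2].
  assert (HL : Lside zeta h c m = RtoC (Series (fun n => / uu h c n ^ (S q) * fser h c n))).
  { assert (Hlt := Csummable_RtoC _ (ex_series_lterm h c m Hc)).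
    unfold Lside. rewrite <- Dl2, <- (CSeries_RtoC (fun n => / uu h c n ^ (S q) * fser h c n)).
    change (Series (lterm h c m)) with (Series (fun n => lterm h c m n)). rewrite <- (CSeries_RtoC (fun n => lterm h c m n)).
    rewrite <- (CSeries_scal (/ 2)) by auto. rewrite <- CSeries_plus by (auto; now apply Csummable_scal).
    rewrite <- CSeries_scal by (apply Csummable_plus; auto; now apply Csummable_scal).
    apply CSeries_ext. intros n. rewrite <- Hpw by now apply uu_pos. rewrite fser_weighted by auto.
    rewrite dirichlet_R, RtoC_mult, RtoC_plus, RtoC_mult, RtoC_inv by lra. ring. }
  assert (HR : Rside zeta h c m = RtoC (Series (fun k => / vv k ^ (S q) * gser h c k))).
  { unfold Rside. rewrite <- Dr2, <- (CSeries_RtoC (fun k => / vv k ^ (S q) * gser h c k)).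
    rewrite <- (CSeries_scal (RtoC (/ _))) by auto.
    rewrite <- CSeries_plus by (try apply Csummable_rterms; now apply Csummable_scal).
    rewrite <- CSeries_scal by (apply Csummable_plus; [now apply Csummable_scal|apply Csummable_rterms]).
    apply CSeries_ext. intros k. rewrite <- Hpw by apply vv_pos. now rewrite gser_weighted. }
  rewrite HL, HR, <- RtoC_mult, <- RtoC_minus. f_equal. now apply Series_fser_gser.
Qed.

(** * The formula *)

Lemma Csum_Z_csum (f : Z -> C) (b : Z) :
  Csum_Z f 0 b = csum (Z.to_nat (b + 1)) (fun j => f (Z.of_nat j)).
Proof.
  unfold Csum_Z. replace (b - 0 + 1)%Z with (b + 1)%Z by lia.
  destruct (Z.to_nat (b + 1)) as [|n].
  - rewrite sum_n_m_zero by lia. reflexivity.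
  - rewrite <- sum_n_m_S.
    change (sum_n (G := C_AbelianMonoid) (fun k => f (0 + Z.of_nat (S k) - 1)%Z) n = csum (S n) (fun j => f (Z.of_nat j))).
    rewrite sum_n_csum. apply csum_ext. intros k _. f_equal. lia.
Qed.

Lemma RtoC_sum_f_R0 (F : nat -> R) (n : nat) : RtoC (sum_f_R0 F n) = csum (S n) (fun j => RtoC (F j)).
Proof.
  induction n as [|n IH]; [simpl; ring|]. rewrite tech5, RtoC_plus, IH. reflexivity.
Qed.

Lemma powerRZ_m1_opp (p : nat) : powerRZ (-1) (- Z.of_nat p) = (-1) ^ p.
Proof.
  rewrite powerRZ_neg', <- pow_powerRZ.
  assert (E := pow_m1_sqr p). assert (H : (-1) ^ p <> 0) by (intros H; rewrite H in E; lra).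
  apply Rmult_eq_reg_r with ((-1) ^ p); auto. rewrite E. now apply Rinv_l.
Qed.

(** One finite sum covers both signs of m: its length [Z.to_nat (m + 2)] is 0 for m <= -2, and for m
    = -1 its only term is -2 times 1/4, the -1/2 found in the negative case. *)
Lemma Lside_Rside (zeta : C -> C) (h : nat) (c : R) (m : Z) :
  is_riemann_zeta zeta -> m <> 0%Z -> 0 < c ->
  Lside zeta h c m = (RtoC (powerRZ (-1) m) * Rside zeta h c m +
    csum (Z.to_nat (m + 2)) (fun j => RtoC (-2 * ((-1) ^ j *
      (zeta_even_scaled h c (Z.to_nat (m + 1 - Z.of_nat j)) * zeta_even j)))))%C.
Proof.
  intros Hz Hm Hc. destruct (Z_lt_le_dec m 0) as [Hneg|Hpos].
  - set (p := Z.to_nat (- m)). assert (Ep : m = (- Z.of_nat p)%Z) by (unfold p; lia).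
    rewrite (Lside_Rside_neg zeta h p m Hz ltac:(unfold p; lia) Ep c Hc).
    rewrite Ep at 2. rewrite powerRZ_m1_opp. f_equal.
    destruct (Nat.eqb_spec p 1) as [E|E].
    + replace (Z.to_nat (m + 2)) with 1%nat by lia. simpl csum.
      replace (m + 1 - 0)%Z with 0%Z by lia. simpl Z.to_nat. unfold zeta_even_scaled.
      rewrite Nat.mul_0_r. simpl. rewrite Cplus_0_l. f_equal. field.
    + replace (Z.to_nat (m + 2)) with 0%nat by lia. reflexivity.
  - set (q := Z.to_nat m). assert (Eq : m = Z.of_nat q) by (unfold q; lia).
    rewrite Eq. rewrite (Lside_Rside_pos zeta h q c Hz ltac:(unfold q; lia) Hc).
    rewrite <- pow_powerRZ. unfold Cminus. f_equal.
    replace (Z.to_nat (Z.of_nat q + 2)) with (S (S q)) by lia.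
    rewrite <- RtoC_opp, Ropp_mult_distr_l, scal_sum, RtoC_sum_f_R0. apply csum_ext. intros j Hj.
    replace (Z.to_nat (Z.of_nat q + 1 - Z.of_nat j)) with (S q - j)%nat by lia. f_equal. ring.
Qed.

Lemma pow_exp_ln (x : R) (n : nat) : 0 < x -> x ^ n = exp (INR n * ln x).
Proof. intros Hx. now rewrite <- Rpower_pow. Qed.

Section Constants.

Variables (h : nat) (alpha beta : R).
Hypotheses (Ha : 0 < alpha) (Hb : 0 < beta)
  (Hab : alpha * beta ^ (2 * h + 1) = PI ^ (2 * h + 1 + 1)).

Let N := INR (2 * h + 1).
Let c := 2 ^ (2 * h + 1) * alpha.

Lemma const_N_ge_1 : 1 <= N.
Proof. unfold N. apply (le_INR 1). lia. Qed.

Lemma const_c_pos : 0 < c.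
Proof. apply Rmult_lt_0_compat; auto. apply pow_lt; lra. Qed.

(** The relation alpha beta^N = pi^(N+1) solved for ln pi. Comparing constants then amounts to
    linear identities in ln 2, ln alpha and ln beta, which [field] decides. *)
Lemma ln_PI_eq : ln PI = (ln alpha + N * ln beta) / (N + 1).
Proof.
  assert (HN := const_N_ge_1). assert (HPI := PI_RGT_0). assert (E := f_equal ln Hab).
  rewrite ln_mult in E by (auto; now apply pow_lt). rewrite !ln_pow in E by auto.
  rewrite (plus_INR (2 * h + 1) 1) in E. fold N in E. simpl (INR 1) in E.
  apply Rmult_eq_reg_r with (N + 1); [|lra]. field_simplify; lra.
Qed.

Lemma ln_2PI_eq : ln (2 * PI) = ln 2 + (ln alpha + N * ln beta) / (N + 1).
Proof. rewrite ln_mult by (generalize PI_RGT_0; lra). now rewrite ln_PI_eq. Qed.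

Lemma ln_c_eq : ln c = N * ln 2 + ln alpha.
Proof. unfold c. rewrite ln_mult, ln_pow by (auto; try apply pow_lt; lra). reflexivity. Qed.

Lemma kap_eq : kap h c = exp (ln 2 / N + ln beta).
Proof.
  assert (HN := const_N_ge_1). unfold kap, Rpower. fold N. f_equal.
  rewrite ln_div, ln_pow, ln_c_eq, ln_2PI_eq by (try apply const_c_pos; try apply pow_lt; apply two_PI_pos).
  replace (INR (2 * h + 2)) with (N + 1) by (unfold N; rewrite !plus_INR; simpl; ring). field. lra.
Qed.

Let E (m : Z) := (2 * N * IZR m + N - 1) / (N + 1).
(** The factor that had been divided out of both sides, determined by the coefficient of the
    left-hand side. *)
Let K (m : Z) := Rpower alpha (- E m) * Rpower c (2 * IZR m + 1).

Lemma K_lcoef (m : Z) : K m * Rpower c (- (2 * IZR m + 1)) = Rpower alpha (- E m).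
Proof.
  unfold K. rewrite Rmult_assoc, <- Rpower_plus, Rplus_opp_r.
  rewrite Rpower_O by apply const_c_pos. ring.
Qed.

Lemma K_rcoef (m : Z) : K m * rcoef h c m =
  Rpower beta (- E m) * (Rpower 2 ((N - 1) * (2 * IZR m + 1 - 1 / N)) / N).
Proof.
  assert (HN := const_N_ge_1). unfold K, rcoef. fold N. unfold Rdiv. rewrite <- !Rmult_assoc. f_equal.
  rewrite kap_eq. unfold Rpower. rewrite <- !exp_plus. f_equal. rewrite ln_c_eq, ln_2PI_eq.
  unfold E. field. lra.
Qed.

(** Here a stands for m + 1 - j. The 1/2 is what remains of the factor 2 of the finite sum and the
    two factors 1/2 in Euler's evaluation. *)
Lemma K_bernoulli (m : Z) (a j : nat) : IZR m + 1 = INR a + INR j ->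
  K m * ((2 * PI) ^ (2 * ((2 * h + 1) * a)) / c ^ (2 * a)) / 2 =
  Rpower 2 (2 * N * IZR m + N - 1) * (Rpower alpha (2 * INR j / (N + 1)) *
     Rpower beta (2 * N ^ 2 * INR a / (N + 1))).
Proof.
  intros Hm. assert (HN := const_N_ge_1).
  replace (IZR m) with (INR a + INR j - 1) by lra.
  unfold K.
  rewrite (pow_exp_ln (2 * PI)), (pow_exp_ln c) by (apply const_c_pos || apply two_PI_pos).
  unfold Rdiv. rewrite <- exp_Ropp. replace (/ 2) with (exp (- ln 2)) by (rewrite exp_Ropp, exp_ln; lra).
  unfold Rpower. rewrite <- !exp_plus. f_equal. rewrite ln_c_eq, ln_2PI_eq.
  rewrite !mult_INR. fold N. unfold E. replace (IZR m) with (INR a + INR j - 1) by lra.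
  replace (INR 2) with 2 by (simpl; ring). field. lra.
Qed.

End Constants.

(** The sign of [zeta_even j] cancels (-1)^j up to a minus sign, and (-1)^(N a) = (-1)^a because N
    is odd. *)
Lemma is_bernoulli_zeta_product (B : nat -> R) (h a j : nat) (c : R) : is_bernoulli B ->
  -2 * ((-1) ^ j * (zeta_even_scaled h c a * zeta_even j)) =
  - (-1) ^ a * ((2 * PI) ^ (2 * ((2 * h + 1) * a)) / c ^ (2 * a) / 2) *
   (B (2 * j)%nat * B (2 * ((2 * h + 1) * a))%nat
    / (INR (fact (2 * j)) * INR (fact (2 * ((2 * h + 1) * a))))).
Proof.
  intros HB. unfold zeta_even_scaled. rewrite !(is_bernoulli_coef B HB).
  assert (Hj := pow_m1_sqr j).
  assert (Hs : (-1) ^ ((2 * h + 1) * a) = (-1) ^ a).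
  { rewrite Nat.mul_add_distr_r, pow_add, <- Nat.mul_assoc, pow_1_even, Nat.mul_1_l. ring. }
  rewrite <- !(tech_pow_Rmult (-1)), Hs.
  set (P := _ / c ^ _).
  assert (H1 := INR_fact_neq_0 (2 * j)). assert (H2 := INR_fact_neq_0 (2 * ((2 * h + 1) * a))).
  set (f1 := INR (fact (2 * j))) in *. set (f2 := INR (fact (2 * ((2 * h + 1) * a)))) in *.
  set (b1 := B (2 * j)%nat). set (b2 := B _). set (s := (-1) ^ a).
  transitivity (- ((-1) ^ j * (-1) ^ j) * s * (P / 2) * (b1 * b2 / (f1 * f2))).
  - field. auto.
  - rewrite Hj. ring.
Qed.

Theorem theorem2p5 :
  forall (zeta : C -> C) (B : nat -> R),
  is_riemann_zeta zeta -> is_bernoulli B ->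
  forall (N : nat) (alpha beta : R) (m : Z),
  Nat.Odd N -> 0 < alpha -> 0 < beta ->
  alpha * beta ^ N = PI ^ (N + 1) ->
  m <> 0%Z ->
  let h := ((Z.of_nat N - 1) / 2)%Z in
  let term1 := fun n : nat =>
    Rpower (INR n) (- 2 * INR N * IZR m - INR N)
      / (exp ((2 * INR n) ^ N * alpha) - 1) in
  let term2 := fun (j : Z) (n : nat) =>
    (RtoC (Rpower (INR n) (- 2 * IZR m - 2 + 1 / INR N))
      / (Cexp (RtoC (Rpower (2 * INR n) (1 / INR N) * beta)
                 * Cexp (Ci * RtoC (PI * IZR j / INR N))) - 1))%C in
  ex_series (fun n => term1 (S n)) /\
  (forall j : Z, (- h <= j <= h)%Z ->
     ex_series (K := C_AbsRing) (V := C_NormedModule)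
       (fun n => term2 j (S n))) /\
  (RtoC (Rpower alpha (- ((2 * INR N * IZR m + INR N - 1) / (INR N + 1))))
     * (1 / 2 * zeta (RtoC (2 * INR N * IZR m + INR N))
        + RtoC (Series (fun n => term1 (S n))))
   = RtoC (powerRZ (-1) m
           * Rpower beta (- ((2 * INR N * IZR m + INR N - 1) / (INR N + 1)))
           * (Rpower 2 ((INR N - 1) * (2 * IZR m + 1 - 1 / INR N)) / INR N))
     * (1 / 2 * (zeta (RtoC (2 * IZR m + 2 - 1 / INR N))
                 / RtoC (sin (PI / (2 * INR N))))
        + Csum_Z (fun j => Cexp (Ci * RtoC (PI * IZR j / INR N))
                             * CSeries (fun n => term2 j (S n))) (- h) h)
     + RtoC (powerRZ (-1) m * Rpower 2 (2 * INR N * IZR m + INR N - 1))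
       * Csum_Z (fun j =>
           RtoC (powerRZ (-1) j
                 * B (Z.to_nat (2 * j))
                 * B (Z.to_nat (2 * Z.of_nat N * (m - j + 1)))
                 / (INR (fact (Z.to_nat (2 * j)))
                    * INR (fact (Z.to_nat (2 * Z.of_nat N * (m - j + 1)))))
                 * Rpower alpha (2 * IZR j / (INR N + 1))
                 * Rpower beta (2 * INR N ^ 2 * (IZR m - IZR j + 1)
                                / (INR N + 1)))) 0 (m + 1))%C.
Proof.
  intros zeta B Hz HB N alpha beta m [h HN] Ha Hb Hab Hm. subst N.
  set (N := (2 * h + 1)%nat) in *. intros hz term1 term2.
  assert (Eh : hz = Z.of_nat h).
  { unfold hz, N. replace (Z.of_nat (2 * h + 1) - 1)%Z with (Z.of_nat h * 2)%Z by lia. now apply Z.div_mul. }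
  set (c := 2 ^ N * alpha). assert (Hc : 0 < c) by now apply const_c_pos.
  assert (HNp : 1 <= INR N) by apply const_N_ge_1.
  (* The factor 2^N of (2n)^N alpha is absorbed into c, and index n stands for n + 1. *)
  assert (T1 : forall n, term1 (S n) = lterm h c m n).
  { intros n. unfold term1, lterm, lexp, xx. fold N. rewrite S_INR.
    replace (- 2 * INR N * IZR m - INR N) with (- (2 * INR N * IZR m + INR N)) by ring.
    do 3 f_equal. unfold c. rewrite Rpow_mult_distr. ring. }
  assert (T2 : forall j n, term2 j (S n) = rterm h c m j n).
  { intros j n. unfold term2, rterm, rexp, yy, cis, ray_angle. fold N. rewrite S_INR.
    replace (- 2 * IZR m - 2 + 1 / INR N) with (- (2 * IZR m + 2 - 1 / INR N)) by ring.
    replace (Rpower (2 * (INR n + 1)) (1 / INR N) * beta) with (kap h c * Rpower (INR n + 1) (/ INR N)); auto.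
    unfold c, N. rewrite (kap_eq h alpha beta) by auto. fold N. rewrite exp_plus, exp_ln by auto.
    rewrite <- Rpower_mult_distr by (lra || apply INR_S_pos).
    unfold Rdiv. rewrite Rmult_1_l. unfold Rpower. rewrite (Rmult_comm (/ INR N) (ln 2)). ring. }
  split; [|split].
  - apply ex_series_ext with (lterm h c m); [intros; symmetry; apply T1|].
    now apply ex_series_Rabs, ex_series_lterm.
  - intros j Hj. apply Csummable_ex_series.
    apply Csummable_ext with (rterm h c m j); [intros; symmetry; apply T2|].
    apply Csummable_rterm. lia.
  - rewrite (Series_ext _ (lterm h c m)) by apply T1.
    rewrite Eh, Csum_Z_ssum.
    rewrite (ssum_ext h _ (fun j => CSeries (fun n => cis (ray_angle h j) * rterm h c m j n)%C)).
    2:{ intros j Hj. rewrite CSeries_scal by now apply Csummable_rterm.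
        unfold cis, ray_angle. fold N. f_equal. apply CSeries_ext. intros; apply T2. }
    destruct (ssum_CSeries h (fun j n => cis (ray_angle h j) * rterm h c m j n)%C) as [_ ->].
    { intros j Hj. now apply Csummable_scal, Csummable_rterm. }
    change (fun k => ssum h (fun j => cis (ray_angle h j) * rterm h c m j k)%C) with (rterms h c m).
    set (E := (2 * INR N * IZR m + INR N - 1) / (INR N + 1)).
    (* Multiplication by this factor restores the coefficients of the statement. *)
    set (K := Rpower alpha (- E) * Rpower c (2 * IZR m + 1)).
    assert (HKl : K * Rpower c (- (2 * IZR m + 1)) = Rpower alpha (- E)) by (apply (K_lcoef h alpha Ha m)).
    assert (HKr : K * rcoef h c m = Rpower beta (- E) * (Rpower 2 ((INR N - 1) * (2 * IZR m + 1 - 1 / INR N)) / INR N))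
      by (apply (K_rcoef h alpha beta Ha Hb Hab m)).
    assert (Hcore := Lside_Rside zeta h c m Hz Hm Hc).
    apply (f_equal (Cmult (RtoC K))) in Hcore.
    unfold Lside, Rside in Hcore. fold N in Hcore.
    change (lexp h m) with (2 * INR N * IZR m + INR N) in Hcore.
    change (rexp h m) with (2 * IZR m + 2 - 1 / INR N) in Hcore.
    rewrite Cmult_assoc, <- RtoC_mult, HKl in Hcore.
    replace (1 / 2)%C with (/ 2)%C by (field).
    rewrite Hcore, Cmult_plus_distr_l. f_equal.
    + rewrite (Rmult_assoc (powerRZ (-1) m)), <- HKr, !RtoC_mult.
      assert (Hs : sin (PI / (2 * INR N)) <> 0).
      { apply Rgt_not_eq, sin_gt_0; generalize PI_RGT_0; intros.
        - apply Rdiv_lt_0_compat; lra.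
        - apply Rlt_div_l; nra. }
      rewrite Rinv_mult, RtoC_mult, !RtoC_inv by (auto; lra).
      unfold Cdiv. ring.
    + rewrite Csum_Z_csum, <- !csum_scal. replace (m + 1 + 1)%Z with (m + 2)%Z by lia.
      apply csum_ext. intros j Hj. rewrite <- !RtoC_mult. f_equal.
      set (a := Z.to_nat (m + 1 - Z.of_nat j)).
      assert (Ea : (m + 1 = Z.of_nat a + Z.of_nat j)%Z) by (unfold a; lia).
      assert (EaR : IZR m + 1 = INR a + INR j) by (rewrite !INR_IZR_INZ, <- !plus_IZR; now f_equal).
      rewrite (is_bernoulli_zeta_product B) by auto. fold N.
      replace (Z.to_nat (2 * Z.of_nat j)) with (2 * j)%nat by lia.
      replace (Z.to_nat (2 * Z.of_nat N * (m - Z.of_nat j + 1))) with (2 * (N * a))%nat.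
      2:{ replace (m - Z.of_nat j + 1)%Z with (Z.of_nat a) by lia. lia. }
      rewrite <- INR_IZR_INZ, <- pow_powerRZ.
      replace (IZR m - INR j + 1) with (INR a) by lra.
      set (b := B (2 * j)%nat * B (2 * (N * a))%nat / (INR (fact (2 * j)) * INR (fact (2 * (N * a))))).
      assert (HKb : K * ((2 * PI) ^ (2 * (N * a)) / c ^ (2 * a)) / 2 =
        Rpower 2 (2 * INR N * IZR m + INR N - 1) * (Rpower alpha (2 * INR j / (INR N + 1)) *
          Rpower beta (2 * INR N ^ 2 * INR a / (INR N + 1))))
        by exact (K_bernoulli h alpha beta Ha Hb Hab m a j EaR).
      (* A parity count from a + j = m + 1. *)
      assert (Hsgn : - (-1) ^ a = powerRZ (-1) m * (-1) ^ j).
      { assert (Ej := pow_m1_sqr j).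
        assert (Hp : powerRZ (-1) m * powerRZ (-1) 1 = (-1) ^ a * (-1) ^ j).
        { rewrite !pow_powerRZ, <- !powerRZ_add by lra. now f_equal. }
        rewrite powerRZ_1 in Hp.
        transitivity (- ((-1) ^ a * (-1) ^ j) * (-1) ^ j); [|rewrite <- Hp; ring].
        transitivity (- (-1) ^ a * ((-1) ^ j * (-1) ^ j)); [rewrite Ej|]; ring. }
      rewrite Hsgn.
      transitivity (powerRZ (-1) m * (-1) ^ j * b * (K * ((2 * PI) ^ (2 * (N * a)) / c ^ (2 * a)) / 2)).
      * unfold Rdiv. ring.
      * rewrite HKb. unfold b, Rdiv. ring.
Qed.
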